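(* Let $n\ge 3$ and $\Lambda<0$. Let $\mathcal H$ be the completion of $C^\infty_c((0,\infty),\mathbb C)$ with respect to the norm induced by the bilinear form \[ B(w,\tilde w)=\int_0^\infty\Big\{\frac 1{32}\frac{n^2}{n-1}\bar w'\tilde w'+n|\Lambda| t^2\bar w\tilde w\Big\}\,dt, \] and let $K(w,\tilde w)=\int_0^\infty t^{2-\frac4n}\bar w\tilde w\,dt$. Then the generalized eigenvalue problem \[ B(w,\varphi)=\lambda K(w,\varphi)\quad\forall\,\varphi\in\mathcal H \] (equivalently, $-\frac1{32} \frac{n^2}{n-1}\ddot w+n|\Lambda| t^2w=\lambda t^{2-\frac4n}w$ in $H^{1,2}_0((0,\infty))$) has countably many solutions $(w_i,\lambda_i)$ such that $0<\lambda_0<\lambda_1<\lambda_2<\cdots$, $\lim_i\lambda_i=\infty$, and $K(w_i,w_j)=\delta_{ij}$. The $w_i$ are complete in $\mathcal H$ as well as in $L^2((0,\infty))$. *)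

(* Defs.v *)
From HB Require Import structures.
From mathcomp Require Import all_boot all_order all_algebra.
From mathcomp Require Import all_classical all_reals all_analysis.
From mathcomp Require Import complex.
Set Implicit Arguments. Unset Strict Implicit. Unset Printing Implicit Defensive.
Import Order.TTheory GRing.Theory Num.Theory numFieldNormedType.Exports.
Local Open Scope classical_set_scope.
Local Open Scope ring_scope.

Section Defs.
Variable R : realType.
Local Notation C := (R[i]).

Definition smoothR (u : R -> R) : Prop :=
  forall (k : nat) (x : R), derivable (derive1n k u) x 1.

Definition test_fun (w : R -> C) : Prop :=
  [/\ smoothR (fun t => complex.Re (w t)), smoothR (fun t => complex.Im (w t)) &
      exists a b : R, 0 < a /\ a <= b /\
        (forall t, t < a \/ b < t -> w t = 0)].

Definition cder (w : R -> C) : R -> C :=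
  fun t => Complex (derive1 (fun s => complex.Re (w s)) t) (derive1 (fun s => complex.Im (w s)) t).

Definition cint (f : R -> C) : C :=
  Complex (\int[lebesgue_measure]_(t in `](0:R), +oo[) complex.Re (f t))
          (\int[lebesgue_measure]_(t in `](0:R), +oo[) complex.Im (f t)).

Definition Bform (n : nat) (Lam : R) (w w' : R -> C) : C :=
  cint (fun t =>
    (Complex ((1 / 32) * (n%:R ^+ 2 / (n%:R - 1))) 0) * (conjc (cder w t) * cder w' t)
    + (Complex (n%:R * `|Lam| * t ^+ 2) 0) * (conjc (w t) * w' t)).

Definition Kform (n : nat) (w w' : R -> C) : C :=
  cint (fun t => (Complex (powR t (2 - 4 / n%:R)) 0) * (conjc (w t) * w' t)).

Definition Bnorm (n : nat) (Lam : R) (w : R -> C) : R :=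
  Num.sqrt (complex.Re (Bform n Lam w w)).

(* elements of the completion H: Cauchy sequences (w.r.t. the B-norm) of
   test functions; they are compared/evaluated only through the limits below *)
Definition inH (n : nat) (Lam : R) (s : nat -> R -> C) : Prop :=
  (forall k, test_fun (s k)) /\
  (forall e : R, 0 < e -> exists N : nat, forall k l : nat, (N <= k)%N -> (N <= l)%N ->
      Bnorm n Lam (fun t => s k t - s l t) < e).

Definition limR (u : nat -> R) : R := lim (u @ \oo).

Definition limC (u : nat -> C) : C :=
  Complex (limR (fun k => complex.Re (u k))) (limR (fun k => complex.Im (u k))).

(* the forms B and K extended by continuity to the completion H *)
Definition BH (n : nat) (Lam : R) (s s' : nat -> R -> C) : C :=
  limC (fun k => Bform n Lam (s k) (s' k)).
Definition KH (n : nat) (s s' : nat -> R -> C) : C :=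
  limC (fun k => Kform n (s k) (s' k)).
Definition BHnorm (n : nat) (Lam : R) (s : nat -> R -> C) : R :=
  Num.sqrt (complex.Re (BH n Lam s s)).

Definition lincomb (N : nat) (c : nat -> C) (w : nat -> nat -> R -> C) :
  nat -> R -> C :=
  fun k t => \sum_(i < N) c i * w i k t.

Definition inL2 (f : R -> C) : Prop :=
  [/\ measurable_fun `](0:R), +oo[ (fun t => complex.Re (f t)),
      measurable_fun `](0:R), +oo[ (fun t => complex.Im (f t)) &
      lebesgue_measure.-integrable `](0:R), +oo[
        (fun t => ((complex.Re (f t)) ^+ 2 + (complex.Im (f t)) ^+ 2)%:E)].

Definition L2norm (f : R -> C) : R :=
  Num.sqrt (\int[lebesgue_measure]_(t in `](0:R), +oo[) ((complex.Re (f t)) ^+ 2 + (complex.Im (f t)) ^+ 2)).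

End Defs.

(* Main.v *)
Require Import Defs.
From HB Require Import structures.
From mathcomp Require Import all_boot all_order all_algebra.
From mathcomp Require Import all_classical all_reals all_analysis.
From mathcomp Require Import complex.
From mathcomp Require Import measurable_realfun.
From mathcomp Require Import ring lra.
Import Order.TTheory GRing.Theory Num.Theory numFieldNormedType.Exports.
Local Open Scope classical_set_scope.
Local Open Scope ring_scope.

(* Idea.  Splitting into real and imaginary parts reduces everything to real
   test functions.  With E the energy form and K the weighted form, the
   eigenpairs are found in the abstract completion of (test functions, E) by
   minimising the Rayleigh quotient E/K recursively on the K-orthogonal
   complement of the previous eigenvectors: the parallelogram law makes a
   K-Cauchy minimising sequence E-Cauchy, and E-bounded sequences have K-Cauchy
   subsequences because K <= eps E + C sum_j u(t_j)^2 for finitely many points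
   t_j.  Expansions converge in energy because E(u, phi)^2 <= C_phi K(u, u) for
   each test function phi (integrate by parts).  Eigenvalues are simple: testing
   the weak equation with smoothed hat functions bounds second divided
   differences of an eigenfunction u by its sup norm, so u(0) = u(T) = 0 for a
   small T forces u = 0, and two eigenfunctions with the same eigenvalue have a
   nontrivial combination vanishing at T.  Finally the energy controls the L2
   norm and test functions are dense in L2. *)

Set Implicit Arguments. Unset Strict Implicit. Unset Printing Implicit Defensive.

(** * Semi-inner products *)

(** The completion is never turned into a space of functions: its elements remain Cauchy sequences
    of test functions. Embeddings and traces are replaced by the bound u(x)^2 <= x E(u,u) / al,
    which makes evaluation at every x >= 0 continuous for the energy. It feeds the compactness
    argument and provides the pointwise limit to which the uniqueness argument applies. The exponent
    p = 2 - 4/n satisfies 0 <= p < 2. At infinity t^p is therefore negligible against the potential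
    t^2, which is why cutting the half-line at a large T leaves only a remainder eps E. For
    simplicity of eigenvalues, the classical proof would compare u'(0) for two solutions. A weak
    solution has no derivative at 0 to speak of, so the second condition is placed at a small T > 0
    instead, and second divided differences take the role of u''. Uniqueness then rests on a sup
    norm that is at most half of itself, first on [0, T], then on short steps to the right. The
    eigenvectors are real; complex coefficients in the expansions account for complex functions. *)

Lemma real_cauchy_cvg (R : realType) (u : nat -> R) :
  (forall e : R, 0 < e -> exists N : nat, forall k l : nat,
     (N <= k)%N -> (N <= l)%N -> `|u k - u l| < e) -> cvg (u @ \oo).
Proof.
move=> cu; apply/cauchy_cvgP/cauchy_exP => e e0; have [N HN] := cu e e0.
by exists (u N); exists N => // k /= Nk; exact: HN.
Qed.

Lemma discriminant_le (R : realType) (a b c : R) : 0 <= a -> 0 <= c ->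
  (forall t, 0 <= a + 2 * t * b + t ^+ 2 * c) -> b ^+ 2 <= a * c.
Proof.
move=> a0; rewrite le_eqVlt => /orP[/eqP <-|c0] H.
  rewrite mulr0; have [->|n0] := eqVneq b 0; first by rewrite expr0n.
  (* At this [t] the quadratic takes the value [a - (1 + a) = -1], so with [c = 0] a nonzero [b] is
     impossible. *)
  have := H (- (1 + a) / (2 * b)); rewrite mulr0 addr0.
  have -> : 2 * (- (1 + a) / (2 * b)) * b = - (1 + a) by field.
  by lra.
have := H (- b / c).
have -> : a + 2 * (- b / c) * b + (- b / c) ^+ 2 * c = (a * c - b ^+ 2) / c.
  by field; rewrite gt_eqF.
by rewrite pmulr_lge0 ?invr_gt0// subr_ge0.
Qed.

Section SemiInner.
Variables (R : realType) (E : lmodType R).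

Record semi_inner (f : E -> E -> R) : Prop := SemiInner {
  sipC : forall u v, f u v = f v u;
  sipP : forall a u v w, f (a *: u + v) w = a * f u w + f v w;
  sip_ge0 : forall u, 0 <= f u u }.

Variables (f : E -> E -> R) (sf : semi_inner f).

Lemma sipDl u v w : f (u + v) w = f u w + f v w.
Proof. by rewrite -[u]scale1r (sipP sf) mul1r scale1r. Qed.

Lemma sip0l w : f 0 w = 0.
Proof. by apply: (addIr (f 0 w)); rewrite -sipDl addr0 add0r. Qed.

Lemma sipZl a u w : f (a *: u) w = a * f u w.
Proof. by rewrite -[a *: u]addr0 (sipP sf) sip0l addr0. Qed.

Lemma sipNl u w : f (- u) w = - f u w.
Proof. by rewrite -scaleN1r sipZl mulN1r. Qed.

Lemma sipBl u v w : f (u - v) w = f u w - f v w.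
Proof. by rewrite sipDl sipNl. Qed.

Lemma sip_suml (I : Type) (r : seq I) (P : pred I) (F : I -> E) w :
  f (\sum_(i <- r | P i) F i) w = \sum_(i <- r | P i) f (F i) w.
Proof.
elim/big_rec2: _ => [|i x y _ <-]; first exact: sip0l.
by rewrite sipDl.
Qed.

Lemma sipDr u v w : f w (u + v) = f w u + f w v.
Proof. by rewrite !(sipC sf w) sipDl. Qed.
Lemma sip0r w : f w 0 = 0. Proof. by rewrite (sipC sf) sip0l. Qed.
Lemma sipZr a u w : f w (a *: u) = a * f w u.
Proof. by rewrite !(sipC sf w) sipZl. Qed.
Lemma sipNr u w : f w (- u) = - f w u.
Proof. by rewrite !(sipC sf w) sipNl. Qed.
Lemma sipBr u v w : f w (u - v) = f w u - f w v.
Proof. by rewrite !(sipC sf w) sipBl. Qed.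
Lemma sip_sumr (I : Type) (r : seq I) (P : pred I) (F : I -> E) w :
  f w (\sum_(i <- r | P i) F i) = \sum_(i <- r | P i) f w (F i).
Proof. by rewrite (sipC sf) sip_suml; apply: eq_bigr => i _; rewrite (sipC sf). Qed.

Definition sipE := (sipDl, sipBl, sipNl, sipZl, sipDr, sipBr, sipNr, sipZr).

Lemma sip_sqrD u v : f (u + v) (u + v) = f u u + 2 * f u v + f v v.
Proof. by rewrite !sipE (sipC sf v u); ring. Qed.

Lemma sip_sqrB u v : f (u - v) (u - v) = f u u - 2 * f u v + f v v.
Proof. by rewrite !sipE (sipC sf v u); ring. Qed.

Lemma sip_sqrZ a u : f (a *: u) (a *: u) = a ^+ 2 * f u u.
Proof. by rewrite !sipE; ring. Qed.

Lemma sip_parallelogram u v :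
  f (u - v) (u - v) = 2 * f u u + 2 * f v v - f (u + v) (u + v).
Proof. by rewrite sip_sqrB sip_sqrD; ring. Qed.

Lemma sip_distC u v : f (u - v) (u - v) = f (v - u) (v - u).
Proof. by rewrite -opprB sipNl sipNr opprK. Qed.

Lemma sip_sqrD_le u v : f (u + v) (u + v) <= 2 * f u u + 2 * f v v.
Proof.
have := sip_ge0 sf (u - v); rewrite sip_parallelogram subr_ge0; exact: id.
Qed.

Lemma sip_CauchySchwarz u v : f u v ^+ 2 <= f u u * f v v.
Proof.
apply: discriminant_le => [||t]; rewrite ?(sip_ge0 sf)//.
have := sip_ge0 sf (u + t *: v); rewrite sip_sqrD sip_sqrZ sipZr.
by rewrite mulrA.
Qed.

Definition sipn u := Num.sqrt (f u u).

Lemma sipn_ge0 u : 0 <= sipn u. Proof. exact: sqrtr_ge0. Qed.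

Lemma sqr_sipn u : sipn u ^+ 2 = f u u.
Proof. by rewrite sqr_sqrtr // (sip_ge0 sf). Qed.

Lemma ler_norm_sip u v : `|f u v| <= sipn u * sipn v.
Proof.
rewrite -sqrtrM ?(sip_ge0 sf)// -sqrtr_sqr ler_sqrt ?mulr_ge0 ?(sip_ge0 sf)//.
exact: sip_CauchySchwarz.
Qed.

Lemma sipnD u v : sipn (u + v) <= sipn u + sipn v.
Proof.
rewrite -(@ler_pXn2r _ 2)// ?nnegrE ?addr_ge0 ?sipn_ge0// sqrrD !sqr_sipn.
rewrite sip_sqrD mulrC -mulr_natr.
have := ler_norm_sip u v; have := ler_norm (f u v); lra.
Qed.

Definition sip_cauchy (s : nat -> E) := forall e : R, 0 < e ->
  exists N : nat, forall k l : nat, (N <= k)%N -> (N <= l)%N ->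
    f (s k - s l) (s k - s l) < e.

Definition sip_cvg (s : nat -> E) (u : E) := forall e : R, 0 < e ->
  exists N : nat, forall k : nat, (N <= k)%N -> f (s k - u) (s k - u) < e.

Lemma sip_cauchy_sipn s : sip_cauchy s -> forall e : R, 0 < e ->
  exists N : nat, forall k l : nat, (N <= k)%N -> (N <= l)%N ->
    sipn (s k - s l) < e.
Proof.
move=> cs e e0; have [N HN] := cs (e ^+ 2) (exprn_gt0 2 e0).
exists N => k l Nk Nl; rewrite -(@ltr_pXn2r _ 2)// ?nnegrE ?sipn_ge0 ?ltW//.
by rewrite sqr_sipn; exact: HN.
Qed.

Lemma sip_cauchy_bound s : sip_cauchy s -> exists2 M, 0 < M & forall k, sipn (s k) <= M.
Proof.
move=> /sip_cauchy_sipn cs; have [N HN] := cs 1 ltr01.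
have Hm k : sipn (s k) <= \sum_(i < N) sipn (s i) + (sipn (s N) + 1).
  have [kN|Nk] := ltnP k N.
    rewrite (bigD1 (Ordinal kN)) //= -addrA lerDl addr_ge0 ?addr_ge0 ?sipn_ge0//.
    by apply: sumr_ge0 => i _; exact: sipn_ge0.
  apply: (@le_trans _ _ (sipn (s N) + 1)).
    have := sipnD (s k - s N) (s N); rewrite subrK.
    have := HN k N Nk (leqnn N); lra.
  by rewrite lerDr sumr_ge0 // => i _; exact: sipn_ge0.
exists (\sum_(i < N) sipn (s i) + (sipn (s N) + 1)) => //.
rewrite ltr_wpDl ?sumr_ge0 // => [i _|]; first exact: sipn_ge0.
by rewrite ltr_wpDl ?sipn_ge0.
Qed.

Lemma sip_cauchy_cvg s s' : sip_cauchy s -> sip_cauchy s' ->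
  cvg ((fun k => f (s k) (s' k)) @ \oo).
Proof.
move=> cs cs'; apply: real_cauchy_cvg => e e0.
have [M M0 HM] := sip_cauchy_bound cs; have [M' M'0 HM'] := sip_cauchy_bound cs'.
have [N HN] := sip_cauchy_sipn cs (divr_gt0 e0 (mulr_gt0 (ltr0Sn R 1) M'0)).
have [N' HN'] := sip_cauchy_sipn cs' (divr_gt0 e0 (mulr_gt0 (ltr0Sn R 1) M0)).
exists (maxn N N') => k l kN lN.
have -> : f (s k) (s' k) - f (s l) (s' l) =
  f (s k - s l) (s' k) + f (s l) (s' k - s' l) by rewrite !sipE; ring.
move: kN lN; rewrite !geq_max => /andP[k1 k2] /andP[l1 l2].
apply: (le_lt_trans (ler_normD _ _)).
have h1 : `|f (s k - s l) (s' k)| <= sipn (s k - s l) * M'.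
  by apply: (le_trans (ler_norm_sip _ _)); rewrite ler_wpM2l ?sipn_ge0.
have h2 : `|f (s l) (s' k - s' l)| <= M * sipn (s' k - s' l).
  by apply: (le_trans (ler_norm_sip _ _)); rewrite ler_wpM2r ?sipn_ge0.
have h3 : sipn (s k - s l) * M' < e / 2.
  have := HN k l k1 l1; rewrite ltr_pdivlMr ?mulr_gt0// => h; lra.
have h4 : M * sipn (s' k - s' l) < e / 2.
  have := HN' k l k2 l2; rewrite ltr_pdivlMr ?mulr_gt0// => h; lra.
lra.
Qed.

Lemma sip_cauchyP s a s' : sip_cauchy s -> sip_cauchy s' -> sip_cauchy (a *: s + s').
Proof.
move=> cs cs' e e0.
(* The [+ 1] keeps the divisor positive when [a = 0]. *)
have a0 : 0 < 4 * (a ^+ 2 + 1) :> R by rewrite mulr_gt0// ltr_wpDl ?sqr_ge0.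
have [N HN] := cs _ (divr_gt0 e0 a0).
have [N' HN'] := cs' _ (divr_gt0 e0 (ltr0Sn R 3)).
exists (maxn N N') => k l; rewrite !geq_max => /andP[k1 k2] /andP[l1 l2].
rewrite (_ : (a *: s + s') k - (a *: s + s') l = a *: (s k - s l) + (s' k - s' l)).
  apply: (le_lt_trans (sip_sqrD_le _ _)); rewrite sip_sqrZ.
  have := HN k l k1 l1; have := HN' k l k2 l2; have := sip_ge0 sf (s k - s l).
  rewrite !ltr_pdivlMr//.
  set x := f _ _; set y := f _ _ => x0 y0; rewrite mulrA; nra.
by rewrite scalerBr addrACA -opprD.
Qed.

Lemma sip_cvg_lim s u v : sip_cvg s u -> (fun k => f (s k) v) @ \oo --> f u v.
Proof.
move=> cs; apply/cvgrPdist_lt => e e0.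
have c0 : 0 < f v v + 1 by rewrite ltr_wpDl ?(sip_ge0 sf).
have [N HN] := cs _ (divr_gt0 (exprn_gt0 2 e0) c0).
exists N => // k /= Nk; rewrite distrC -sipBl.
rewrite -(@ltr_pXn2r _ 2)// ?nnegrE ?ltW// real_normK ?num_real//.
apply: (le_lt_trans (sip_CauchySchwarz _ _)).
have := HN k Nk; rewrite ltr_pdivlMr//; have := sip_ge0 sf (s k - u); nra.
Qed.

Lemma sip_cvg_sqr s u : sip_cvg s u -> (fun k => f (s k) (s k)) @ \oo --> f u u.
Proof.
move=> cs; have c : (fun k => f (s k) u) @ \oo --> f u u by exact: sip_cvg_lim.
have c2 : (fun k => f (s k - u) (s k - u)) @ \oo --> (0 : R).
  apply/cvgrPdist_lt => e e0; have [N HN] := cs _ e0.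
  by exists N => // k /= Nk; rewrite sub0r normrN ger0_norm ?(sip_ge0 sf)// HN.
have -> : (fun k => f (s k) (s k)) =
  (fun k => f (s k - u) (s k - u) + 2 * f (s k) u - f u u).
  by apply/funext => k; rewrite sip_sqrB; ring.
suff H : (fun k => f (s k - u) (s k - u) + 2 * f (s k) u - f u u) @ \oo -->
    0 + 2 * f u u - f u u.
  by apply: cvg_trans H _; rewrite (_ : 0 + _ - _ = f u u)//; ring.
by apply: cvgB; [apply: cvgD => //; exact: cvgMl_tmp|exact: cvg_cst].
Qed.

End SemiInner.

(** * Spectral theorem by minimisation *)

Lemma invS_lt (R : realType) (e : R) : 0 < e ->
  exists N : nat, forall k : nat, (N <= k)%N -> k.+1%:R^-1 < e.
Proof.
move=> e0; have [N _ HN] := near_infty_natSinv_lt (PosNum e0).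
by exists N => k; exact: HN.
Qed.

Section Spectral.
Variables (R : realType) (E : lmodType R) (B K : E -> E -> R).
Hypotheses (sB : semi_inner B) (sK : semi_inner K).
Variables (C : R) (C0 : 0 < C).
Hypothesis KB : forall u, K u u <= C * B u u.
Hypothesis complete : forall s, sip_cauchy B s -> exists u, sip_cvg B s u.
Hypothesis compact : forall s M, (forall k, B (s k) (s k) <= M) ->
  exists g : nat -> nat, (forall k, (k <= g k)%N) /\ sip_cauchy K (s \o g).
(** The second condition makes [B _ d] continuous for [K]: such a [d] lies in the domain of the
    operator that represents [B] with respect to [K]. For these vectors, smallness of a residual in
    [K] can be converted into smallness of its energy. *)
Hypothesis dense : forall u (e : R), 0 < e -> exists2 d, B (u - d) (u - d) < e &
  exists c, forall v, B v d ^+ 2 <= c * K v v.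
Hypothesis infdim : forall m : nat, exists f : nat -> E, forall i j,
  (i <= m)%N -> (j <= m)%N -> K (f i) (f j) = (i == j)%:R.

Definition eigenvector (u : E) (l : R) := forall phi, B u phi = l * K u phi.

(** Linear dependence is expressed by a combination of [K]-length zero because the forms need not be
    definite. For [K]-orthonormal [u] and [v] this is already contradictory. *)
Hypothesis simple : forall u v l, eigenvector u l -> eigenvector v l ->
  exists a b, (a != 0) || (b != 0) /\
    K (a *: u + b *: v) (a *: u + b *: v) = 0.

Lemma sip_cvg_weaker s u : sip_cvg B s u -> sip_cvg K s u.
Proof.
move=> cs e e0; have [N HN] := cs _ (divr_gt0 e0 C0).
exists N => k Nk; apply: (le_lt_trans (KB _)).
by have := HN k Nk; rewrite ltr_pdivlMr// mulrC.
Qed.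

Definition orthon m (w : nat -> E) := forall i j, (i < m)%N -> (j < m)%N ->
  K (w i) (w j) = (i == j)%:R.

Definition residual m (w : nat -> E) u := u - \sum_(i < m) K u (w i) *: w i.

Lemma residual_orth m w u : orthon m w ->
  forall j, (j < m)%N -> K (residual m w u) (w j) = 0.
Proof.
move=> ow j jm; rewrite /residual (sipBl sK) (sip_suml sK).
rewrite (bigD1 (Ordinal jm))//= (sipZl sK) ow// eqxx mulr1 big1 ?addr0 ?subrr//.
by move=> i /negPf ij; rewrite (sipZl sK) ow//= (_ : (i == j :> nat) = false) ?mulr0.
Qed.

Lemma residual_sqr m w u : orthon m w ->
  K (residual m w u) (residual m w u) = K u u - \sum_(i < m) K u (w i) ^+ 2.
Proof.
move=> ow; rewrite {2}/residual (sipBr sK) (sip_sumr sK).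
rewrite [X in _ - X]big1 ?subr0 => [|i _]; last first.
  by rewrite (sipZr sK) residual_orth ?mulr0.
rewrite /residual (sipBl sK) (sip_suml sK); congr (_ - _).
by apply: eq_bigr => i _; rewrite (sipZl sK) (sipC sK (w i)) expr2.
Qed.

Lemma bessel m w u : orthon m w -> \sum_(i < m) K u (w i) ^+ 2 <= K u u.
Proof. by move=> ow; rewrite -subr_ge0 -residual_sqr// (sip_ge0 sK). Qed.

(** A dimension count by double summation. If all residuals of the [m.+1] orthonormal vectors [f j]
    had length zero, the squares [K (f j) (w i) ^+ 2] would sum to at least [m.+1], whereas Bessel's
    inequality for the family [f], applied to each unit vector [w i], bounds the same sum by [m]. *)
Lemma exists_unit_orth m w : orthon m w ->
  exists2 u, (forall j, (j < m)%N -> K u (w j) = 0) & K u u = 1.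
Proof.
move=> ow; have [f Hf] := infdim m.
have [j Hj] : exists j : 'I_m.+1, 0 < K (residual m w (f j)) (residual m w (f j)).
  apply: contrapT => /forallNP H.
  have E1 (j : 'I_m.+1) : 1 <= \sum_(i < m) K (f j) (w i) ^+ 2.
    have Kj : K (f j) (f j) = 1 by rewrite Hf ?leq_ord// eqxx.
    rewrite -subr_le0 -[X in X - _]Kj -residual_sqr// leNgt.
    exact/negP/H.
  have : (m.+1%:R : R) <= m%:R.
    have -> : (m.+1%:R : R) = \sum_(j < m.+1) 1 by rewrite sumr_const card_ord.
    have -> : (m%:R : R) = \sum_(i < m) 1 by rewrite sumr_const card_ord.
    apply: (@le_trans _ _ (\sum_(j < m.+1) \sum_(i < m) K (f j) (w i) ^+ 2)).
      by apply: ler_sum => j _; exact: E1.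
    rewrite exchange_big /=; apply: ler_sum => i _.
    have Ki : K (w i) (w i) = 1 by rewrite ow ?eqxx.
    rewrite -[leRHS]Ki.
    under eq_bigr do rewrite (sipC sK).
    by apply: (@bessel m.+1 f (w i)) => j k jm km; exact: Hf.
  by rewrite ler_nat ltnn.
set v := residual m w (f j) in Hj.
exists ((sipn K v)^-1 *: v) => [i im|].
  by rewrite (sipZl sK) /v residual_orth ?mulr0.
by rewrite (sip_sqrZ sK) exprVn (sqr_sipn sK) mulVf ?gt_eqF.
Qed.

(** [P] stands for the [K]-orthogonal complement of the eigenvectors already found; linearity and
    closedness are all that enters. The equation is the first variation at the minimiser, hence it
    comes out only against vectors of [P]. *)
Lemma rayleigh_min (P : E -> Prop) :
  (forall a u v, P u -> P v -> P (a *: u + v)) ->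
  (forall s u, (forall k, P (s k)) -> sip_cvg B s u -> P u) ->
  (exists2 u, P u & K u u = 1) ->
  exists u l, [/\ P u, K u u = 1, (forall phi, P phi -> B u phi = l * K u phi) &
    (forall phi, P phi -> l * K phi phi <= B phi phi)].
Proof.
move=> Plin Pclosed [u0 Pu0 K0].
have P0 : P 0.
  by have := Plin (-1) _ _ Pu0 Pu0; rewrite scaleN1r addNr.
have PZ a u : P u -> P (a *: u) by move=> Pu; rewrite -[_ *: _]addr0; exact: Plin.
pose S := [set B v v | v in [set v | P v /\ K v v = 1]].
have lS : has_lbound S by exists 0 => _ [v _ <-]; exact: (sip_ge0 sB).
have iS : has_inf S by split => //; exists (B u0 u0), u0.
pose l := inf S.
have l0 : 0 <= l.
  by apply: lb_le_inf; [case: iS|move=> _ [v _ <-]; exact: (sip_ge0 sB)].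
have lmin phi : P phi -> l * K phi phi <= B phi phi.
  move=> Pp; have := sip_ge0 sK phi; rewrite le_eqVlt => /orP[/eqP<-|Kp].
    by rewrite mulr0 (sip_ge0 sB).
  have : l <= B ((sipn K phi)^-1 *: phi) ((sipn K phi)^-1 *: phi).
    apply: ge_inf => //; exists ((sipn K phi)^-1 *: phi) => //; split; first exact: PZ.
    by rewrite (sip_sqrZ sK) exprVn (sqr_sipn sK) mulVf ?gt_eqF.
  by rewrite (sip_sqrZ sB) exprVn (sqr_sipn sK) mulrC ler_pdivlMr.
have Hs (k : nat) : exists v, [/\ P v, K v v = 1 & B v v < l + k.+1%:R^-1].
  have k0 : 0 < k.+1%:R^-1 :> R by rewrite invr_gt0.
  by have [_ [v [Pv Kv] <-] Bv] := inf_adherent k0 iS; exists v.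
have [s {}Hs] := choice Hs.
have [g [gk cg]] : exists g : nat -> nat, (forall k, (k <= g k)%N) /\ sip_cauchy K (s \o g).
  apply: (@compact _ (l + 1)) => k; have [_ _ /ltW h] := Hs k.
  by apply: (le_trans h); rewrite lerD2l invf_le1// ler1n.
pose t := s \o g.
have Pt k : P (t k) by case: (Hs (g k)).
have Kt k : K (t k) (t k) = 1 by case: (Hs (g k)).
have Bt k : B (t k) (t k) < l + k.+1%:R^-1.
  have [_ _ h] := Hs (g k); apply: (lt_le_trans h).
  by rewrite lerD2l lef_pV2 ?posrE// ler_nat ltnS.
(* For unit vectors the squared [K]-length of [t k + t j] is 4 minus that of [t k - t j]. With the
   minimality of [l], the squared energy distance of [t k] and [t j] is below [2 / k.+1 + 2 / j.+1]
   plus [l] times their squared [K]-distance; the tolerances [e / 8] and [e / (2 * (l + 1))] bring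
   this below [e]. *)
have cB : sip_cauchy B t.
  move=> e e0; have l10 : 0 < 2 * (l + 1) by rewrite mulr_gt0// ltr_wpDl.
  have [N HN] := invS_lt (divr_gt0 e0 (ltr0Sn R 7)).
  have [N' HN'] := cg _ (divr_gt0 e0 l10).
  exists (maxn N N') => k j; rewrite !geq_max => /andP[k1 k2] /andP[j1 j2].
  have h1 := HN k k1; have h2 := HN j j1.
  have h3 : K (t k - t j) (t k - t j) < _ := HN' k j k2 j2.
  have h4 := lmin (1 *: t k + t j) (Plin _ _ _ (Pt k) (Pt j)).
  have h5 := sip_parallelogram sK (t k) (t j).
  rewrite scale1r in h4; rewrite ltr_pdivlMr// in h3.
  have h6 := sip_ge0 sK (t k - t j).
  rewrite (sip_parallelogram sB); have := Bt k; have := Bt j.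
  rewrite !Kt in h5.
  have : l * K (t k + t j) (t k + t j) = 4 * l - l * K (t k - t j) (t k - t j).
    by rewrite h5; ring.
  have : l * K (t k - t j) (t k - t j) * 2 <= K (t k - t j) (t k - t j) * (2 * (l + 1)).
    by nra.
  move: h3 h4 h1 h2; rewrite !ltr_pdivlMr//.
  move: (k.+1%:R^-1) (j.+1%:R^-1) (l * K (t k - t j) _) (l * K (t k + t j) _) => x y z z1.
  lra.
have [u cu] := complete cB; exists u, l.
have Pu : P u by exact: (Pclosed t).
have Ku : K u u = 1.
  have /cvg_lim := sip_cvg_sqr sK (sip_cvg_weaker cu) => <-//.
  by under eq_fun do rewrite Kt; rewrite lim_cst.
have Bu : B u u = l.
  apply/eqP; rewrite eq_le; apply/andP; split; last first.
    by have := lmin u Pu; rewrite Ku mulr1.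
  apply/ler_addgt0Pr => e e0.
  have cb := sip_cvg_sqr sB cu.
  have /cvg_lim <-// := cb.
  apply: limr_le; first by apply/cvg_ex; exists (B u u).
  have [N HN] := invS_lt e0; exists N => // k /= Nk.
  by apply: ltW; apply: (lt_trans (Bt k)); rewrite ltrD2l HN.
split => // phi Pp.
set b := B u phi - l * K u phi.
suff : b = 0 by rewrite /b => /eqP; rewrite subr_eq0 => /eqP.
set c := B phi phi - l * K phi phi.
have c0 : 0 <= c by rewrite subr_ge0 lmin.
have H x : 0 <= 2 * x * b + x ^+ 2 * c.
  have := lmin (x *: phi + u) (Plin _ _ _ Pp Pu).
  rewrite addrC !(sip_sqrD sB, sip_sqrD sK) !(sip_sqrZ sB, sip_sqrZ sK).
  rewrite !(sipZr sB, sipZr sK) Bu Ku -subr_ge0.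
  by congr (0 <= _); rewrite /b /c; ring.
(* [B - l K] is nonnegative on [P] and vanishes at [u], so its linear part [b] in the direction
   [phi] must be 0. The divisor [c + 1] replaces [c], which may be 0. *)
have := H (- b / (c + 1)).
have c1 : 0 < c + 1 by rewrite ltr_wpDl.
have -> : 2 * (- b / (c + 1)) * b + (- b / (c + 1)) ^+ 2 * c =
  - (b ^+ 2 * ((c + 2) / (c + 1) ^+ 2)) by field; rewrite gt_eqF.
rewrite oppr_ge0 pmulr_lle0 ?divr_gt0 ?exprn_gt0 ?ltr_wpDl// => h.
by apply/eqP; rewrite -sqrf_eq0 eq_le h sqr_ge0.
Qed.

Definition eigen_family m (x : nat -> E * R) :=
  orthon m (fst \o x) /\ forall i, (i < m)%N -> eigenvector (x i).1 (x i).2.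

(** The minimality clause is kept beside the equation: it gives the ordering of the eigenvalues and,
    applied to residuals, the convergence of expansions. *)
Definition next_eigenpair m (x : nat -> E * R) (p : E * R) :=
  [/\ K p.1 p.1 = 1, forall i, (i < m)%N -> K p.1 (x i).1 = 0,
      eigenvector p.1 p.2 &
      forall phi, (forall i, (i < m)%N -> K phi (x i).1 = 0) ->
        p.2 * K phi phi <= B phi phi].

Lemma next_eigenpair_ex m x : eigen_family m x -> exists p, next_eigenpair m x p.
Proof.
move=> [ox ex]; pose P u := forall i, (i < m)%N -> K u (x i).1 = 0.
have [|||u [l [Pu Ku Hu Hl]]] := @rayleigh_min P.
- by move=> a u v Pu Pv i im; rewrite (sipP sK) Pu// Pv// mulr0 addr0.
- move=> s u Ps cu i im.
  have /cvg_lim := sip_cvg_lim (v := (x i).1) sK (sip_cvg_weaker cu) => <-//.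
  by under eq_fun do rewrite Ps//; rewrite lim_cst.
- exact: (exists_unit_orth ox).
exists (u, l); split => // phi.
(* The equation holds for the residual of [phi]. The part subtracted contributes nothing:
   [K u (x i).1 = 0] by orthogonality, and then [B u (x i).1 = 0] too because [x i] is an
   eigenpair. *)
have := Hu _ (residual_orth phi ox); rewrite /residual.
rewrite !(sipBr sB, sipBr sK, sip_sumr sB, sip_sumr sK).
rewrite big1 => [|i _]; last first.
  by rewrite (sipZr sB) (sipC sB) /= ex// (sipC sK (x i).1 u) Pu// !mulr0.
rewrite big1 => [|i _]; last by rewrite (sipZr sK) /= Pu// mulr0.
by rewrite !subr0.
Qed.

Lemma eigen_sequence : exists x : nat -> E * R,
  forall m, eigen_family m x /\ next_eigenpair m x (x m).
Proof.
have ex (mx : nat * (nat -> E * R)) : exists p,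
    eigen_family mx.1 mx.2 -> next_eigenpair mx.1 mx.2 p.
  have [h|h] := pselect (eigen_family mx.1 mx.2); last by exists (0, 0).
  by have [p Hp] := next_eigenpair_ex h; exists p.
have [F HF] := choice ex.
pose p0 : E * R := (0, 0).
(* Each choice depends on all earlier ones, so the recursion builds the list of the first [m] pairs
   and [x] reads off its entries. [F] is total because the condition on the family is a premise
   inside the existential. *)
pose s := fix s m := if m is m'.+1 then rcons (s m') (F (m', nth p0 (s m'))) else [::].
pose x i := F (i, nth p0 (s i)).
have ss m : size (s m) = m by elim: m => [|m IH] //=; rewrite size_rcons IH.
have sx m i : (i < m)%N -> nth p0 (s m) i = x i.
  elim: m => [|m IH] //=; rewrite ltnS leq_eqVlt => /orP[/eqP ->|im].
    by rewrite nth_rcons ss ltnn eqxx.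
  by rewrite nth_rcons ss im IH.
have next m : eigen_family m x -> next_eigenpair m x (x m).
  move=> [oo ee]; have [|h1 h2 h3 h4] := HF (m, nth p0 (s m)).
    by split => [i j im jm|i im] /=; rewrite !sx//; [exact: oo|exact: ee].
  split => // [i im|phi Hphi]; first by rewrite -(sx m i)//; exact: h2.
  by apply: h4 => i im; rewrite [(_, _).2 i]sx//; exact: Hphi.
have fam m : eigen_family m x.
  elim: m => [|m [oo ee]]; first by split.
  have [h1 h2 h3 _] := next m (conj oo ee).
  split => [i j|i]; rewrite !ltnS leq_eqVlt.
    move=> /orP[/eqP ->|im]; rewrite leq_eqVlt => /orP[/eqP ->|jm] /=.
    - by rewrite eqxx h1.
    - by rewrite h2// gtn_eqF.
    - by rewrite (sipC sK) h2// ltn_eqF.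
    - exact: oo.
  by move=> /orP[/eqP ->//|im]; exact: ee.
by exists x => m; split => //; exact: next.
Qed.

Theorem spectral : exists (w : nat -> E) (lam : nat -> R),
  [/\ forall i, eigenvector (w i) (lam i),
      [/\ 0 < lam 0%N, forall i, lam i < lam i.+1 & lam @ \oo --> +oo],
      forall i j, K (w i) (w j) = (i == j)%:R &
      forall phi e, 0 < e -> exists N (c : nat -> R),
        B (phi - \sum_(i < N) c i *: w i) (phi - \sum_(i < N) c i *: w i) < e].
Proof.
have [x Hx] := eigen_sequence; pose w i := (x i).1; pose lam i := (x i).2.
have ow i j : K (w i) (w j) = (i == j)%:R.
  have [[oo _] _] := Hx (maxn i j).+1.
  by apply: oo; rewrite ltnS ?leq_maxl ?leq_maxr.
have ew i : eigenvector (w i) (lam i) by have [_ []] := Hx i.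
have omw m : orthon m w by move=> i j _ _; exact: ow.
(* The weak inequality holds because [w i.+1] competes in the minimisation that produced [lam i].
   Equality would yield [a ^+ 2 + b ^+ 2 = 0] for coefficients that are not both 0. *)
have mono i : lam i < lam i.+1.
  rewrite lt_neqAle; apply/andP; split; last first.
    have [_ [_ _ _ h]] := Hx i; have [_ [k1 k2 e _]] := Hx i.+1.
    have := h (w i.+1); rewrite ew {1}[in X in X -> _]/w ow eqxx !mulr1; apply.
    by move=> j ji; rewrite ow gtn_eqF// ltnW.
  apply/negP => /eqP eql.
  have ew2 : eigenvector (w i.+1) (lam i) by rewrite eql; exact: ew.
  have [a [b [ab]]] := simple (ew i) ew2.
  rewrite !(sipE sK) !ow !eqxx (gtn_eqF (ltnSn i)) (ltn_eqF (ltnSn i)) !mulr0 addr0 add0r !mulr1.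
  move=> h; move: ab; have : a ^+ 2 + b ^+ 2 = 0 by rewrite -h; ring.
  move=> /eqP; rewrite paddr_eq0 ?sqr_ge0// !sqrf_eq0 => /andP[/eqP-> /eqP->].
  by rewrite eqxx.
have homo_lam : {homo lam : i j / (i <= j)%N >-> i <= j}.
  by apply: homo_leq => [//|? ? ?|i]; [exact: le_trans|exact: ltW].
have Bw i : B (w i) (w i) = lam i by rewrite ew ow eqxx mulr1.
have lam0 : 0 < lam 0%N.
  rewrite -Bw -(pmulr_rgt0 _ C0); apply: (lt_le_trans _ (KB _)).
  by rewrite ow eqxx ltr01.
(* If the eigenvalues did not tend to infinity they would be bounded, and [w] would have a
   [K]-Cauchy subsequence; but distinct orthonormal vectors are at squared distance 2. *)
have lamy : lam @ \oo --> +oo.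
  apply/cvgryPge => A; apply: contrapT => nA.
  have bd k : B (w k) (w k) <= A.
    rewrite leNgt; apply/negP => Ak; apply: nA; exists k => // j /= kj.
    by rewrite (le_trans (ltW Ak))// Bw homo_lam.
  have [g [gk cg]] := compact bd; have [N HN] := cg 1 ltr01.
  have := HN N (g N).+1 (leqnn _) (leq_trans (gk N) (leqnSn _)).
  rewrite /= (sip_sqrB sK) !ow !eqxx ltn_eqF ?gk// mulr0 subr0.
  by rewrite -[_ + _]/(2 : R) ltNge ler1n.
exists w, lam; split => // phi e e0.
pose r N u := residual N w u.
(* For an eigenvector, [K]-orthogonality implies [B]-orthogonality. Hence [r N] is a [B]-orthogonal
   projection and does not increase the energy. *)
have rortho N u (i : 'I_N) : B (r N u) (w i) = 0.
  by rewrite (sipC sB) ew (sipC sK) residual_orth ?mulr0.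
have rB N u v : B (r N u) v = B (r N u) (r N v).
  rewrite {3}/r/residual (sipBr sB) (sip_sumr sB) big1 ?subr0// => i _.
  by rewrite (sipZr sB) rortho mulr0.
have rle N u : B (r N u) (r N u) <= B u u.
  have := sip_ge0 sB (u - r N u); rewrite (sip_sqrB sB) (sipC sB u) rB; lra.
have rK N u : lam N * K (r N u) (r N u) <= B (r N u) (r N u).
  have [_ [_ _ _ h]] := Hx N; apply: h => i iN; exact: residual_orth.
have [d dphi [c Hc]] := dense phi (divr_gt0 e0 (ltr0Sn R 3)).
pose c' := `|c| + 1; have c'0 : 0 < c' by rewrite ltr_wpDl.
have Bd0 : 0 < B d d + 1 by rewrite ltr_wpDl// (sip_ge0 sB).
(* The energy [b] of [r N d] equals [B (r N d) d], so [b ^+ 2 <= c' * K (r N d) (r N d)], while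
   [lam N * K (r N d) (r N d) <= B d d]. A large [lam N] therefore makes [b] small. *)
have [N HN] : exists N, c' * (B d d + 1) / (e / 4) ^+ 2 < lam N.
  move/cvgryPgt : lamy => /(_ (c' * (B d d + 1) / (e / 4) ^+ 2)) [N _ HN].
  by exists N; apply: HN => /=.
exists N, (fun i => K phi (w i)); rewrite -/(residual N w phi) -/(r N phi).
have rD : r N phi = r N (phi - d) + r N d.
  rewrite /r /residual addrACA subrK -opprD -big_split /=; congr (_ - _).
  by apply: eq_bigr => i _; rewrite -scalerDl -(sipDl sK) subrK.
rewrite rD; apply: (le_lt_trans (sip_sqrD_le sB _ _)).
have h1 := rle N (phi - d).
suff : B (r N d) (r N d) <= e / 4 by lra.
set b := B (r N d) (r N d).
have lN0 : 0 < lam N by apply: (lt_le_trans lam0); exact: homo_lam.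
have h2 : b ^+ 2 <= c' * K (r N d) (r N d).
  rewrite /b -rB; apply: (le_trans (Hc _)).
  by rewrite ler_wpM2r ?(sip_ge0 sK)// (le_trans (ler_norm c))// lerDl.
have h3 : lam N * K (r N d) (r N d) <= B d d + 1.
  by have := rK N d; have := rle N d; lra.
have b0 : 0 <= b by exact: (sip_ge0 sB).
have e40 : 0 <= e / 4 by rewrite divr_ge0 ?ltW.
rewrite -(@ler_pXn2r _ 2)// ?nnegrE//.
have e4 : 0 < (e / 4) ^+ 2 by rewrite exprn_gt0// divr_gt0.
move: HN; rewrite ltr_pdivrMr// => HN.
rewrite -(ler_pM2l lN0); apply: ltW; apply: le_lt_trans HN.
apply: (@le_trans _ _ (c' * (lam N * K (r N d) (r N d)))).
  by rewrite [leRHS]mulrCA ler_pM2l.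
by rewrite ler_pM2l.
Qed.

End Spectral.

(** * Completion *)

Lemma sip_cauchy_close (R : realType) (E : lmodType R) (f : E -> E -> R)
    (sf : semi_inner f) (s t : nat -> E) : sip_cauchy f t ->
  (forall e, 0 < e -> exists N : nat, forall k, (N <= k)%N ->
     f (s k - t k) (s k - t k) < e) -> sip_cauchy f s.
Proof.
move=> ct cst e e0; have e9 : 0 < e / 10 by rewrite divr_gt0.
have [N HN] := ct _ e9; have [N' HN'] := cst _ e9.
exists (maxn N N') => k l; rewrite !geq_max => /andP[k1 k2] /andP[l1 l2].
have -> : s k - s l = (s k - t k) + ((t k - t l) - (s l - t l)).
  by rewrite opprB !subrKA.
apply: (le_lt_trans (sip_sqrD_le sf _ _)).
have := sip_sqrD_le sf (t k - t l) (- (s l - t l)).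
rewrite (sipNl sf) (sipNr sf) opprK.
by have := HN k l k1 l1; have := HN' k k2; have := HN' l l2; lra.
Qed.

Section Completion.
Variables (R : realType) (V : lmodType R) (B : V -> V -> R) (sB : semi_inner B).

(* No quotient by null sequences is needed: semi-inner products do not have to be
   definite.  The unused argument makes the instances below depend on [sB]. *)
Definition cauchy_seqs of semi_inner B : {pred nat -> V} :=
  fun s => `[< sip_cauchy B s >].

Lemma cauchy_seqs_submod_closed : submod_closed (cauchy_seqs sB).
Proof.
split.
  by apply/asboolP => e e0; exists 0%N => k l _ _; rewrite subrr (sip0l sB).
by move=> a s t /asboolP cs /asboolP ct; apply/asboolP; exact: sip_cauchyP.
Qed.

HB.instance Definition _ := GRing.isSubmodClosed.Build R (nat -> V)
  (cauchy_seqs sB) cauchy_seqs_submod_closed.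

Record completion := Completion {
  cauchy_val : nat -> V; cauchy_valP : cauchy_val \in cauchy_seqs sB }.

HB.instance Definition _ := [isSub for cauchy_val].
HB.instance Definition _ := [Choice of completion by <:].
HB.instance Definition _ := [SubChoice_isSubLmodule of completion by <:].

Lemma completion_cauchy (s : completion) : sip_cauchy B (val s).
Proof. exact/asboolP/cauchy_valP. Qed.

Lemma completion_ex (s : nat -> V) : sip_cauchy B s ->
  exists S : completion, val S = s.
Proof. by move=> /asboolP cs; exists (Completion cs). Qed.

Definition extend (f : V -> V -> R) (s t : completion) : R :=
  lim ((fun k => f (val s k) (val t k)) @ \oo).

Section Extend.
Variables (f : V -> V -> R) (sf : semi_inner f) (C : R) (C0 : 0 < C).
Hypothesis fB : forall u, f u u <= C * B u u.

Lemma sip_cauchy_weaker s : sip_cauchy B s -> sip_cauchy f s.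
Proof.
move=> cs e e0; have [N HN] := cs _ (divr_gt0 e0 C0).
exists N => k l Nk Nl; apply: (le_lt_trans (fB _)).
by have := HN k l Nk Nl; rewrite ltr_pdivlMr// mulrC.
Qed.

Lemma extend_cvg s t : (fun k => f (val s k) (val t k)) @ \oo --> extend f s t.
Proof.
by apply: (sip_cauchy_cvg sf); apply: sip_cauchy_weaker; exact: completion_cauchy.
Qed.

Lemma extend_eq s t l : (fun k => f (val s k) (val t k)) @ \oo --> l ->
  extend f s t = l.
Proof. by move=> h; apply/cvg_lim. Qed.

Lemma extend_semi_inner : semi_inner (extend f).
Proof.
split.
- by move=> s t; rewrite /extend; under eq_fun do rewrite (sipC sf).
- move=> a s t u; apply: extend_eq.
  rewrite linearP /=; under eq_fun do rewrite (sipP sf).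
  by apply: cvgD; [apply: cvgMl_tmp|]; exact: extend_cvg.
- move=> s; apply: limr_ge; first by apply/cvg_ex; eexists; exact: extend_cvg.
  by apply: nearW => k; exact: (sip_ge0 sf).
Qed.

Lemma extend_le s : extend f s s <= C * extend B s s.
Proof.
have cB : (fun k => C * B (val s k) (val s k)) @ \oo --> C * extend B s s.
  by apply: cvgMl_tmp; apply: (sip_cauchy_cvg sB); exact: completion_cauchy.
have /cvg_lim <-// := cB.
apply: ler_lim; [by apply/cvg_ex; eexists; exact: extend_cvg| |].
  by apply/cvg_ex; eexists; exact: cB.
by apply: nearW => k; exact: fB.
Qed.

Lemma extend_sqr_le s e : (exists N : nat, forall k, (N <= k)%N ->
  f (val s k) (val s k) <= e) -> extend f s s <= e.
Proof.
move=> [N HN]; apply: limr_le; first by apply/cvg_ex; eexists; exact: extend_cvg.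
by exists N => // k /= Nk; exact: HN.
Qed.

End Extend.

Lemma const_cauchy (v : V) : sip_cauchy B (fun=> v).
Proof. by move=> e e0; exists 0%N => k l _ _; rewrite subrr (sip0l sB). Qed.

Definition iota_completion (v : V) : completion :=
  Completion (asboolT (const_cauchy v)).

Lemma extend_iota f u v : extend f (iota_completion u) (iota_completion v) = f u v.
Proof. by rewrite /extend /= lim_cst. Qed.

Lemma iota_completionB u v :
  iota_completion (u - v) = iota_completion u - iota_completion v.
Proof. exact/val_inj. Qed.

Let B_le : forall u, B u u <= 1 * B u u. Proof. by move=> u; rewrite mul1r. Qed.

Let sBE : semi_inner (extend B). Proof. exact: (extend_semi_inner sB ltr01 B_le). Qed.

Lemma completion_approx s (e : R) : 0 < e -> exists v,
  extend B (s - iota_completion v) (s - iota_completion v) < e.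
Proof.
move=> e0; have e2 : 0 < e / 2 by rewrite divr_gt0.
have [N HN] := completion_cauchy s e2; exists (val s N).
apply: (@le_lt_trans _ _ (e / 2)); last lra.
apply: (extend_sqr_le sB ltr01 B_le); exists N => k Nk.
exact/ltW/HN.
Qed.

Lemma completion_approx_seq (S : nat -> completion) : exists v : nat -> V,
  forall k, extend B (S k - iota_completion (v k)) (S k - iota_completion (v k))
    < k.+1%:R^-1.
Proof.
have H k : exists v : V,
    extend B (S k - iota_completion v) (S k - iota_completion v) < k.+1%:R^-1.
  by apply: completion_approx; rewrite invr_gt0.
by have [v Hv] := choice H; exists v.
Qed.

(** Each [S k] is replaced by one vector [v k] of [V] at squared distance below [1 / k.+1]. The
    sequence [v] is Cauchy in [V], and this sequence is itself the limit sought. *)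
Lemma completion_complete (S : nat -> completion) : sip_cauchy (extend B) S ->
  exists u, sip_cvg (extend B) S u.
Proof.
move=> cS; have [v Hv] := completion_approx_seq S.
have ci : sip_cauchy (extend B) (iota_completion \o v).
  apply: (sip_cauchy_close sBE cS) => e e0; have [N HN] := invS_lt e0.
  by exists N => k Nk; rewrite (sip_distC sBE); apply: (lt_trans (Hv k)); exact: HN.
have cv : sip_cauchy B v.
  move=> e e0; have [N HN] := ci e e0; exists N => k l Nk Nl.
  by have := HN k l Nk Nl; rewrite /= -iota_completionB extend_iota.
have [u uv] := completion_ex cv; exists u => e e0.
have e9 : 0 < e / 5 by rewrite divr_gt0.
have [N HN] := cv _ e9; have [N' HN'] := invS_lt e9.
exists (maxn N N') => k; rewrite !geq_max => /andP[k1 k2].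
rewrite -(subrK (iota_completion (v k)) (S k)) -addrA.
apply: (le_lt_trans (sip_sqrD_le sBE _ _)).
have h1 := lt_trans (Hv k) (HN' k k2).
suff : extend B (iota_completion (v k) - u) (iota_completion (v k) - u) <= e / 5.
  by lra.
apply: (extend_sqr_le sB ltr01 B_le); exists N => l Nl.
by rewrite linearB /= uv; apply/ltW/HN.
Qed.

Variables (K : V -> V -> R) (sK : semi_inner K) (C : R) (C0 : 0 < C).
Hypothesis KB : forall u, K u u <= C * B u u.
Hypothesis compactV : forall s M, (forall k, B (s k) (s k) <= M) ->
  exists g : nat -> nat, (forall k, (k <= g k)%N) /\ sip_cauchy K (s \o g).
Hypothesis denseV : forall d, exists c, forall v, B v d ^+ 2 <= c * K v v.
Hypothesis infdimV : forall m : nat, exists f : nat -> V, forall i j,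
  (i <= m)%N -> (j <= m)%N -> K (f i) (f j) = (i == j)%:R.
(** The weak equation is demanded in the limit and against fixed vectors of [V], the form in which
    it can be exploited on a representing sequence. *)
Hypothesis simpleV : forall s t l, sip_cauchy B s -> sip_cauchy B t ->
  (forall phi, (fun k => B (s k) phi - l * K (s k) phi) @ \oo --> (0 : R)) ->
  (forall phi, (fun k => B (t k) phi - l * K (t k) phi) @ \oo --> (0 : R)) ->
  exists a b, (a != 0) || (b != 0) /\
    (fun k => K (a *: s k + b *: t k) (a *: s k + b *: t k)) @ \oo --> (0 : R).

Let sKE : semi_inner (extend K). Proof. exact: (extend_semi_inner sK C0 KB). Qed.

Lemma completion_compact (S : nat -> completion) M :
  (forall k, extend B (S k) (S k) <= M) ->
  exists g : nat -> nat, (forall k, (k <= g k)%N) /\ sip_cauchy (extend K) (S \o g).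
Proof.
move=> SM; have [v Hv] := completion_approx_seq S.
have vM k : B (v k) (v k) <= 2 * M + 2.
  rewrite -extend_iota -(subrK (S k) (iota_completion _)).
  apply: (le_trans (sip_sqrD_le sBE _ _)).
  rewrite (sip_distC sBE); have := Hv k; have := SM k.
  have : k.+1%:R^-1 <= 1 :> R by rewrite invf_le1// ler1n.
  by move: (k.+1%:R^-1) => x; lra.
have [g [gk cg]] := compactV vM; exists g; split => //.
have ci : sip_cauchy (extend K) (iota_completion \o v \o g).
  move=> e e0; have [N HN] := cg e e0; exists N => k l Nk Nl /=.
  by rewrite -iota_completionB extend_iota; exact: HN.
apply: (sip_cauchy_close sKE ci) => e e0.
have [N HN] := invS_lt (divr_gt0 e0 C0); exists N => k Nk /=.
apply: (le_lt_trans (extend_le sK C0 KB _)); rewrite mulrC -ltr_pdivlMr//.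
by apply: (lt_trans (Hv _)); apply: HN; exact: leq_trans (gk k).
Qed.

Lemma extend_const_cvg (f : V -> V -> R) (sf : semi_inner f) (D : R) :
  0 < D -> (forall u, f u u <= D * B u u) -> forall s v,
  (fun k => f (val s k) v) @ \oo --> extend f s (iota_completion v).
Proof. by move=> D0 fB s v; exact: (extend_cvg (t := iota_completion v) sf D0 fB). Qed.

Lemma completion_dense (u : completion) (e : R) : 0 < e ->
  exists2 d, extend B (u - d) (u - d) < e &
  exists c, forall v, extend B v d ^+ 2 <= c * extend K v v.
Proof.
move=> e0; have [d Hd] := completion_approx u e0.
exists (iota_completion d) => //; have [c Hc] := denseV d; exists c => v.
have h1 := extend_const_cvg (s := v) (v := d) sB ltr01 B_le.
have h2 : (fun k => B (val v k) d ^+ 2) @ \oo --> extend B v (iota_completion d) ^+ 2.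
  by rewrite expr2; under eq_fun do rewrite expr2; exact: cvgM.
have h3 : (fun k => c * K (val v k) (val v k)) @ \oo --> c * extend K v v.
  by apply: cvgMl_tmp; exact: (extend_cvg sK C0 KB).
have /cvg_lim <-// := h2; have /cvg_lim <-// := h3.
apply: ler_lim; [by apply/cvg_ex; eexists; exact: h2
  |by apply/cvg_ex; eexists; exact: h3|by apply: nearW].
Qed.

Lemma completion_simple (u v : completion) l :
  eigenvector (extend B) (extend K) u l -> eigenvector (extend B) (extend K) v l ->
  exists a b, (a != 0) || (b != 0) /\
    extend K (a *: u + b *: v) (a *: u + b *: v) = 0.
Proof.
move=> eu ev.
have H (s : completion) : eigenvector (extend B) (extend K) s l -> forall phi,
    (fun k => B (val s k) phi - l * K (val s k) phi) @ \oo --> (0 : R).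
  move=> es phi; rewrite -(subrr (extend B s (iota_completion phi))) {2}es.
  apply: cvgB; first exact: (extend_const_cvg sB ltr01 B_le).
  by apply: cvgMl_tmp; exact: (extend_const_cvg sK C0 KB).
have [a [b [ab c]]] := simpleV (completion_cauchy u) (completion_cauchy v)
  (H u eu) (H v ev).
exists a, b; split => //; apply: extend_eq.
by rewrite linearD !linearZ.
Qed.

Theorem spectral_completion : exists (w : nat -> nat -> V) (lam : nat -> R),
  [/\ forall i, sip_cauchy B (w i),
      forall i phi, sip_cauchy B phi ->
        lim ((fun k => B (w i k) (phi k)) @ \oo) =
        lam i * lim ((fun k => K (w i k) (phi k)) @ \oo),
      [/\ 0 < lam 0%N, forall i, lam i < lam i.+1 & lam @ \oo --> +oo],
      forall i j, lim ((fun k => K (w i k) (w j k)) @ \oo) = (i == j)%:R &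
      forall phi e, sip_cauchy B phi -> 0 < e -> exists N (c : nat -> R),
        lim ((fun k => B (phi k - \sum_(i < N) c i *: w i k)
                         (phi k - \sum_(i < N) c i *: w i k)) @ \oo) < e].
Proof.
have infE m : exists f : nat -> completion, forall i j,
    (i <= m)%N -> (j <= m)%N -> extend K (f i) (f j) = (i == j)%:R.
  have [f Hf] := infdimV m; exists (iota_completion \o f) => i j im jm.
  by rewrite /= extend_iota Hf.
have [w [lam [h1 h2 h3 h4]]] := spectral sBE sKE C0 (extend_le sK C0 KB)
  completion_complete completion_compact completion_dense infE completion_simple.
exists (fun i => val (w i)), lam; split => //.
- by move=> i; exact: completion_cauchy.
- move=> i phi /completion_ex[S <-]; exact: h1.
move=> phi e /completion_ex[S <-] e0; have [N [c Hc]] := h4 S e e0.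
exists N, c; move: Hc; rewrite /extend.
have E k : val (S - \sum_(i < N) c i *: w i) k =
    val S k - \sum_(i < N) c i *: val (w i) k.
  rewrite linearB linear_sum /=; congr (_ - _).
  rewrite fct_sumE; apply: eq_bigr => i _.
  by [].
by under eq_fun do rewrite E.
Qed.

End Completion.

(** * Smooth functions *)

Section SmoothFunctions.
Variable R : realType.
Implicit Types f g : R -> R.

Lemma derive1nSr (k : nat) f : derive1n k.+1 f = derive1n k (derive1 f).
Proof. by rewrite /derive1n iterSr. Qed.

Lemma smoothR_derive1 f : smoothR f -> smoothR (derive1 f).
Proof. by move=> sf k x; rewrite -derive1nSr; exact: sf. Qed.

Lemma is_derive_smoothR f (x : R) : smoothR f -> is_derive x 1 f (derive1 f x).
Proof. by move=> sf; apply: DeriveDef; [exact: (sf 0%N)|rewrite derive1E]. Qed.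

(* [flat 0] is the classical smooth function [exp (-1/x)] vanishing for [x <= 0];
   the family is closed under differentiation up to linear combinations. *)
Definition flat (k : nat) (x : R) : R :=
  if 0 < x then x^-1 ^+ k * expR (- x^-1) else 0.

Lemma flat_ge0 k x : 0 <= flat k x.
Proof.
rewrite /flat; case: ifPn => // x0.
by rewrite mulr_ge0 ?expR_ge0// exprn_ge0// invr_ge0 ltW.
Qed.

Lemma flat_le0 k x : x <= 0 -> flat k x = 0.
Proof. by move=> x0; rewrite /flat ltNge x0. Qed.

Lemma flat_gt0 k x : 0 < x -> 0 < flat k x.
Proof. by move=> x0; rewrite /flat x0 mulr_gt0 ?expR_gt0// exprn_gt0// invr_gt0. Qed.

(** The exponential at [x^-1] dominates the term of order [k.+1] of its series, which leaves one
    power of [x] over. This is what makes the difference quotients at 0 converge. *)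
Lemma flat_bound k : exists2 M, 0 < M & forall x, flat k x <= M * `|x|.
Proof.
exists (k.+1`!%:R); first by rewrite ltr0n fact_gt0.
move=> x; rewrite /flat; case: ifPn => x0; last by rewrite mulr_ge0.
rewrite gtr0_norm// expRN.
have y0 : 0 < x^-1 by rewrite invr_gt0.
have := expR_ge1Dxn k (ltW y0); move: (x^-1) y0 (invrK x) => y y0 <- h.
have f0 : 0 < k.+1`!%:R :> R by rewrite ltr0n fact_gt0.
have hy : y ^+ k.+1 <= k.+1`!%:R * expR y.
  by rewrite mulrC -ler_pdivrMr//; move: (_ / _) h => z; lra.
rewrite ler_pdivrMr ?expR_gt0// mulrAC -ler_pdivrMr ?invr_gt0// invrK.
by rewrite mulrC -exprS.
Qed.

Lemma flatE k x : flat k x = flat k.+1 x * x.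
Proof.
rewrite /flat; case: ifPn => x0; last by rewrite mul0r.
by rewrite exprS; field; rewrite gt_eqF.
Qed.

Lemma is_derive_flat k (x : R) :
  is_derive x 1 (flat k) (flat k.+2 x - k%:R * flat k.+1 x).
Proof.
have [x0|x0|->] := ltgtP x 0.
- rewrite !flat_le0 ?ltW// mulr0 subr0.
  apply: (@near_eq_is_derive _ _ _ (cst 0)).
  by near=> y; rewrite flat_le0// ltW//; near: y; exact: lt_nbhsl.
- suff H : is_derive x 1 (fun x : R => x^-1 ^+ k * expR (- x^-1))
      (flat k.+2 x - k%:R * flat k.+1 x).
    apply: (near_eq_is_derive _ H).
    by near=> y; rewrite /flat ifT//; near: y; exact: lt_nbhsr.
  have dv : is_derive x 1 (fun y : R => y^-1) (- x ^- 2 *: 1).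
    by apply: (is_deriveV _ (is_derive_id _ _)); rewrite gt_eqF.
  have de : is_derive x 1 (expR \o (fun y : R => - y^-1)) (expR (- x^-1) * - (- x ^- 2 *: 1)).
    by apply: is_derive1_comp.
  have dX : is_derive x 1 ((fun y : R => y^-1) ^+ k) ((k%:R * x^-1 ^+ k.-1) *: (- x ^- 2 *: 1)).
    exact: is_deriveX.
  have := is_deriveM dX de.
  have -> : (fun y : R => y^-1) ^+ k * (expR \o (fun y : R => - y^-1)) =
      (fun y => y^-1 ^+ k * expR (- y^-1)).
    by apply/funext => y; rewrite /= fctE exprfctE.
  move=> H; apply: is_derive_eq.
  rewrite /flat x0 /= exprfctE.
  rewrite -![_ *: _]/(_ * _).
  case: k {dX H} => [|k] /=.
    by rewrite !expr0; field; rewrite gt_eqF.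
  by rewrite !exprS; field; rewrite gt_eqF.
(* At 0 the difference quotient of [flat k] is exactly [flat k.+1], which tends to 0 by the linear
   bound. *)
- rewrite !flat_le0// mulr0 subr0; apply/is_derive1_caratheodory.
  exists (flat k.+1); split; last by rewrite flat_le0.
    by move=> z; rewrite (flat_le0 _ (lexx 0)) !subr0 -flatE.
  have [M M0 HM] := flat_bound k.+1.
  apply/cvgrPdist_lt => e e0; rewrite flat_le0//.
  near=> y; rewrite sub0r normrN ger0_norm ?flat_ge0//.
  apply: (le_lt_trans (HM y)); rewrite mulrC -ltr_pdivlMr//.
  near: y; apply/nbhs_ballP; exists (e / M); first by rewrite /= divr_gt0.
  by move=> y; rewrite /ball/= sub0r normrN.
Unshelve. all: by end_near. Qed.

(** A class of functions that differentiation maps into itself: derivatives of all orders then exist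
    by a single induction, with no Leibniz or chain formula of higher order. *)
Inductive smooth_expr : (R -> R) -> Prop :=
| smooth_base f : smoothR f -> smooth_expr f
| smooth_cst c : smooth_expr (fun=> c)
| smooth_id : smooth_expr id
| smooth_flat k : smooth_expr (flat k)
| smooth_add f g : smooth_expr f -> smooth_expr g -> smooth_expr (f \+ g)
| smooth_mul f g : smooth_expr f -> smooth_expr g -> smooth_expr (f \* g)
| smooth_inv f : (forall x, f x != 0) -> smooth_expr f ->
    smooth_expr (fun x => (f x)^-1)
| smooth_comp f g : smooth_expr f -> smooth_expr g -> smooth_expr (f \o g).

Lemma smooth_expr_is_derive f : smooth_expr f ->
  exists2 g, smooth_expr g & forall x : R, is_derive x 1 f (g x).
Proof.
elim=> {f} [f sf|c| |k|f g sf [f' sf' df] sg [g' sg' dg]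
  |f g sf [f' sf' df] sg [g' sg' dg]|f f0 sf [f' sf' df]
  |f g sf [f' sf' df] sg [g' sg' dg]].
- exists (derive1 f); first by apply/smooth_base/smoothR_derive1.
  by move=> x; exact: is_derive_smoothR.
- by exists (fun=> 0); [exact: smooth_cst|move=> x; exact: is_derive_cst].
- by exists (fun=> 1); [exact: smooth_cst|move=> x; exact: is_derive_id].
- exists (flat k.+2 \+ ((fun=> - k%:R) \* flat k.+1)).
    apply: smooth_add; first exact: smooth_flat.
    by apply: smooth_mul; [exact: smooth_cst|exact: smooth_flat].
  by move=> x; rewrite /= mulNr; exact: is_derive_flat.
- exists (f' \+ g'); first exact: smooth_add.
  by move=> x; exact: is_deriveD.
- exists ((f \* g') \+ (g \* f')).
    by apply: smooth_add; apply: smooth_mul.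
  by move=> x; exact: is_deriveM.
- exists (fun x => - 1 * ((f x)^-1 * (f x)^-1) * f' x).
    apply: (@smooth_mul (fun x => - 1 * ((f x)^-1 * (f x)^-1))) => //.
    apply: (@smooth_mul (fun=> - 1)); first exact: smooth_cst.
    by apply: (@smooth_mul (fun x => (f x)^-1)); exact: smooth_inv.
  move=> x; have H := is_deriveV (f0 x) (df x); apply: is_derive_eq.
  by rewrite -[_ *: _]/(_ * _) expr2 invfM mulN1r.
- exists ((f' \o g) \* g').
    by apply: smooth_mul => //; exact: smooth_comp.
  by move=> x; exact: is_derive1_comp.
Qed.

Lemma smooth_exprP f : smooth_expr f -> smoothR f.
Proof.
move=> sf k; elim: k f sf => [|k IH] f sf x.
  by have [g _ dg] := smooth_expr_is_derive sf; exact: ex_derive.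
rewrite derive1nSr; apply: IH.
have [g sg dg] := smooth_expr_is_derive sf.
suff -> : derive1 f = g by [].
by apply/funext => y; rewrite derive1E derive_val.
Qed.

(** The classical transition from 0 to 1 on [[0, 1]] built from [exp (-1/x)]. *)
Definition step_fun (x : R) : R := flat 0 x / (flat 0 x + flat 0 (1 - x)).

Lemma step_den_gt0 x : 0 < flat 0 x + flat 0 (1 - x).
Proof.
have [x0|x0] := ltP 0 x; first by rewrite ltr_pwDl ?flat_gt0 ?flat_ge0.
by rewrite ltr_wpDl ?flat_ge0// flat_gt0//; lra.
Qed.

Lemma smooth_step : smooth_expr step_fun.
Proof.
have d : smooth_expr (fun x => flat 0 x + flat 0 (1 - x)).
  apply: (@smooth_add (flat 0)); first exact: smooth_flat.
  apply: (@smooth_comp (flat 0) (fun x => 1 - x)); first exact: smooth_flat.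
  have -> : (fun x : R => 1 - x) = (fun=> 1) \+ ((fun=> - 1) \* id).
    by apply/funext => x /=; rewrite mulN1r.
  apply: smooth_add; first exact: smooth_cst.
  by apply: smooth_mul; [exact: smooth_cst|exact: smooth_id].
apply: (@smooth_mul (flat 0) (fun x => (flat 0 x + flat 0 (1 - x))^-1)).
  exact: smooth_flat.
by apply: smooth_inv => // x; rewrite gt_eqF// step_den_gt0.
Qed.

Lemma step_le0 x : x <= 0 -> step_fun x = 0.
Proof. by move=> x0; rewrite /step_fun flat_le0// mul0r. Qed.

Lemma step_ge1 x : 1 <= x -> step_fun x = 1.
Proof.
move=> x1; rewrite /step_fun (@flat_le0 _ (1 - x)) ?subr_le0// addr0 divff//.
by rewrite gt_eqF// flat_gt0// (lt_le_trans ltr01).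
Qed.

Lemma step_ge0 x : 0 <= step_fun x.
Proof. by rewrite divr_ge0 ?flat_ge0// ltW// step_den_gt0. Qed.

Lemma step_le1 x : step_fun x <= 1.
Proof. by rewrite ler_pdivrMr ?step_den_gt0// mul1r lerDl flat_ge0. Qed.

Lemma smooth_affine (a b : R) : smooth_expr (fun x => a * x + b).
Proof.
apply: (@smooth_add (fun x => a * x) (fun=> b)); last exact: smooth_cst.
by apply: (@smooth_mul (fun=> a) id); [exact: smooth_cst|exact: smooth_id].
Qed.

(** The ramp stays 0 up to 1, not merely up to 0: after rescaling, a hat whose first node is 0 still
    vanishes near 0 and is an admissible test function. *)
Definition soft_ramp (x : R) : R := x * step_fun (x - 1).

Lemma smooth_soft_ramp : smooth_expr soft_ramp.
Proof.
apply: (@smooth_mul id (fun x => step_fun (x - 1))); first exact: smooth_id.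
apply: (@smooth_comp step_fun (fun x => x - 1)); first exact: smooth_step.
have -> : (fun x : R => x - 1) = (fun x => 1 * x + - 1).
  by apply/funext => x; rewrite mul1r.
exact: smooth_affine.
Qed.

Lemma soft_ramp_le1 x : x <= 1 -> soft_ramp x = 0.
Proof. by move=> x1; rewrite /soft_ramp step_le0 ?mulr0// subr_le0. Qed.

Lemma soft_ramp_ge2 x : 2 <= x -> soft_ramp x = x.
Proof. by move=> x2; rewrite /soft_ramp step_ge1 ?mulr1//; lra. Qed.

Lemma continuous_smoothR f : smoothR f -> continuous f.
Proof.
by move=> sf x; apply/differentiable_continuous/derivable1_diffP; exact: (sf 0%N).
Qed.

Lemma derive1_eq_near f g (x : R) : (\near x, f x = g x) ->
  derive1 f x = derive1 g x.
Proof. by move=> fg; rewrite !derive1E; exact: near_eq_derive. Qed.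

Lemma derive1_soft_ramp_lt1 x : x < 1 -> derive1 soft_ramp x = 0.
Proof.
move=> x1; rewrite (@derive1_eq_near _ (cst 0)) ?derive1_cst//.
by near=> y; rewrite soft_ramp_le1// ltW//; near: y; exact: lt_nbhsl.
Unshelve. all: by end_near. Qed.

Lemma derive1_soft_ramp_gt2 x : 2 < x -> derive1 soft_ramp x = 1.
Proof.
move=> x2; rewrite (@derive1_eq_near _ id); first by rewrite derive1E derive_id.
by near=> y; rewrite soft_ramp_ge2// ltW//; near: y; exact: lt_nbhsr.
Unshelve. all: by end_near. Qed.

Lemma derive1_soft_ramp_bound : exists2 M, 1 <= M & forall x, `|derive1 soft_ramp x| <= M.
Proof.
have c : continuous (fun x => `|derive1 soft_ramp x|).
  move=> x; apply: (@continuous_comp _ _ _ (derive1 soft_ramp) (fun y => `|y|)).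
    exact/continuous_smoothR/smoothR_derive1/smooth_exprP/smooth_soft_ramp.
  exact: norm_continuous.
have [|x0 _ H] := @EVT_max R _ 1 2 _ (continuous_subspaceT c); first by lra.
exists (1 + `|derive1 soft_ramp x0|); first by rewrite lerDl.
move=> x; have [x1|x1] := ltP x 1.
  by rewrite derive1_soft_ramp_lt1// normr0 addr_ge0.
have [x2|x2] := ltP 2 x.
  by rewrite derive1_soft_ramp_gt2// normr1 lerDl.
by apply: le_trans (H x _) _; rewrite ?in_itv/= ?x1 ?x2 ?lerDr.
Qed.

End SmoothFunctions.

(** * Integration of compactly supported functions *)

Lemma Rintegral_subset_le d (T : measurableType d) (R : realType)
    (mu : {measure set T -> \bar R}) (A A' : set T) (f : T -> R) : measurable A -> measurable A' ->
  A `<=` A' -> mu.-integrable A' (EFin \o f) -> (forall t, A' t -> 0 <= f t) ->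
  \int[mu]_(t in A) f t <= \int[mu]_(t in A') f t.
Proof.
move=> mA mA' AA' intf f0; have intfA := integrableS mA' mA AA' intf.
apply: fine_le; [exact: integrable_fin_num|exact: integrable_fin_num|].
apply: ge0_subset_integral => //; first by case/integrableP: intf.
Qed.

Section CompactlySupported.
Variable R : realType.
Implicit Types (f g : R -> R).
Notation mu := (@lebesgue_measure R).
Notation D := (`](0:R), +oo[)%classic.

Definition halfint f : R := \int[mu]_(t in D) f t.

Definition cc f := (forall x : R, 0 < x -> {for x, continuous f}) /\
  exists a b, [/\ 0 < a, a < b & forall t, t <= a \/ b <= t -> f t = 0].

Lemma ccD f g : cc f -> cc g -> cc (f \+ g).
Proof.
move=> [cf [a [b [a0 ab fz]]]] [cg [a' [b' [a'0 ab' gz]]]]; split.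
  by move=> x x0; apply: continuousD; [exact: cf|exact: cg].
exists (Num.min a a'), (Num.max b b'); split.
- by rewrite lt_min a0.
- by rewrite lt_max gt_min ab.
- move=> t H; rewrite /= fz ?gz ?addr0//; case: H; rewrite ?le_min ?ge_max => /andP[? ?];
  by [left|right].
Qed.

Lemma ccM g f : (forall x : R, 0 < x -> {for x, continuous g}) -> cc f -> cc (g \* f).
Proof.
move=> cg [cf [a [b [a0 ab fz]]]]; split.
  by move=> x x0; apply: continuousM; [exact: cg|exact: cf].
by exists a, b; split => // t /fz /= ->; rewrite mulr0.
Qed.

Lemma ccZ c f : cc f -> cc (fun t => c * f t).
Proof. by apply: (@ccM (fun=> c)) => x _; exact: cst_continuous. Qed.

Lemma cc_eq0 f t : cc f -> t <= 0 -> f t = 0.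
Proof. by move=> [_ [a [b [a0 ab fz]]]] t0; apply: fz; left; apply: le_trans (ltW a0). Qed.

Lemma cc_within f : cc f -> exists a b, [/\ 0 < a, a < b,
  {within `[a, b], continuous f} & forall t, t <= a \/ b <= t -> f t = 0].
Proof.
move=> [cf [a [b [a0 ab fz]]]]; exists a, b; split => //.
apply: continuous_in_subspaceT => x; rewrite inE/= in_itv/= => /andP[ax _].
by apply: cf; exact: lt_le_trans ax.
Qed.

Lemma cc_restrict f a b : (forall t, t <= a \/ b <= t -> f t = 0) ->
  f \_ `[a, b] = f.
Proof.
move=> fz; apply/funext => t; rewrite patchE; case: ifPn => // /negP H.
rewrite fz//; case: (leP t a) => ta; [by left|right].
rewrite leNgt; apply/negP => tb; apply: H.
by rewrite inE/= in_itv/= !ltW.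
Qed.

Lemma cc_integrableT f : cc f -> mu.-integrable setT (EFin \o f).
Proof.
move=> /cc_within[a [b [a0 ab cf fz]]].
have := continuous_compact_integrable (@segment_compact _ a b) cf.
rewrite integrable_mkcond// => H; move: H; congr integrable.
by rewrite restrict_EFin (cc_restrict fz).
Qed.

Lemma cc_integrable f (A : set (measurableTypeR R)) : measurable A -> cc f ->
  mu.-integrable A (EFin \o f).
Proof. by move=> mA /cc_integrableT; exact: integrableS. Qed.

Lemma halfintT f : cc f -> halfint f = \int[mu]_t f t.
Proof.
move=> cf; rewrite /halfint Rintegral_mkcond; congr Rintegral; apply/funext => t.
rewrite patchE; case: ifPn => // /negP H; rewrite (cc_eq0 cf)// leNgt.
by apply/negP => t0; apply: H; rewrite inE/= in_itv/= t0.
Qed.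

Lemma halfintD f g : cc f -> cc g -> halfint (f \+ g) = halfint f + halfint g.
Proof. by move=> cf cg; rewrite /halfint RintegralD//; exact: cc_integrable. Qed.

Lemma halfintZ c f : cc f -> halfint (fun t => c * f t) = c * halfint f.
Proof. by move=> cf; rewrite /halfint RintegralZl//; exact: cc_integrable. Qed.

Lemma halfint_ge0 f : (forall t, 0 < t -> 0 <= f t) -> 0 <= halfint f.
Proof. by move=> f0; apply: Rintegral_ge0 => t /=; rewrite in_itv/= andbT; exact: f0. Qed.

Lemma eq_halfint f g : (forall t, 0 < t -> f t = g t) -> halfint f = halfint g.
Proof.
by move=> fg; apply: eq_Rintegral => t; rewrite inE/= in_itv/= andbT; exact: fg.
Qed.

Lemma halfint_le f g : cc f -> cc g -> (forall t, 0 < t -> f t <= g t) ->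
  halfint f <= halfint g.
Proof.
move=> cf cg fg; apply: le_Rintegral => //; try exact: cc_integrable.
by move=> t /=; rewrite in_itv/= andbT; exact: fg.
Qed.

Lemma cc_subset_le f (A : set (measurableTypeR R)) : measurable A -> cc f -> (forall t, 0 <= f t) ->
  \int[mu]_(t in A) f t <= halfint f.
Proof.
move=> mA cf f0; rewrite halfintT//; apply: Rintegral_subset_le => //.
exact: cc_integrableT.
Qed.

Lemma FTC2_smooth f x y : smoothR f -> x < y ->
  \int[mu]_(t in `[x, y]) (derive1 f t) = f y - f x.
Proof.
move=> sf xy; rewrite /Rintegral (@continuous_FTC2 _ _ f)//.
- apply: continuous_subspaceT; exact/continuous_smoothR/smoothR_derive1.
- split; first by move=> t _; exact: (sf 0%N).
  + by apply: cvg_at_right_filter; exact: continuous_smoothR.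
  + by apply: cvg_at_left_filter; exact: continuous_smoothR.
Qed.

Lemma integrable_itv_continuous f x y : continuous f ->
  mu.-integrable `[x, y] (EFin \o f).
Proof.
move=> cf; apply: continuous_compact_integrable; first exact: segment_compact.
exact: continuous_subspaceT.
Qed.

Lemma Rintegral_itv_cst (x y c : R) : x <= y -> \int[mu]_(t in `[x, y]) c = c * (y - x).
Proof.
move=> xy; rewrite Rintegral_cst//= lebesgue_measure_itv/= lte_fin.
by move: xy; rewrite le_eqVlt => /orP[/eqP->|->//]; rewrite ltxx subrr.
Qed.

Lemma Rintegral_pieces f (N : nat) (h : R) (c : nat -> R) : 0 < h -> cc f ->
  (forall j t, (j < N)%N -> j%:R * h < t -> t <= j.+1%:R * h -> f t <= c j) ->
  \int[mu]_(t in `]0, N%:R * h]) f t <= (\sum_(j < N) c j) * h.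
Proof.
move=> h0 cf; elim: N => [|N IH] fc.
  by rewrite mul0r big_ord0 mul0r set_itv_ge ?Rintegral_set0// bnd_simp ltxx.
have step : N%:R * h < N.+1%:R * h by rewrite ltr_pM2r// ltr_nat.
rewrite (@itv_bndbnd_setU _ _ _ (BRight (N%:R * h))); last 2 first.
- by rewrite bnd_simp mulr_ge0// ltW.
- by rewrite bnd_simp ltW.
rewrite Rintegral_setU//=; last first.
- apply/disj_setPS => y [/=]; rewrite 2!in_itv/= => /andP[_ yx] /andP[].
  by rewrite ltNge yx.
- by apply: cc_integrable => //; apply: measurableU.
rewrite big_ord_recr/= mulrDl; apply: lerD.
  by apply: IH => j t jN; apply: fc; exact: ltnW.
apply: (@le_trans _ _ (\int[mu]_(t in `]N%:R * h, N.+1%:R * h]) c N)).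
  apply: le_Rintegral => //.
  - exact: cc_integrable.
  - have := @continuous_compact_integrable R (cst (c N)) `[N%:R * h, N.+1%:R * h]
      (@segment_compact _ _ _) (continuous_subspaceT (@cst_continuous _ _ (c N))).
    by apply: integrableS => //; apply: subset_itvr; rewrite bnd_simp.
  - by move=> t /=; rewrite in_itv/= => /andP[t1 t2]; exact: fc.
rewrite Rintegral_cst//= lebesgue_measure_itv/= lte_fin step /=.
by rewrite -mulrBl -natrB// subSnn mul1r.
Qed.

(** Separates a region treated by finitely many cells from a tail treated by a majorant, the shape
    in which the compactness estimate is obtained. *)
Lemma halfint_pieces f g (N : nat) (h : R) (c : nat -> R) : 0 < h -> cc f -> cc g ->
  (forall t, 0 <= g t) ->
  (forall j t, (j < N)%N -> j%:R * h < t -> t <= j.+1%:R * h -> f t <= c j) ->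
  (forall t, N%:R * h < t -> f t <= g t) ->
  halfint f <= (\sum_(j < N) c j) * h + halfint g.
Proof.
move=> h0 cf cg g0 fc fg.
have Nh0 : 0 <= N%:R * h by rewrite mulr_ge0// ltW.
rewrite {1}/halfint (@itv_bndbnd_setU _ _ _ (BRight (N%:R * h))); last 2 first.
- by rewrite bnd_simp.
- by rewrite bnd_simp.
rewrite Rintegral_setU//=; last first.
- apply/disj_setPS => y [/=]; rewrite 2!in_itv/= => /andP[_ yx] /andP[].
  by rewrite ltNge yx.
- by apply: cc_integrable => //; apply: measurableU.
apply: lerD; first exact: Rintegral_pieces.
apply: (@le_trans _ _ (\int[mu]_(t in `]N%:R * h, +oo[) g t)).
  apply: le_Rintegral => //; try exact: cc_integrable.
  by move=> t /=; rewrite in_itv/= andbT; exact: fg.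
exact: cc_subset_le.
Qed.

End CompactlySupported.

(** * Test functions and the two forms *)

Section TestSpace.
Variable R : realType.
Notation mu := (@lebesgue_measure R).

Definition rtest (u : R -> R) : Prop := smoothR u /\
  exists a b : R, [/\ 0 < a, a <= b & forall t, t < a \/ b < t -> u t = 0].

Lemma smoothR_linear (a : R) u v : smoothR u -> smoothR v -> smoothR (a *: u + v).
Proof.
move=> su sv; apply: smooth_exprP; apply: (@smooth_add _ (a *: u)); last exact: smooth_base.
by apply: (@smooth_mul _ (fun=> a) u); [exact: smooth_cst|exact: smooth_base].
Qed.

Definition rtests : {pred R -> R} := fun u => `[< rtest u >].

Lemma rtests_submod_closed : submod_closed rtests.
Proof.
split.
  apply/asboolP; split; last by exists 1, 1.
  by apply: smooth_exprP; exact: smooth_cst.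
move=> c u v /asboolP[su [a [b [a0 ab uz]]]] /asboolP[sv [a' [b' [a'0 ab' vz]]]].
apply/asboolP; split; first exact: smoothR_linear.
exists (Num.min a a'), (Num.max b b'); split.
- by rewrite lt_min a0.
- by rewrite le_max ge_min ab.
- move=> t H; have [h1 h2] : (t < a \/ b < t) /\ (t < a' \/ b' < t).
    by case: H; rewrite ?lt_min ?gt_max => /andP[? ?]; split; by [left|right].
  have -> : (c *: u + v) t = c * u t + v t by [].
  by rewrite uz// vz// mulr0 addr0.
Qed.

HB.instance Definition _ := GRing.isSubmodClosed.Build R (R -> R)
  rtests rtests_submod_closed.

Record test_space := TestSpace { test_val : R -> R; test_valP : test_val \in rtests }.

HB.instance Definition _ := [isSub for test_val].
HB.instance Definition _ := [Choice of test_space by <:].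
HB.instance Definition _ := [SubChoice_isSubLmodule of test_space by <:].

Implicit Types u v phi : test_space.

Lemma test_ex (f : R -> R) : rtest f -> exists u, val u = f.
Proof. by move=> /asboolP h; exists (TestSpace h). Qed.

Lemma test_smooth u : smoothR (val u).
Proof. by have /asboolP[] := test_valP u. Qed.

Arguments test_smooth : clear implicits.

Definition tder u : R -> R := derive1 (val u).

Lemma tvalP c u v t : val (c *: u + v) t = c * val u t + val v t.
Proof. by []. Qed.

Lemma tderP c u v t : tder (c *: u + v) t = c * tder u t + tder v t.
Proof.
rewrite /tder linearP /= !derive1E.
have su := is_derive_smoothR t (test_smooth u).
have sv := is_derive_smoothR t (test_smooth v).
have := is_deriveD (is_deriveZ c su) sv => H.
by rewrite derive_val -!derive1E.
Qed.

Lemma test_supp u : exists a b, [/\ 0 < a, a < b &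
  forall t, t <= a \/ b <= t -> val u t = 0 /\ tder u t = 0].
Proof.
have /asboolP[su [a [b [a0 ab uz]]]] := test_valP u.
(* The enlarged interval is nondegenerate, and [u] vanishes in a neighbourhood of its ends, so that
   the derivative vanishes there as well. *)
exists (a / 2), (b + 1); split; [lra|lra|].
move=> t H; have {}H : t < a \/ b < t by case: H => h; [left|right]; lra.
split; first exact: uz.
rewrite /tder (@derive1_eq_near _ _ (cst 0)) ?derive1_cst//.
case: H => h.
  by apply: filterS (lt_nbhsl h) => s sa; apply: uz; left.
by apply: filterS (lt_nbhsr h) => s sa; apply: uz; right.
Qed.

Lemma test_eq0 u t : t <= 0 -> val u t = 0.
Proof.
move=> t0; have [a [b [a0 ab /(_ t)[]]]] := test_supp u => //.
by left; apply: le_trans (ltW a0).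
Qed.

Lemma continuous_test u : continuous (val u).
Proof. exact/continuous_smoothR/test_smooth. Qed.

Lemma continuous_tder u : continuous (tder u).
Proof. exact/continuous_smoothR/smoothR_derive1/test_smooth. Qed.

Lemma cc_mul_test (g : R -> R) u : continuous g -> cc (fun t => g t * val u t).
Proof.
move=> cg; split; first by move=> x _; apply: continuousM; [exact: cg|exact: continuous_test].
have [a [b [a0 ab uz]]] := test_supp u; exists a, b; split => // t /uz[-> _].
by rewrite mulr0.
Qed.

Lemma cc_mul_tder (g : R -> R) u : continuous g -> cc (fun t => g t * tder u t).
Proof.
move=> cg; split; first by move=> x _; apply: continuousM; [exact: cg|exact: continuous_tder].
have [a [b [a0 ab uz]]] := test_supp u; exists a, b; split => // t /uz[_ ->].
by rewrite mulr0.
Qed.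

Lemma cc_val_val u v : cc (fun t => val u t * val v t).
Proof. exact/cc_mul_test/continuous_test. Qed.

Lemma cc_tder_tder u v : cc (fun t => tder u t * tder v t).
Proof. exact/cc_mul_tder/continuous_tder. Qed.

Lemma continuous_powR (p x : R) : 0 < x -> {for x, continuous (fun t : R => powR t p)}.
Proof.
move=> x0; apply/differentiable_continuous/derivable1_diffP.
by apply: derivable_powR; rewrite in_itv/= x0.
Qed.

(** The exponent is left free: [p = 2 - 4 / n] gives the form of the eigenvalue problem, [p = 0] the
    inner product of L2. *)
Definition wform (p : R) u v := halfint (fun t => powR t p * (val u t * val v t)).

Lemma cc_wform p u v : cc (fun t => powR t p * (val u t * val v t)).
Proof. by apply: ccM; [move=> x; exact: continuous_powR|exact: cc_val_val]. Qed.

Lemma wform_semi_inner p : semi_inner (wform p).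
Proof.
split.
- by move=> u v; apply: eq_halfint => t _; rewrite (mulrC (val u t)).
- move=> a u v w; rewrite /wform -halfintZ; last exact: cc_wform.
  rewrite -halfintD; [|exact/ccZ/cc_wform|exact: cc_wform].
  by apply: eq_halfint => t _; rewrite tvalP /=; ring.
- move=> u; apply: halfint_ge0 => t _.
  by rewrite mulr_ge0 ?powR_ge0// -expr2 sqr_ge0.
Qed.

Variables (al be : R) (al0 : 0 < al) (be0 : 0 < be).

Definition eform u v := halfint (fun t =>
  al * (tder u t * tder v t) + be * t ^+ 2 * (val u t * val v t)).

Lemma continuous_quad (c : R) : continuous (fun t : R => c * t ^+ 2).
Proof.
move=> x; apply: (@continuousM _ _ (fun=> c) (fun t : R => t ^+ 2)).
  exact: cst_continuous.
exact: exprn_continuous.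
Qed.

Lemma cc_pot u v : cc (fun t => be * t ^+ 2 * (val u t * val v t)).
Proof. by apply: ccM; [move=> x _; exact: continuous_quad|exact: cc_val_val]. Qed.

Lemma cc_eform u v : cc (fun t =>
  al * (tder u t * tder v t) + be * t ^+ 2 * (val u t * val v t)).
Proof. by apply: ccD; [exact/ccZ/cc_tder_tder|exact: cc_pot]. Qed.

Lemma eform_semi_inner : semi_inner eform.
Proof.
split.
- by move=> u v; apply: eq_halfint => t _; rewrite (mulrC (val u t)) (mulrC (tder u t)).
- move=> a u v w; rewrite /eform -halfintZ; last exact: cc_eform.
  rewrite -halfintD; [|exact/ccZ/cc_eform|exact: cc_eform].
  by apply: eq_halfint => t _; rewrite tvalP tderP /=; ring.
- move=> u; apply: halfint_ge0 => t _.
  rewrite -!expr2; apply: addr_ge0; first by apply: mulr_ge0; rewrite ?sqr_ge0// ltW.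
  by apply: mulr_ge0; rewrite ?sqr_ge0//; apply: mulr_ge0; rewrite ?sqr_ge0// ltW.
Qed.

Lemma dirichlet_le u : halfint (fun t => tder u t ^+ 2) <= eform u u / al.
Proof.
rewrite ler_pdivlMr// mulrC -halfintZ; last exact: cc_tder_tder.
apply: halfint_le; [exact/ccZ/cc_tder_tder|exact: cc_eform|] => t _.
rewrite -!expr2 lerDl; apply: mulr_ge0; rewrite ?sqr_ge0//.
by apply: mulr_ge0; rewrite ?sqr_ge0// ltW.
Qed.

Lemma potential_le u : halfint (fun t => t ^+ 2 * val u t ^+ 2) <= eform u u / be.
Proof.
have c : cc (fun t => t ^+ 2 * (val u t * val u t)).
  apply: ccM; last exact: cc_val_val.
  by move=> x _; exact: exprn_continuous.
rewrite ler_pdivlMr// mulrC -halfintZ//.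
apply: halfint_le; [exact/ccZ|exact: cc_eform|] => t _.
by rewrite -!expr2 mulrA lerDr; apply: mulr_ge0; rewrite ?sqr_ge0// ltW.
Qed.

(* Integrating [(u' - c)^2 >= 0] with [c] the difference quotient gives the
   Cauchy-Schwarz bound directly. *)
Lemma test_dist_sqr u x y : (val u y - val u x) ^+ 2 <= `|y - x| * (eform u u / al).
Proof.
wlog xy : x y / x < y.
  move=> H; have [xy|xy|->] := ltgtP x y; first exact: H.
    by rewrite distrC -sqrrN opprB; exact: H.
  by rewrite !subrr normr0 mul0r expr0n.
rewrite gtr0_norm ?subr_gt0//.
set d := val u y - val u x; set c := d / (y - x).
have yx0 : 0 < y - x by rewrite subr_gt0.
have ci : mu.-integrable `[x, y] (EFin \o tder u).
  exact/integrable_itv_continuous/continuous_tder.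
have ci2 : mu.-integrable `[x, y] (EFin \o (fun t => tder u t ^+ 2)).
  apply: cc_integrable => //; exact: cc_tder_tder.
have cst c' : mu.-integrable `[x, y] (EFin \o (fun t => c')).
  exact/integrable_itv_continuous/cst_continuous.
have h : 0 <= \int[mu]_(t in `[x, y]) ((tder u t ^+ 2 + (- 2 * c) * tder u t) + c ^+ 2).
  apply: Rintegral_ge0 => t _.
  have -> : tder u t ^+ 2 + (- 2 * c) * tder u t + c ^+ 2 = (tder u t - c) ^+ 2 by ring.
  exact: sqr_ge0.
have ciZ : mu.-integrable `[x, y] (EFin \o (fun t => (- 2 * c) * tder u t)).
  apply: integrable_itv_continuous => t.
  apply: (@continuousM _ _ (fun=> - 2 * c) (tder u)); first exact: cst_continuous.
  exact: continuous_tder.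
have ciD : mu.-integrable `[x, y] (EFin \o (fun t => tder u t ^+ 2 + (- 2 * c) * tder u t)).
  by have := integrableD _ ci2 ciZ; apply.
rewrite RintegralD// RintegralD// RintegralZl// in h.
rewrite FTC2_smooth ?(ltW xy)// in h; last exact: test_smooth.
rewrite Rintegral_itv_cst ?(ltW xy)// -/d in h.
have h2 : \int[mu]_(t in `[x, y]) (tder u t ^+ 2) <= eform u u / al.
  apply: le_trans (dirichlet_le u); apply: cc_subset_le => //; first exact: cc_tder_tder.
  by move=> t; exact: sqr_ge0.
have h3 : d ^+ 2 / (y - x) <= eform u u / al.
  move: h h2; move: (\int[mu]_(t in _) _) (eform u u / al) => I E.
  have -> : I + - 2 * c * d + c ^+ 2 * (y - x) = I - d ^+ 2 / (y - x).
    by rewrite /c; field; rewrite gt_eqF.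
  lra.
by move: h3; rewrite ler_pdivrMr// mulrC.
Qed.

Lemma test_sqr u x : 0 <= x -> val u x ^+ 2 <= x * (eform u u / al).
Proof.
move=> x0; have := test_dist_sqr u 0 x.
by rewrite (test_eq0 u (lexx 0)) !subr0 ger0_norm.
Qed.

(** On a cell, [u] is compared with its value at the left node, at the cost of [h] times the energy.
    Beyond [T = N%:R * h] the weight is [powR t (p - 2) * t ^+ 2], whose first factor is at most
    [powR T (p - 2)] because [p <= 2], and the potential term absorbs the rest. *)
Lemma wform_pieces p u N (h : R) : 0 <= p -> p <= 2 -> 0 < h -> 1 <= N%:R * h ->
  wform p u u <= (\sum_(j < N) 2 * (val u (j%:R * h) ^+ 2 + h * (eform u u / al)))
     * powR (N%:R * h) p * h + powR (N%:R * h) (p - 2) * (eform u u / be).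
Proof.
move=> p0 p2 h0 T1; set T := N%:R * h in T1 *.
have T0 : 0 < T by apply: lt_le_trans T1.
have E0 : 0 <= eform u u / al by rewrite divr_ge0 ?(sip_ge0 eform_semi_inner)// ltW.
have cg : cc (fun t => t ^+ 2 * (val u t * val u t)).
  apply: ccM; last exact: cc_val_val.
  by move=> x _; exact: exprn_continuous.
apply: (@le_trans _ _ ((\sum_(j < N) powR T p *
     (2 * (val u (j%:R * h) ^+ 2 + h * (eform u u / al)))) * h +
   halfint (fun t => powR T (p - 2) * (t ^+ 2 * (val u t * val u t))))).
  apply: (@halfint_pieces _ _ _ N h (fun j => powR T p *
     (2 * (val u (j%:R * h) ^+ 2 + h * (eform u u / al))))) => //.
  - exact: cc_wform.
  - exact: ccZ.
  - move=> t; rewrite -expr2; apply: mulr_ge0; rewrite ?powR_ge0//.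
    by apply: mulr_ge0; rewrite ?sqr_ge0.
  - move=> j t jN jt tj; have t0 : 0 < t by apply: le_lt_trans jt; rewrite mulr_ge0// ltW.
    apply: ler_pM; rewrite ?powR_ge0//; first by rewrite -expr2 sqr_ge0.
      apply: ge0_ler_powR => //; rewrite ?nnegrE ?(ltW t0) ?(ltW T0)//.
      by apply: (le_trans tj); rewrite ler_pM2r// ler_nat.
    have := test_dist_sqr u (j%:R * h) t; rewrite gtr0_norm ?subr_gt0// => H.
    have : (t - j%:R * h) * (eform u u / al) <= h * (eform u u / al).
      by rewrite ler_wpM2r//; move: tj; rewrite -natr1 mulrDl mul1r; lra.
    move: H; move: (val u t) (val u (j%:R * h)) (h * _) ((t - _) * _) => a b c d.
    (* Nonnegativity of [(a - 2 * b) ^+ 2] is the inequality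
       [a ^+ 2 <= 2 * b ^+ 2 + 2 * (a - b) ^+ 2]. *)
    by have := sqr_ge0 (a - 2 * b); rewrite -expr2; nra.
  - move=> t Tt; have t0 : 0 < t by apply: lt_trans Tt.
    rewrite [leRHS]mulrA -!expr2 ler_wpM2r ?sqr_ge0//.
    have -> : powR t p = powR t (p - 2) * t ^+ 2.
      rewrite -powR_mulrn ?(ltW t0)// -powRD ?subrK// (gt_eqF t0)/=.
      by rewrite implybT.
    rewrite ler_wpM2r ?sqr_ge0// -!(opprB 2) !powRN lef_pV2 ?posrE ?powR_gt0//.
    by apply: ge0_ler_powR; rewrite ?subr_ge0 ?nnegrE ?(ltW T0) ?(ltW t0) ?(ltW Tt).
apply: lerD; first by rewrite -mulr_sumr (mulrC (powR _ _)).
by rewrite halfintZ// ler_wpM2l ?powR_ge0// potential_le.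
Qed.

End TestSpace.

Arguments test_smooth {R} u.

(** * Comparison of the weighted form with the energy *)

Lemma weighted_CauchySchwarz (R : realType) (w f g : R -> R) :
  (forall x : R, 0 < x -> {for x, continuous w}) -> (forall t, 0 <= w t) ->
  cc f -> cc g ->
  halfint (fun t => w t * (f t * g t)) ^+ 2 <=
  halfint (fun t => w t * (f t * f t)) * halfint (fun t => w t * (g t * g t)).
Proof.
move=> cw w0 cf cg.
have C f1 g1 : cc f1 -> cc g1 -> cc (fun t => w t * (f1 t * g1 t)).
  move=> [c1 h] c2; apply: ccM => //; apply: ccM => //.
have sq f1 : 0 <= halfint (fun t => w t * (f1 t * f1 t)).
  by apply: halfint_ge0 => t _; rewrite mulr_ge0// -expr2 sqr_ge0.
apply: discriminant_le => // s.
rewrite -(@halfintZ _ (2 * s)); last exact: C.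
rewrite -(@halfintZ _ (s ^+ 2)); last exact: C.
rewrite -halfintD; [|exact: C|exact/ccZ/C].
rewrite -halfintD; [|apply: ccD; [exact: C|exact/ccZ/C]|exact/ccZ/C].
apply: halfint_ge0 => t _ /=.
have -> : w t * (f t * f t) + 2 * s * (w t * (f t * g t)) + s ^+ 2 * (w t * (g t * g t)) =
  w t * (f t + s * g t) ^+ 2 by ring.
by rewrite mulr_ge0// sqr_ge0.
Qed.

Section TestSpaceBounds.
Variables (R : realType) (al be p : R).
Hypotheses (al0 : 0 < al) (be0 : 0 < be) (p0 : 0 <= p) (p2 : p <= 2).
Implicit Types u v phi : test_space R.
Notation mu := (@lebesgue_measure R).
Local Notation E := (eform al be).
Local Notation K := (wform p).

Lemma E_ge0 u : 0 <= E u u. Proof. exact: (sip_ge0 (eform_semi_inner al0 be0)). Qed.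

(** A single cell of length 1 suffices, since its node is 0, where test functions vanish. *)
Lemma wform_le u : K u u <= (2 / al + 1 / be) * E u u.
Proof.
have := wform_pieces al0 be0 u (N := 1%N) p0 p2 ltr01.
rewrite mulr1 => /(_ (lexx 1)); rewrite big_ord1 !powR1 mul0r (test_eq0 u (lexx 0)).
move=> h; apply: (le_trans h); rewrite le_eqVlt; apply/orP; left; apply/eqP.
by field; rewrite !gt_eqF.
Qed.

Lemma wform_finite_rank e : p < 2 -> 0 < e -> exists (N : nat) (h M : R),
  [/\ 0 < h, 0 <= M & forall u,
    K u u <= e * E u u + M * \sum_(j < N) val u (j%:R * h) ^+ 2].
Proof.
move=> p2' e0.
have e2 : 0 < 2 / (e * be) by rewrite divr_gt0// mulr_gt0.
have q0 : 0 < 2 - p by rewrite subr_gt0.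
(* [T] makes the tail coefficient [powR T (p - 2) / be] at most [e / 2], which is possible because
   [p < 2]. *)
pose T := Num.max 1 (powR (2 / (e * be)) (2 - p)^-1).
have T1 : 1 <= T by rewrite le_max lexx.
have T0 : 0 < T by apply: lt_le_trans T1.
have Tq : 2 / (e * be) <= powR T (2 - p).
  have -> : 2 / (e * be) = powR (powR (2 / (e * be)) (2 - p)^-1) (2 - p).
    by rewrite -powRrM mulVf ?gt_eqF// powRr1// ltW.
  apply: ge0_ler_powR; rewrite ?nnegrE ?powR_ge0 ?(ltW q0) ?(ltW T0)//.
  by rewrite le_max lexx orbT.
have Tp : powR T (p - 2) / be <= e / 2.
  rewrite -opprB powRN -invfM.
  rewrite -[e / 2]invrK lef_pV2 ?posrE ?invr_gt0 ?mulr_gt0 ?powR_gt0 ?divr_gt0//.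
  rewrite invf_div; move: Tq; rewrite ler_pdivrMr ?mulr_gt0//.
  by rewrite ler_pdivrMr// mulrA mulrAC.
(* With cells of length [T / N.+1] the oscillation within cells costs [c / N.+1] times the energy;
   [N] makes this at most the other [e / 2]. *)
pose c := 2 * powR T p * T * T / al.
have c0 : 0 <= c by rewrite divr_ge0 ?mulr_ge0 ?powR_ge0// ltW.
have c1 : 0 < 2 * (c + 1) by rewrite mulr_gt0// ltr_wpDl.
have [N /(_ N (leqnn N)) HN] := invS_lt (divr_gt0 e0 c1).
have h0 : 0 < T / N.+1%:R by rewrite divr_gt0.
have NT : N.+1%:R * (T / N.+1%:R) = T by rewrite mulrC divfK// pnatr_eq0.
exists N.+1, (T / N.+1%:R), (2 * powR T p * (T / N.+1%:R)); split => //.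
  by rewrite !mulr_ge0 ?powR_ge0// ltW.
move=> u; have := wform_pieces al0 be0 u (N := N.+1) p0 p2 h0.
rewrite NT => /(_ T1) H; apply: (le_trans H).
rewrite -mulr_sumr big_split /= sumr_const card_ord.
set S := \sum_(_ < _) _; set h := T / _ in h0 NT *.
have hE : (h * (E u u / al)) *+ N.+1 = T * (E u u / al) by rewrite -mulr_natl mulrA NT.
rewrite hE.
have E0 := E_ge0 u.
have b1 : powR T (p - 2) * (E u u / be) <= e / 2 * E u u.
  by rewrite mulrA mulrAC ler_wpM2r.
have b2 : 2 * (T * (E u u / al)) * powR T p * h <= e / 2 * E u u.
  have -> : 2 * (T * (E u u / al)) * powR T p * h = c * N.+1%:R^-1 * E u u.
    have : N.+1%:R != 0 :> R by rewrite pnatr_eq0.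
    by rewrite /c /h; move: (N.+1%:R) => k k0; field; rewrite k0 gt_eqF.
  rewrite ler_wpM2r//; apply: (@le_trans _ _ (c * (e / (2 * (c + 1))))).
    by rewrite ler_wpM2l// ltW.
  rewrite mulrA ler_pdivrMr//.
  have -> : e / 2 * (2 * (c + 1)) = c * e + e by field.
  by rewrite lerDl ltW.
have -> : 2 * (S + T * (E u u / al)) * powR T p * h =
   2 * (T * (E u u / al)) * powR T p * h + 2 * powR T p * h * S by ring.
by move: b1 b2; move: (_ * _) (_ * h) (_ * S) => x y z; lra.
Qed.

Lemma by_parts u phi :
  halfint (fun t => tder u t * tder phi t) = - halfint (fun t => val u t * derive1 (tder phi) t).
Proof.
have su := test_smooth u; have sp := smoothR_derive1 (test_smooth phi).
have c1 : cc (fun t => tder u t * tder phi t) by exact: cc_tder_tder.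
have c2 : cc (fun t => val u t * derive1 (tder phi) t).
  have -> : (fun t => val u t * derive1 (tder phi) t) =
     (fun t => derive1 (tder phi) t * val u t) by apply/funext => t; rewrite mulrC.
  exact/cc_mul_test/continuous_smoothR/smoothR_derive1.
apply/eqP; rewrite -addr_eq0 -halfintD//; apply/eqP.
pose f : R -> R := val u \* tder phi.
have sf : smoothR f.
  by apply: smooth_exprP; apply: smooth_mul; exact: smooth_base.
have df t : derive1 f t = tder u t * tder phi t + val u t * derive1 (tder phi) t.
  have h1 := is_derive_smoothR t su; have h2 := is_derive_smoothR t sp.
  have := is_deriveM h1 h2 => h; rewrite derive1E derive_val.
  by rewrite addrC mulrC.
have [a [b [a0 ab uz]]] := test_supp u.
have -> : halfint ((fun t => tder u t * tder phi t) \+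
    (fun t => val u t * derive1 (tder phi) t)) = halfint (derive1 f).
  by apply: eq_halfint => t _; rewrite df.
have fz t : t <= a \/ b <= t -> derive1 f t = 0.
  by move=> /uz[h1 h2]; rewrite df h1 h2 !mul0r addr0.
have cf : cc (derive1 f).
  split; last by exists a, b.
  by move=> x _; apply: continuous_smoothR; exact: smoothR_derive1.
rewrite halfintT// -(cc_restrict fz) -Rintegral_mkcond FTC2_smooth//.
by rewrite /f/= !(proj1 (uz _ _)) ?mul0r ?subrr//; [left|right].
Qed.

Lemma eform_by_parts u phi : E u phi =
  halfint (fun t => val u t * (be * t ^+ 2 * val phi t - al * derive1 (tder phi) t)).
Proof.
have c2 : cc (fun t => val u t * derive1 (tder phi) t).
  have -> : (fun t => val u t * derive1 (tder phi) t) =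
     (fun t => derive1 (tder phi) t * val u t) by apply/funext => t; rewrite mulrC.
  exact/cc_mul_test/continuous_smoothR/smoothR_derive1/smoothR_derive1/test_smooth.
rewrite /eform halfintD; [|exact/ccZ/cc_tder_tder|exact: cc_pot].
rewrite halfintZ; last exact: cc_tder_tder.
rewrite by_parts mulrN -mulNr -halfintZ//.
rewrite -halfintD; [|exact: ccZ|exact: cc_pot].
by apply: eq_halfint => t _ /=; ring.
Qed.

(** Once both derivatives fall on [phi], dividing by the weight, harmless because the support of
    [phi] avoids 0, writes [E u phi] as a weighted pairing of [u] with a fixed [g]. Cauchy-Schwarz
    then gives [c] as the weighted square norm of [g]. *)
Lemma eform_le_wform phi : exists c, forall u, E u phi ^+ 2 <= c * K u u.
Proof.
pose g t := powR t (- p) * (be * t ^+ 2 * val phi t + - al * derive1 (tder phi) t).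
have [a [b [a0 ab fz]]] := test_supp phi.
have dz t : t < a \/ b < t -> derive1 (tder phi) t = 0.
  move=> H; rewrite (@derive1_eq_near _ _ (cst 0)) ?derive1_cst//.
  case: H => h.
    by apply: filterS (lt_nbhsl h) => s sa; case: (fz s _) => //; left; exact: ltW.
  by apply: filterS (lt_nbhsr h) => s sa; case: (fz s _) => //; right; exact: ltW.
have cd : cc (derive1 (tder phi)).
  split.
    by move=> x _; exact/continuous_smoothR/smoothR_derive1/smoothR_derive1/test_smooth.
  exists (a / 2), (b + 1); split; [lra|lra|] => t H.
  by apply: dz; case: H; [left|right]; lra.
have cg : cc g.
  apply: ccM; first by move=> x; exact: continuous_powR.
  by apply: ccD; [exact/cc_mul_test/continuous_quad|exact: ccZ].
exists (halfint (fun t => powR t p * (g t * g t))) => u.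
have cu : cc (val u).
  split; first by move=> x _; exact: continuous_test.
  by have [a' [b' [? ? H]]] := test_supp u; exists a', b'; split => // t /H[].
have -> : E u phi = halfint (fun t => powR t p * (val u t * g t)).
  rewrite eform_by_parts; apply: eq_halfint => t t0; rewrite /g powRN.
  by field; rewrite gt_eqF// powR_gt0.
rewrite mulrC; apply: weighted_CauchySchwarz => //.
  by move=> x; exact: continuous_powR.
by move=> t; exact: powR_ge0.
Qed.

Lemma bump_ex (m : nat) : exists u, K u u = 1 /\
  forall t, t <= m.+1%:R \/ m.+2%:R <= t -> val u t = 0.
Proof.
pose f (t : R) := step_fun (t - m.+1%:R) * step_fun (m.+2%:R - t).
have fz t : t <= m.+1%:R \/ m.+2%:R <= t -> f t = 0.
  by case=> h; rewrite /f; [rewrite step_le0 ?mul0r|rewrite [X in _ * X]step_le0 ?mulr0];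
    rewrite // subr_le0.
have sf : smoothR f.
  apply: smooth_exprP.
  apply: (@smooth_mul _ (fun t => step_fun (t - m.+1%:R)) (fun t => step_fun (m.+2%:R - t))).
    apply: (@smooth_comp _ (@step_fun R) (fun t => t - m.+1%:R)); first exact: smooth_step.
    have -> : (fun t : R => t - m.+1%:R) = (fun t => 1 * t + - m.+1%:R).
      by apply/funext => t; rewrite mul1r.
    exact: smooth_affine.
  apply: (@smooth_comp _ (@step_fun R) (fun t => m.+2%:R - t)); first exact: smooth_step.
  have -> : (fun t : R => m.+2%:R - t) = (fun t => - 1 * t + m.+2%:R).
    by apply/funext => t; rewrite mulN1r addrC.
  exact: smooth_affine.
have [v vf] : exists v, val v = f.
  apply: test_ex; split => //; exists m.+1%:R, m.+2%:R; split => //.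
    by rewrite ler_nat.
  by move=> t H; apply: fz; case: H => /ltW; [left|right].
have v0 : 0 < K v v.
  (* If [K v v] were 0, the bound of [E v v] by [K] would give [v] zero energy, hence zero values
     everywhere, while [f] is positive at the midpoint [x] of its support. *)
  rewrite lt_neqAle (sip_ge0 (wform_semi_inner p)) andbT; apply/eqP => Kv.
  have [c Hc] := eform_le_wform v.
  have := Hc v; rewrite -Kv mulr0 => h.
  have {}h : E v v = 0 by apply/eqP; rewrite -sqrf_eq0 eq_le h sqr_ge0.
  pose x : R := m.+1%:R + 1 / 2.
  have x0 : 0 <= x by rewrite addr_ge0.
  have := test_sqr al0 be0 v x0; rewrite h mul0r mulr0 vf => h2.
  have : f x = 0 by apply/eqP; rewrite -sqrf_eq0 eq_le h2 sqr_ge0.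
  apply/eqP; rewrite gt_eqF// /f /x mulr_gt0// divr_gt0 ?step_den_gt0// flat_gt0//.
    by rewrite addrAC subrr add0r.
  by rewrite -natr1; lra.
exists ((sipn K v)^-1 *: v); split.
  rewrite (sip_sqrZ (wform_semi_inner p)) exprVn (sqr_sipn (wform_semi_inner p)).
  by rewrite mulVf ?gt_eqF.
move=> t /fz ft; have -> : val ((sipn K v)^-1 *: v) t = (sipn K v)^-1 * val v t by [].
by rewrite vf ft mulr0.
Qed.

Lemma wform_infdim : forall m : nat, exists f : nat -> test_space R, forall i j,
  (i <= m)%N -> (j <= m)%N -> K (f i) (f j) = (i == j)%:R.
Proof.
move=> m; have [f Hf] := choice bump_ex; exists f => i j _ _.
have [<-|ij] := eqVneq i j; first by have [] := Hf i.
wlog lij : i j ij / (i < j)%N.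
  move=> H; have [h|h|h] := ltngtP i j; first exact: H.
    by rewrite (sipC (wform_semi_inner p)); apply: H; rewrite // eq_sym.
  by rewrite h eqxx in ij.
have -> : K (f i) (f j) = halfint (fun t => 0 * (val (f i) t * val (f j) t)).
  apply: eq_halfint => t _; have [_ fi] := Hf i; have [_ fj] := Hf j.
  have [h|h] := leP t j.+1%:R; first by rewrite fj ?mulr0//; left.
  rewrite fi ?mul0r ?mulr0//; right; apply: le_trans (ltW h).
  by rewrite ler_nat.
by rewrite halfintZ ?mul0r//; exact: cc_val_val.
Qed.

End TestSpaceBounds.

(** * Compactness *)

Lemma ultra_fmap (T T' : Type) (f : T -> T') (U : set_system T) :
  UltraFilter U -> UltraFilter (f @ U).
Proof.
move=> UU; have PU := @ultra_proper _ _ UU.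
have PF : ProperFilter (f @ U) by exact: fmap_proper_filter.
split => // G PG sFG; apply/seteqP; split => // A GA.
have [//|nA] := in_ultra_setVsetC (f @^-1` A) UU.
have : G (A `&` ~` A) by apply: filterI => //; exact: sFG.
by rewrite setICr => /filter_not_empty.
Qed.

Lemma ultra_bounded_cvg (R : realType) (U : set_system nat) (u : nat -> R) (b : R) :
  UltraFilter U -> (forall k, `|u k| <= b) -> exists l : R, u @ U --> l.
Proof.
move=> UU ub; have FU := ultra_fmap u UU; have PU := @ultra_proper _ _ UU.
have := @segment_compact R (- b) b; rewrite compact_ultra => /(_ _ FU).
have uA : (u @ U) `[- b, b]%classic.
  apply: (@filterS _ U _ setT); last exact: filterT.
  by move=> k _; rewrite /= in_itv/= -ler_norml.
by move=> /(_ uA)[l [_ h]]; exists l.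
Qed.

(** Used with an ultrafilter finer than [\oo], along which the values at all points converge at
    once; this takes the place of a diagonal extraction. The lemma returns to ordinary indices. *)
Lemma proper_extract (U : set_system nat) (A : nat -> set nat) :
  ProperFilter U -> \oo `<=` U -> (forall m, U (A m)) ->
  exists g : nat -> nat, (forall k, (k <= g k)%N) /\
    forall N k, (N <= k)%N -> A N (g k).
Proof.
move=> PU sU UA.
have ex (m : nat) : exists k, (m <= k)%N /\ forall i : 'I_m.+1, A i k.
  have h1 : U [set k | (m <= k)%N] by apply: sU; exists m.
  have h2 : U [set k | forall i : 'I_m.+1, A i k] by apply: filter_forall => i.
  have [k [? ?]] := filter_ex (filterI h1 h2).
  by exists k.
have [g Hg] := choice ex; exists g; split => [k|N k Nk]; first by have [] := Hg k.
by have [_ /(_ (inord N))] := Hg k; rewrite inordK.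
Qed.

Section Compactness.
Variables (R : realType) (al be p : R).
Hypotheses (al0 : 0 < al) (be0 : 0 < be) (p0 : 0 <= p) (p2 : p < 2).
Local Notation E := (eform al be).
Local Notation K := (wform p).

Lemma eform_compact (s : nat -> test_space R) M : (forall k, E (s k) (s k) <= M) ->
  exists g : nat -> nat, (forall k, (k <= g k)%N) /\ sip_cauchy K (s \o g).
Proof.
move=> sM.
have [U [UU sU]] := ultraFilterLemma (F := \oo) _.
have PU := @ultra_proper _ _ UU.
have M0 : 0 <= M by apply: le_trans (sM 0%N); exact: E_ge0.
have cv (t : R) : 0 <= t -> exists l : R, (fun k => val (s k) t) @ U --> l.
  move=> t0; apply: (ultra_bounded_cvg (b := Num.sqrt (t * (M / al)))) => // k.
  rewrite -sqrtr_sqr ler_sqrt ?mulr_ge0 ?invr_ge0 ?(ltW al0)//.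
  apply: (le_trans (test_sqr al0 be0 _ t0)); rewrite ler_wpM2l//.
  by rewrite ler_pM2r ?invr_gt0.
have close e : 0 < e -> exists2 A, U A &
    forall k l, A k -> A l -> K (s k - s l) (s k - s l) < e.
  move=> e0; have M1 : 0 < 8 * (M + 1) by rewrite mulr_gt0// ltr_wpDl.
  have [N [h [C [h0 C0 HC]]]] :=
    wform_finite_rank al0 be0 p0 (ltW p2) p2 (divr_gt0 e0 M1).
  have D0 : 0 < 8 * (N%:R * C + 1) by rewrite mulr_gt0// ltr_wpDl// mulr_ge0.
  (* [eta <= 1] gives [eta ^+ 2 <= eta], so no square root enters the choice of [eta]. *)
  pose eta := Num.min 1 (e / (8 * (N%:R * C + 1))).
  have eta0 : 0 < eta by rewrite lt_min ltr01 divr_gt0.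
  have eta2 : eta ^+ 2 <= e / (8 * (N%:R * C + 1)).
    apply: (@le_trans _ _ eta); last by rewrite ge_min lexx orbT.
    by rewrite expr2 ler_piMl ?(ltW eta0)// ge_min lexx.
  have [L HL] : exists L : nat -> R, forall j : nat,
      (fun k => val (s k) (j%:R * h)) @ U --> L j.
    have ex (j : nat) : exists l : R, (fun k => val (s k) (j%:R * h)) @ U --> l.
      by apply: cv; rewrite mulr_ge0// ltW.
    by have [L HL] := choice ex; exists L.
  exists [set k | forall j : 'I_N, `|L j - val (s k) (j%:R * h)| < eta].
    by apply: filter_forall => j; have /cvgrPdist_lt/(_ _ eta0) := HL j.
  move=> k l Hk Hl; apply: (le_lt_trans (HC _)).
  have h1 : E (s k - s l) (s k - s l) <= 4 * M.
    have := sip_sqrD_le (eform_semi_inner al0 be0) (s k) (- s l).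
    rewrite (sipNl (eform_semi_inner al0 be0)) (sipNr (eform_semi_inner al0 be0)) opprK.
    by have := sM k; have := sM l; lra.
  have h2 : \sum_(j < N) val (s k - s l) (j%:R * h) ^+ 2 <= N%:R * (4 * eta ^+ 2).
    rewrite mulr_natl -[X in _ <= _ *+ X](card_ord N) -sumr_const.
    apply: ler_sum => j _.
    have -> : val (s k - s l) (j%:R * h) = val (s k) (j%:R * h) - val (s l) (j%:R * h) by [].
    have := Hk j; have := Hl j; rewrite !ltr_norml => /andP[a1 a2] /andP[a3 a4].
    have : `|val (s k) (j%:R * h) - val (s l) (j%:R * h)| <= 2 * eta.
      by rewrite ler_norml; lra.
    move=> /(@lerXn2r _ 2); rewrite !nnegrE normr_ge0 mulr_ge0 ?(ltW eta0)//.
    by move=> /(_ isT isT); rewrite real_normK ?num_real// exprMn; lra.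
  have h3 : e / (8 * (M + 1)) * E (s k - s l) (s k - s l) <= e / 2.
    apply: (@le_trans _ _ (e / (8 * (M + 1)) * (4 * M))).
      by rewrite ler_wpM2l// ltW// divr_gt0.
    rewrite -mulrA ler_pM2l// mulrC ler_pdivrMr//; lra.
  have h4 : C * \sum_(j < N) val (s k - s l) (j%:R * h) ^+ 2 < e / 2.
    apply: (@le_lt_trans _ _ (C * (N%:R * (4 * eta ^+ 2)))).
      by rewrite ler_wpM2l.
    apply: (@le_lt_trans _ _ ((N%:R * C) * (4 * (e / (8 * (N%:R * C + 1)))))).
      rewrite mulrCA mulrA ler_wpM2l ?mulr_ge0//.
      by move: (_ / _) eta2 => z; lra.
    have NC : 0 <= N%:R * C by rewrite mulr_ge0.
    move: (N%:R * C) NC D0 => x x0 D0.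
    rewrite mulrA mulrA ltr_pdivrMr//; nra.
  lra.
have ex (m : nat) : exists A : set nat, U A /\
    forall k l, A k -> A l -> K (s k - s l) (s k - s l) < m.+1%:R^-1.
  have m0 : 0 < m.+1%:R^-1 :> R by rewrite invr_gt0.
  by have [A UA HA] := close _ m0; exists A.
have [A HA] := choice ex.
have [|g [gk gA]] := proper_extract PU sU (A := A); first by move=> m; case: (HA m).
exists g; split => // e e0; have [N HN] := invS_lt e0; exists N => k l Nk Nl.
have [_ h] := HA N; apply: (lt_trans (h _ _ _ _)); [exact: gA|exact: gA|exact: HN].
Qed.

End Compactness.

(** * Simplicity of eigenvalues *)

Section ContractionUniqueness.
Variables (R : realType) (u : R -> R) (al : R) (Q : R -> R).
Hypotheses (al0 : 0 < al) (Q0 : forall L, 0 < L -> 0 < Q L) (u0 : u 0 = 0).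
Hypothesis ub : forall L, exists M, forall t, 0 <= t -> t <= L -> `|u t| <= M.
(** An integrated form of [al u'' = V u] with a potential [V] of size [Q L]. It stands in for the
    differential equation, since a limit of test functions has no second derivative at hand. *)
Hypothesis hat : forall L a b c M, 0 <= a -> a < b -> b < c -> c <= L ->
  (forall t, a <= t -> t <= c -> `|u t| <= M) ->
  al * `|(b - a)^-1 * (u b - u a) - (c - b)^-1 * (u c - u b)| <=
  8 * Q L * ((b - a)^-1 + (c - b)^-1) * (c - a) ^+ 2 * M.

(** The supremum of [|u|] over [S] is finite by [ub] and at most half of itself. *)
Lemma contraction_eq0 (S : R -> Prop) : (forall t, S t -> 0 <= t) ->
  (exists L, forall t, S t -> t <= L) ->
  (forall M, 0 <= M -> (forall t, S t -> `|u t| <= M) -> forall t, S t -> `|u t| <= M / 2) ->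
  forall t, S t -> u t = 0.
Proof.
move=> S0 [L SL] contr t St; have [M HM] := ub L.
pose A := [set `|u t| | t in [set t | S t]].
have hA : has_sup A.
  split; first by exists `|u t|, t.
  by exists M => _ [x Sx <-]; apply: HM; [exact: S0|exact: SL].
have bA x : S x -> `|u x| <= sup A by move=> Sx; apply: ub_le_sup; [case: hA|exists x].
have sA0 : 0 <= sup A by apply: le_trans (bA t St).
have h : sup A <= sup A / 2.
  by apply: ge_sup; [case: hA|move=> _ [x Sx <-]; exact: contr].
by apply/eqP; rewrite -normr_eq0 eq_le normr_ge0 andbT; have := bA t St; lra.
Qed.

(** For nodes [0 < b < T] with [u] zero at both ends, the divided difference is [u b] times
    [b^-1 + (T - b)^-1], a factor that also stands on the right of [hat]. Cancelling it leaves
    [8 * Q 1 * T ^+ 2 * M] as a bound of [al * |u b|], which the size of [T] makes at most half of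
    [al * M]. *)
Lemma initial_eq0 T : 0 < T -> T <= 1 -> 16 * Q 1 * T <= al -> u T = 0 ->
  forall t, 0 <= t -> t <= T -> u t = 0.
Proof.
move=> T0 T1 QT uT t t0 tT.
apply: (@contraction_eq0 (fun t => 0 <= t /\ t <= T)) => //; first by move=> ? [].
  by exists T => ? [].
move=> M M0 HM b [b0 bT].
move: b0; rewrite le_eqVlt => /orP[/eqP <-|b0]; first by rewrite u0 normr0; lra.
move: bT; rewrite le_eqVlt => /orP[/eqP ->|bT]; first by rewrite uT normr0; lra.
have := hat (lexx 0) b0 bT T1 (fun t t0 tT => HM t (conj t0 tT)).
rewrite u0 uT !subr0 sub0r mulrN opprK -mulrDl normrM.
have p0 : 0 < b^-1 + (T - b)^-1 by rewrite addr_gt0// invr_gt0// subr_gt0.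
rewrite (gtr0_norm p0) => h.
have {}h : al * `|u b| <= 8 * Q 1 * T ^+ 2 * M.
  rewrite -(ler_pM2l p0) mulrCA; apply: (le_trans h).
  by rewrite le_eqVlt; apply/orP; left; apply/eqP; ring.
have QM : 0 <= Q 1 * M by rewrite mulr_ge0 ?(ltW (Q0 _)).
have h2 : 16 * Q 1 * T ^+ 2 * M <= al * M.
  rewrite ler_wpM2r// (le_trans _ QT)// expr2 mulrA ler_piMr//.
  by rewrite !mulr_ge0 ?(ltW (Q0 _))// ltW.
by rewrite -(ler_pM2l al0); lra.
Qed.

(** March to the right by steps of length [d]. For [tau < c <= tau + d], [u] vanishes at the first
    two of the nodes [tau - d], [tau], [c], so [hat] bounds [u c] alone. *)
Lemma extension_eq0 T L : 0 < T -> (forall t, 0 <= t -> t <= T -> u t = 0) ->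
  0 < L -> forall t, 0 <= t -> t <= L -> u t = 0.
Proof.
move=> T0 uT L0.
have QL := Q0 L0.
(* [d <= T] keeps [tau - d] nonnegative and [d <= 1] gives [d ^+ 2 <= d]. The constant 128 is twice
   [8 * 2 * 4]: the 8 of [hat], then [d^-1 + (c - tau)^-1 <= 2 * (c - tau)^-1], then the squared
   width, at most [4 * d ^+ 2]. *)
pose d := Num.min T (Num.min 1 (al / (128 * Q L))).
have d0 : 0 < d by rewrite !lt_min T0 ltr01 divr_gt0// mulr_gt0.
have dT : d <= T by rewrite ge_min lexx.
have dd : d ^+ 2 <= al / (128 * Q L).
  apply: (@le_trans _ _ d); last by rewrite !ge_min lexx !orbT.
  by rewrite expr2 ler_piMl ?(ltW d0)// !ge_min lexx orbT.
have step n t : 0 <= t -> t <= L -> t <= T + n%:R * d -> u t = 0.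
  elim: n t => [|n IH] t t0 tL; first by rewrite mul0r addr0; exact: uT.
  rewrite -natr1 mulrDl mul1r addrA; move: (T + n%:R * d) (lerDl T (n%:R * d)) IH => tau tauT IH tt.
  have {}tauT : T <= tau by rewrite tauT mulr_ge0// ltW.
  have [ttau|taut] := leP t tau; first exact: IH.
  apply: (@contraction_eq0 (fun t => [/\ tau < t, t <= L & t <= tau + d])) => //.
    by move=> x [h _ _]; lra.
  - by exists L => x [].
  move=> M M0 HM c [c1 c2 c3].
  have a0 : 0 <= tau - d by lra.
  have ab : tau - d < tau by lra.
  have HM' x : tau - d <= x -> x <= c -> `|u x| <= M.
    move=> x1 x2; have [xt|tx] := leP x tau; last by apply: HM; split => //; lra.
    by rewrite IH ?normr0//; lra.
  have := hat a0 ab c1 c2 HM'.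
  rewrite (IH tau) ?(IH (tau - d)); try lra.
  rewrite !subr0 mulr0 sub0r subKr normrN normrM.
  have ct : 0 < c - tau by rewrite subr_gt0.
  have p0 : 0 < (c - tau)^-1 by rewrite invr_gt0.
  rewrite (gtr0_norm p0) => h.
  have dp : d^-1 <= (c - tau)^-1 by rewrite lef_pV2 ?posrE//; lra.
  have {}h : al * `|u c| <= 64 * Q L * d ^+ 2 * M.
    rewrite -(ler_pM2l p0) mulrCA; apply: (le_trans h).
    have hc : (c - (tau - d)) ^+ 2 <= 4 * d ^+ 2.
      have -> : 4 * d ^+ 2 = (2 * d) ^+ 2 by ring.
      by apply: lerXn2r; rewrite ?nnegrE; lra.
    apply: (@le_trans _ _ (8 * Q L * (2 * (c - tau)^-1) * (4 * d ^+ 2) * M)).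
      rewrite ler_wpM2r//; apply: ler_pM => //.
      - by rewrite !mulr_ge0 ?addr_ge0 ?invr_ge0 ?(ltW QL) ?(ltW ct) ?(ltW d0).
      - exact: sqr_ge0.
      - by rewrite ler_wpM2l ?mulr_ge0 ?(ltW QL)//; lra.
    by rewrite le_eqVlt; apply/orP; left; apply/eqP; ring.
  have h2 : 128 * Q L * d ^+ 2 * M <= al * M.
    by rewrite ler_wpM2r// mulrC -ler_pdivlMr// mulr_gt0.
  by rewrite -(ler_pM2l al0); lra.
move=> t t0 tL; have [n Hn] : exists n : nat, t <= T + n%:R * d.
  exists (Num.bound (t / d)).
  have : t / d < (Num.bound (t / d))%:R by apply: archi_boundP; rewrite divr_ge0// ltW.
  by rewrite ltr_pdivrMr//; lra.
exact: (step n).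
Qed.

End ContractionUniqueness.

Lemma halfint_bound (R : realType) (f : R -> R) x y C : cc f -> x <= y ->
  (forall t, t <= x \/ y <= t -> f t = 0) ->
  (forall t, x <= t -> t <= y -> `|f t| <= C) -> `|halfint f| <= C * (y - x).
Proof.
move=> cf xy fz fC.
have ci : (@lebesgue_measure R).-integrable `[x, y] (EFin \o f) by exact: cc_integrable.
have ciC C' : (@lebesgue_measure R).-integrable `[x, y] (EFin \o (fun=> C')).
  exact/integrable_itv_continuous/cst_continuous.
have -> : halfint f = \int[lebesgue_measure]_(t in `[x, y]) f t.
  by rewrite halfintT// -{1}(cc_restrict fz) -Rintegral_mkcond.
have H1 : \int[lebesgue_measure]_(t in `[x, y]) f t <= C * (y - x).
  rewrite -Rintegral_itv_cst//; apply: le_Rintegral => // t /=.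
  by rewrite in_itv/= => /andP[t1 t2]; apply: le_trans (fC t t1 t2); exact: ler_norm.
have H2 : - C * (y - x) <= \int[lebesgue_measure]_(t in `[x, y]) f t.
  rewrite -Rintegral_itv_cst//; apply: le_Rintegral => // t /=.
  rewrite in_itv/= => /andP[t1 t2]; have := fC t t1 t2.
  by rewrite ler_norml => /andP[].
by rewrite ler_norml; lra.
Qed.

(** * Smoothed hat functions and their pairing with derivatives *)

Section Hats.
Variable R : realType.
Implicit Types (e a b c t : R).
Notation mu := (@lebesgue_measure R).

(* A smooth approximation of [t |-> max 0 (t - a)], exact outside
   [a + e < t < a + 2 e]. *)
Definition sramp e a t := e * soft_ramp ((t - a) / e).

Lemma smooth_sramp e a : smooth_expr (sramp e a).
Proof.
apply: (@smooth_mul _ (fun=> e) (fun t => soft_ramp ((t - a) / e))).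
  exact: smooth_cst.
apply: (@smooth_comp _ (@soft_ramp R) (fun t => (t - a) / e)); first exact: smooth_soft_ramp.
have -> : (fun t : R => (t - a) / e) = (fun t => e^-1 * t + - a / e).
  by apply/funext => t; rewrite mulrBl mulNr mulrC.
exact: smooth_affine.
Qed.

Lemma sramp_le e a t : 0 < e -> t <= a + e -> sramp e a t = 0.
Proof.
move=> e0 h; rewrite /sramp soft_ramp_le1 ?mulr0// ler_pdivrMr// mul1r; lra.
Qed.

Lemma sramp_ge e a t : 0 < e -> a + 2 * e <= t -> sramp e a t = t - a.
Proof.
move=> e0 h; rewrite /sramp soft_ramp_ge2; first by rewrite mulrC divfK ?gt_eqF.
by rewrite ler_pdivlMr//; lra.
Qed.

Lemma sramp_norm e a t : 0 < e -> `|sramp e a t| <= `|t - a|.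
Proof.
move=> e0; rewrite /sramp /soft_ramp mulrA [e * _]mulrC divfK ?gt_eqF// normrM.
by rewrite ler_piMr// ger0_norm ?step_ge0 ?step_le1.
Qed.

Lemma derive1_sramp e a t : 0 < e ->
  derive1 (sramp e a) t = derive1 (@soft_ramp R) ((t - a) / e).
Proof.
move=> e0.
have d1 : is_derive t 1 (fun t : R => (t - a) / e) e^-1.
  have -> : (fun t : R => (t - a) / e) = (fun t => e^-1 *: (t - a)).
    by apply/funext => x; rewrite mulrC.
  have h : is_derive t 1 (fun t : R => t - a) (1 - 0) by exact: is_deriveB.
  by have := is_deriveZ e^-1 h; rewrite subr0 /GRing.scale/= mulr1.
have d2 := is_derive_smoothR ((t - a) / e) (smooth_exprP (smooth_soft_ramp R)).
have d3 := is_deriveZ e (is_derive1_comp (g := fun t : R => (t - a) / e) d2 d1).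
rewrite derive1E (_ : sramp e a = e *: (@soft_ramp R \o (fun t => (t - a) / e)))//.
by rewrite derive_val /GRing.scale/= mulrCA divff ?gt_eqF// mulr1.
Qed.

(** Without smoothing, the three ramps add up to the tent with height 1 at [b] and support [[a, c]].
    Pairing its derivative with [v'] produces the second divided difference of [v] at the three
    nodes. *)
Definition hatf e a b c t :=
  ((b - a)^-1 * sramp e a t + - ((b - a)^-1 + (c - b)^-1) * sramp e b t)
  + (c - b)^-1 * sramp e c t.

Lemma hatf_eq0 e a b c t : 0 < e -> a < b -> b < c ->
  t <= a + e \/ c + 2 * e <= t -> hatf e a b c t = 0.
Proof.
move=> e0 ab bc [h|h]; rewrite /hatf.
  by rewrite !sramp_le ?mulr0 ?addr0//; lra.
rewrite !sramp_ge//; try lra.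
by field; rewrite !subr_eq0 !gt_eqF.
Qed.

Lemma smooth_hatf e a b c : smoothR (hatf e a b c).
Proof.
apply: smooth_exprP.
have m k x : smooth_expr (fun t => k * sramp e x t).
  apply: (@smooth_mul _ (fun=> k) (sramp e x)); first exact: smooth_cst.
  exact: smooth_sramp.
apply: (@smooth_add _ (fun t => (b - a)^-1 * sramp e a t +
     - ((b - a)^-1 + (c - b)^-1) * sramp e b t)
   (fun t => (c - b)^-1 * sramp e c t)) => //.
exact: (@smooth_add _ (fun t => (b - a)^-1 * sramp e a t)
   (fun t => - ((b - a)^-1 + (c - b)^-1) * sramp e b t)).
Qed.

Lemma hat_ex e a b c : 0 < e -> 0 <= a -> a < b -> b < c ->
  exists phi : test_space R, val phi = hatf e a b c.
Proof.
move=> e0 a0 ab bc; apply: test_ex; split; first exact: smooth_hatf.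
exists (a + e), (c + 2 * e); split; [lra|lra|].
by move=> t H; apply: hatf_eq0 => //; case: H => /ltW; [left|right].
Qed.

Lemma hatf_bound e a b c t : 0 < e -> a < b -> b < c -> a <= t -> t <= c + 2 * e ->
  `|hatf e a b c t| <= 2 * ((b - a)^-1 + (c - b)^-1) * (c - a + 2 * e).
Proof.
move=> e0 ab bc ta tc; rewrite /hatf.
have p1 : 0 < (b - a)^-1 by rewrite invr_gt0 subr_gt0.
have p3 : 0 < (c - b)^-1 by rewrite invr_gt0 subr_gt0.
have B x : a <= x -> x <= c -> `|sramp e x t| <= c - a + 2 * e.
  move=> ax xc; apply: (le_trans (sramp_norm _ _ e0)).
  by rewrite ler_norml; lra.
have h1 := B a (lexx _) (ltW (lt_trans ab bc)).
have h2 := B b (ltW ab) (ltW bc).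
have h3 := B c (ltW (lt_trans ab bc)) (lexx _).
apply: (le_trans (ler_normD _ _)); rewrite normrM (gtr0_norm p3).
apply: (@le_trans _ _ ((b - a)^-1 * (c - a + 2 * e) +
   ((b - a)^-1 + (c - b)^-1) * (c - a + 2 * e) + (c - b)^-1 * (c - a + 2 * e))).
  apply: lerD; last by rewrite ler_pM2l.
  apply: (le_trans (ler_normD _ _)); rewrite mulNr normrN.
  rewrite [X in X + _ <= _]normrM [X in _ + X <= _]normrM (gtr0_norm p1).
  rewrite (gtr0_norm (addr_gt0 p1 p3)).
  by apply: lerD; rewrite ler_pM2l// addr_gt0.
by rewrite le_eqVlt; apply/orP; left; apply/eqP; ring.
Qed.

Variables (al be p : R).
Hypotheses (al0 : 0 < al) (be0 : 0 < be).
Local Notation E := (eform al be).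
Local Notation K := (wform p).
Implicit Types v phi : test_space R.

Lemma cc_tder_sramp v e a : cc (fun t => tder v t * derive1 (sramp e a) t).
Proof.
have -> : (fun t => tder v t * derive1 (sramp e a) t) =
  (fun t => derive1 (sramp e a) t * tder v t) by apply/funext => t; rewrite mulrC.
exact/cc_mul_tder/continuous_smoothR/smoothR_derive1/smooth_exprP/smooth_sramp.
Qed.

(** Beyond [a + 2 * e] the ramp has slope 1, and the integral there is exactly
    [- val v (a + 2 * e)]. What remains is a transition zone of length of order [e], where Young's
    inequality with parameter [eta] separates the energy of [v] from the bounded slope of the
    ramp. *)
Lemma ramp_pairing v e a eta M : 0 < e -> 0 <= a -> 0 < eta ->
  (forall x, `|derive1 (@soft_ramp R) x| <= M) ->
  `|halfint (fun t => tder v t * derive1 (sramp e a) t) + val v (a + 2 * e)| <=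
  eta / 2 * (E v v / al) + M ^+ 2 / (2 * eta) * (2 * e).
Proof.
move=> e0 a0 eta0 HM.
set f := fun t => _.
have cf : cc f by exact: cc_tder_sramp.
have [a' [b' [a'0 ab' vz]]] := test_supp v.
(* [x] lies strictly left of [a + e], where the slope of the ramp is already known to be 0; [B] lies
   beyond the support of [v]. *)
pose x := a + e / 2; pose y := a + 2 * e; pose B := Num.max b' (a + 3 * e).
have xy : x < y by rewrite /x /y; lra.
have yB : y < B by rewrite /y /B lt_max; apply/orP; right; lra.
have fz t : t <= x \/ B <= t -> f t = 0.
  case=> h; rewrite /f.
    rewrite derive1_sramp// derive1_soft_ramp_lt1 ?mulr0// ltr_pdivrMr// mul1r.
    by move: h; rewrite /x; lra.
  by rewrite (proj2 (vz t _)) ?mul0r//; right; move: h; rewrite ge_max => /andP[].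
have ciT t1 t2 : mu.-integrable `[t1, t2] (EFin \o f) by exact: cc_integrable.
have fI : halfint f = \int[mu]_(t in `[x, B]) f t.
  by rewrite halfintT// -{1}(cc_restrict fz) -Rintegral_mkcond.
have fyB : \int[mu]_(t in `]y, B]) f t = - val v y.
  have -> : \int[mu]_(t in `]y, B]) f t = \int[mu]_(t in `]y, B]) tder v t.
    apply: eq_Rintegral => t; rewrite inE/= in_itv/= => /andP[yt _].
    rewrite /f derive1_sramp// derive1_soft_ramp_gt2 ?mulr1//.
    by rewrite ltr_pdivlMr//; move: yt; rewrite /y; lra.
  have ci : mu.-integrable `[y, B] (EFin \o tder v).
    exact/integrable_itv_continuous/continuous_tder.
  rewrite Rintegral_itv_obnd_cbnd; last first.
    by apply: integrableS ci => //; apply: subset_itvr; rewrite bnd_simp.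
  rewrite FTC2_smooth//; last exact: test_smooth.
  by rewrite (proj1 (vz B _)) ?sub0r//; right; rewrite /B le_max lexx.
have -> : halfint f + val v y = \int[mu]_(t in `[x, y]) f t.
  rewrite fI; have := @Rintegral_itvB R f (BLeft x) (BRight B) y (ciT x B).
  rewrite !bnd_simp fyB => /(_ (ltW xy) (ltW yB)).
  by move: (\int[mu]_(t in _) _) (\int[mu]_(t in _) _) => i1 i2; lra.
apply: (le_trans (le_normr_Rintegral _ (ciT x y))) => //.
have ci2 : mu.-integrable `[x, y] (EFin \o (fun t => eta / 2 * tder v t ^+ 2)).
  by apply: cc_integrable => //; apply: ccZ; exact: cc_tder_tder.
have cic : mu.-integrable `[x, y] (EFin \o (fun=> M ^+ 2 / (2 * eta))).
  exact/integrable_itv_continuous/cst_continuous.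
apply: (@le_trans _ _ (\int[mu]_(t in `[x, y]) (eta / 2 * tder v t ^+ 2 + M ^+ 2 / (2 * eta)))).
  apply: le_Rintegral => //.
  - have := integrable_abse (ciT x y); apply: eq_integrable => //.
  - by have := integrableD _ ci2 cic; apply.
  - move=> t _; rewrite /f normrM.
    have h := HM ((t - a) / e); rewrite derive1_sramp//.
    rewrite -(real_normK (num_real (tder v t))).
    set X := `|tder v t|; set Y := `|derive1 _ _| in h *.
    have X0 : 0 <= X by exact: normr_ge0.
    have : X * Y <= X * M by rewrite ler_wpM2l.
    have : 0 <= (eta * X - M) ^+ 2 / (2 * eta).
      by rewrite divr_ge0 ?sqr_ge0// mulr_ge0// ltW.
    have -> : (eta * X - M) ^+ 2 / (2 * eta) = eta / 2 * X ^+ 2 + M ^+ 2 / (2 * eta) - X * M.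
      by field; rewrite gt_eqF.
    by rewrite subr_ge0 => h1 h2; exact: le_trans h2 h1.
rewrite RintegralD//.
apply: lerD.
  apply: (@le_trans _ _ (halfint (fun t => eta / 2 * tder v t ^+ 2))).
    apply: cc_subset_le => //; first by apply: ccZ; exact: cc_tder_tder.
    by move=> t; rewrite mulr_ge0 ?sqr_ge0 ?divr_ge0// ltW.
  rewrite halfintZ; last exact: cc_tder_tder.
  by rewrite ler_wpM2l ?divr_ge0 ?(ltW eta0)//; exact: dirichlet_le.
rewrite Rintegral_itv_cst ?(ltW xy)// ler_wpM2l ?divr_ge0 ?sqr_ge0 ?mulr_ge0 ?(ltW eta0)//.
by rewrite /x /y; lra.
Qed.

Lemma test_dist v M0 x y k : 0 <= k -> E v v <= M0 -> `|y - x| * (M0 / al) <= k ^+ 2 ->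
  `|val v y - val v x| <= k.
Proof.
move=> k0 vM h; rewrite -(@ler_pXn2r _ 2)// ?nnegrE// real_normK ?num_real//.
apply: (le_trans (test_dist_sqr al0 be0 v x y)); apply: le_trans h.
by rewrite ler_wpM2l// ler_pM2r// invr_gt0.
Qed.

(** The threshold [e0] is uniform in [v] and [a]: the smoothing has to be fixed before the term of
    the Cauchy sequence is selected. *)
Lemma ramp_pairing_small M0 k : 0 <= M0 -> 0 < k -> exists2 e0, 0 < e0 &
  forall e, 0 < e -> e <= e0 -> forall v, E v v <= M0 -> forall a, 0 <= a ->
  `|halfint (fun t => tder v t * derive1 (sramp e a) t) + val v a| <= k.
Proof.
move=> M00 k0; have [M M1 HM] := derive1_soft_ramp_bound R.
have I0 : 0 < M0 / al + 1 by rewrite ltr_wpDl// divr_ge0// ltW.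
have Mp0 : 0 < M by lra.
have Mp : 0 < M ^+ 2 by rewrite exprn_gt0.
(* [eta] reduces the energy term of Young's inequality to [k / 2]. Then [e1] reduces the slope term
   to [k / 4], and [e2] does the same for the replacement of [val v (a + 2 * e)] by [val v a]. *)
pose eta := k / (M0 / al + 1).
have eta0 : 0 < eta by rewrite divr_gt0.
pose e1 := k * eta / (4 * M ^+ 2).
pose e2 := k ^+ 2 / (32 * (M0 / al + 1)).
have e10 : 0 < e1 by apply: divr_gt0; exact: mulr_gt0.
have e20 : 0 < e2 by apply: divr_gt0; [exact: exprn_gt0|exact: mulr_gt0].
exists (Num.min e1 e2); first by rewrite lt_min e10.
move=> e ep; rewrite le_min => /andP[ee1 ee2] v vM a a0.
have h := ramp_pairing v ep a0 eta0 HM.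
have vI : E v v / al <= M0 / al by rewrite ler_pM2r ?invr_gt0.
have b1 : eta / 2 * (E v v / al) <= k / 2.
  apply: (@le_trans _ _ (eta / 2 * (M0 / al + 1))).
    by rewrite ler_wpM2l ?divr_ge0 ?(ltW eta0)//; lra.
  rewrite /eta mulrAC divfK ?gt_eqF//.
have b2 : M ^+ 2 / (2 * eta) * (2 * e) <= k / 4.
  apply: (@le_trans _ _ (M ^+ 2 / (2 * eta) * (2 * e1))).
    apply: ler_wpM2l; last by rewrite ler_pM2l.
    apply: divr_ge0; first exact: sqr_ge0.
    by apply: mulr_ge0 => //; exact: ltW.
  rewrite /e1 le_eqVlt; apply/orP; left; apply/eqP; field.
  by rewrite !gt_eqF//; lra.
have b3 : `|val v (a + 2 * e) - val v a| <= k / 4.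
  apply: (test_dist _ vM); first by rewrite divr_ge0 ?ltW.
  rewrite addrAC subrr add0r gtr0_norm ?mulr_gt0//.
  apply: (@le_trans _ _ (2 * e2 * (M0 / al + 1))).
    apply: ler_pM; [by apply: mulr_ge0 => //; exact: ltW| |by rewrite ler_pM2l|by rewrite lerDl].
    by apply: divr_ge0 => //; exact: ltW.
  rewrite /e2 le_eqVlt; apply/orP; left; apply/eqP.
  by move: (M0 / al + 1) I0 => x x0; field; rewrite gt_eqF.
move: h b3; rewrite !ler_norml; set J := halfint _; set I := eta / 2 * _ in b1 *.
by move: (M ^+ 2 / _ * _) b2 => z b2; lra.
Qed.

End Hats.

Lemma halfint_lin3 (R : realType) (f d1 d2 d3 d : R -> R) (q1 q2 q3 : R) :
  cc (fun t => f t * d1 t) -> cc (fun t => f t * d2 t) -> cc (fun t => f t * d3 t) ->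
  (forall t, d t = (q1 * d1 t + q2 * d2 t) + q3 * d3 t) ->
  halfint (fun t => f t * d t) = q1 * halfint (fun t => f t * d1 t) +
    q2 * halfint (fun t => f t * d2 t) + q3 * halfint (fun t => f t * d3 t).
Proof.
move=> c1 c2 c3 dE; rewrite -!halfintZ//.
rewrite -halfintD; [|exact: ccZ|exact: ccZ].
rewrite -halfintD; [|by apply: ccD; exact: ccZ|exact: ccZ].
by apply: eq_halfint => t _; rewrite dE /=; ring.
Qed.

Lemma second_difference_close (R : realType) (q1 q3 A B C x y z k : R) :
  0 < q1 -> 0 < q3 -> `|A + x| <= k -> `|B + y| <= k -> `|C + z| <= k ->
  `|q1 * A + - (q1 + q3) * B + q3 * C - (q1 * (y - x) - q3 * (z - y))|
    <= 2 * (q1 + q3) * k.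
Proof.
move=> q10 q30 h1 h2 h3.
have -> : q1 * A + - (q1 + q3) * B + q3 * C - (q1 * (y - x) - q3 * (z - y)) =
  q1 * (A + x) - (q1 + q3) * (B + y) + q3 * (C + z) by ring.
apply: (le_trans (ler_normD _ _)).
have -> : 2 * (q1 + q3) * k = q1 * k + (q1 + q3) * k + q3 * k by ring.
apply: lerD; last by rewrite normrM gtr0_norm// ler_pM2l.
apply: (le_trans (ler_normB _ _)).
apply: lerD; rewrite normrM gtr0_norm ?addr_gt0// ler_pM2l ?addr_gt0//.
Qed.

Lemma second_difference_dist (R : realType) (q1 q3 x y z x' y' z' k : R) :
  0 < q1 -> 0 < q3 -> `|x - x'| <= k -> `|y - y'| <= k -> `|z - z'| <= k ->
  `|(q1 * (y' - x') - q3 * (z' - y')) - (q1 * (y - x) - q3 * (z - y))|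
    <= 2 * (q1 + q3) * k.
Proof.
move=> q10 q30 h1 h2 h3.
have -> : (q1 * (y' - x') - q3 * (z' - y')) - (q1 * (y - x) - q3 * (z - y)) =
  q1 * ((y' - y) - (x' - x)) - q3 * ((z' - z) - (y' - y)) by ring.
apply: (le_trans (ler_normB _ _)); rewrite !normrM (gtr0_norm q10) (gtr0_norm q30).
have -> : 2 * (q1 + q3) * k = q1 * (2 * k) + q3 * (2 * k) by ring.
move: h1 h2 h3; rewrite !ler_norml => /andP[? ?] /andP[? ?] /andP[? ?].
by apply: lerD; rewrite ler_pM2l// ler_norml; apply/andP; split; lra.
Qed.

(** Smoothed hats reach past their last node [c]. A bound of the limit on [[a, c]] is carried over
    to an approximant on the longer interval through its modulus of continuity. *)
Lemma bound_extend (R : realType) (u v : R -> R) (a c d M k : R) : 0 <= d -> a <= c ->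
  (forall t, a <= t -> t <= c -> `|u t| <= M) ->
  (forall t, a <= t -> t <= c -> `|v t - u t| <= k) ->
  (forall x y, `|y - x| <= d -> `|v y - v x| <= k) ->
  forall t, a <= t -> t <= c + d -> `|v t| <= M + 2 * k.
Proof.
move=> d0 ac hu hvu hv t ta tc; pose t' := Num.min t c.
have t'a : a <= t' by rewrite le_min ta.
have t'c : t' <= c by rewrite ge_min lexx orbT.
have tt' : `|t - t'| <= d.
  by rewrite ger0_norm ?subr_ge0 ?ge_min ?lexx// /t'; case: (leP t c) => h; lra.
move: (hv _ _ tt') (hvu t' t'a t'c) (hu t' t'a t'c).
rewrite !ler_norml => /andP[? ?] /andP[? ?] /andP[? ?].
by apply/andP; split; lra.
Qed.

Lemma hat_support_arith (R : realType) (a c e L : R) :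
  0 <= a -> a < c -> c <= L -> 0 < e -> 2 * e <= c - a ->
  [/\ a <= c + 2 * e, c + 2 * e <= 2 * L, c - a + 2 * e <= 2 * (c - a) &
    c + 2 * e - a <= 2 * (c - a)].
Proof. by move=> *; split; lra. Qed.

(** * Pointwise limits of energy-Cauchy sequences and their divided differences *)

Section LimitFunction.
Variables (R : realType) (al be p l : R).
Hypotheses (al0 : 0 < al) (be0 : 0 < be) (p0 : 0 <= p).
Local Notation E := (eform al be).
Local Notation K := (wform p).
Notation mu := (@lebesgue_measure R).
Implicit Types v phi : test_space R.

(** A bound of [l * powR t p - be * t ^+ 2] up to [2 * L] rather than [L], to cover hats that reach
    past their last node; the [+ 1] makes it positive. *)
Definition potential_bound (L : R) := `|l| * powR (2 * L) p + be * (2 * L) ^+ 2 + 1.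

Lemma potential_bound_gt0 L : 0 < potential_bound L.
Proof.
rewrite ltr_wpDl// addr_ge0//; apply: mulr_ge0; rewrite ?powR_ge0//; first exact: ltW.
exact: sqr_ge0.
Qed.

Lemma potential_boundP L t : 0 <= t -> t <= 2 * L ->
  `|l * powR t p - be * t ^+ 2| <= potential_bound L.
Proof.
move=> t0 tL; apply: (le_trans (ler_normB _ _)).
rewrite [X in X + _]normrM [X in _ + X]normrM.
rewrite (ger0_norm (powR_ge0 _ _)) (gtr0_norm be0) (ger0_norm (sqr_ge0 t)).
apply: (@le_trans _ _ (`|l| * powR (2 * L) p + be * (2 * L) ^+ 2)).
  have L0 : 0 <= 2 * L by apply: le_trans tL.
  apply: lerD; first by rewrite ler_wpM2l// ge0_ler_powR.
  by rewrite ler_pM2l// lerXn2r.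
by rewrite /potential_bound lerDl.
Qed.

Lemma hat_pairing M0 k : 0 <= M0 -> 0 < k -> exists2 e0, 0 < e0 &
  forall e a b c phi, 0 < e -> e <= e0 -> 0 <= a -> a < b -> b < c ->
  val phi = hatf e a b c -> forall v, E v v <= M0 ->
  `|halfint (fun t => tder v t * tder phi t) -
    ((b - a)^-1 * (val v b - val v a) - (c - b)^-1 * (val v c - val v b))|
  <= 2 * ((b - a)^-1 + (c - b)^-1) * k.
Proof.
move=> M00 k0; have [e0 e00 H] := ramp_pairing_small al0 be0 M00 k0.
exists e0 => // e a b c phi ep ee a0 ab bc phiE v vM.
have p1 : 0 < (b - a)^-1 by rewrite invr_gt0 subr_gt0.
have p3 : 0 < (c - b)^-1 by rewrite invr_gt0 subr_gt0.
have h1 := H e ep ee v vM a a0.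
have h2 := H e ep ee v vM b (le_trans a0 (ltW ab)).
have h3 := H e ep ee v vM c (le_trans a0 (ltW (lt_trans ab bc))).
have dphi t : tder phi t = ((b - a)^-1 * derive1 (sramp e a) t +
    - ((b - a)^-1 + (c - b)^-1) * derive1 (sramp e b) t) +
    (c - b)^-1 * derive1 (sramp e c) t.
  have sr x := is_derive_smoothR t (smooth_exprP (smooth_sramp e x)).
  have d1 := is_deriveZ (b - a)^-1 (sr a).
  have d2 := is_deriveZ (- ((b - a)^-1 + (c - b)^-1)) (sr b).
  have d3 := is_deriveZ (c - b)^-1 (sr c).
  have d := is_deriveD (is_deriveD d1 d2) d3.
  by rewrite /tder phiE derive1E; have := @derive_val _ _ _ _ _ _ _ d.
rewrite (halfint_lin3 (cc_tder_sramp _ _ _) (cc_tder_sramp _ _ _)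
  (cc_tder_sramp _ _ _) dphi).
exact: second_difference_close.
Qed.

Variable s : nat -> test_space R.
Hypothesis cs : sip_cauchy E s.
Hypothesis eig : forall phi, (fun k => E (s k) phi - l * K (s k) phi) @ \oo --> (0 : R).

(** The function behind an element of the completion; for [t >= 0] the limit exists because the
    energy controls point values. *)
Definition limfun (t : R) : R := lim ((fun k => val (s k) t) @ \oo).

Lemma test_cauchy_uniform L e : 0 <= L -> 0 < e -> exists N : nat,
  forall k m t, (N <= k)%N -> (N <= m)%N -> 0 <= t -> t <= L ->
  `|val (s k) t - val (s m) t| < e.
Proof.
move=> L0 e0; have L1 : 0 < L + 1 by rewrite ltr_wpDl.
have d0 : 0 < e ^+ 2 * al / (L + 1) by rewrite divr_gt0// mulr_gt0// exprn_gt0.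
have [N HN] := cs d0; exists N => k m t Nk Nm t0 tL.
rewrite -(@ltr_pXn2r _ 2)// ?nnegrE ?ltW// real_normK ?num_real//.
have -> : val (s k) t - val (s m) t = val (s k - s m) t by [].
apply: (le_lt_trans (test_sqr al0 be0 _ t0)).
have := HN k m Nk Nm; rewrite ltr_pdivlMr// => h.
have X0 := E_ge0 al0 be0 (s k - s m).
rewrite mulrA ltr_pdivrMr//; apply: le_lt_trans h.
by rewrite mulrC ler_wpM2l//; lra.
Qed.

Lemma limfun_cvg t : 0 <= t -> (fun k => val (s k) t) @ \oo --> limfun t.
Proof.
move=> t0; apply: real_cauchy_cvg => e e0.
have [N HN] := test_cauchy_uniform t0 e0.
by exists N => k m Nk Nm; apply: HN.
Qed.

Lemma limfun_uniform L e : 0 <= L -> 0 < e -> exists N : nat,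
  forall k t, (N <= k)%N -> 0 <= t -> t <= L -> `|val (s k) t - limfun t| <= e.
Proof.
move=> L0 e0; have e2 : 0 < e / 2 by rewrite divr_gt0.
have [N HN] := test_cauchy_uniform L0 e2; exists N => k t Nk t0 tL.
have /cvgrPdist_lt/(_ _ e2)[N' _ HN'] := limfun_cvg t0.
have h1 := HN k (maxn N N') t Nk (leq_maxl _ _) t0 tL.
have h2 := HN' (maxn N N') (leq_maxr _ _).
move: h1 h2; rewrite /= !ltr_norml ler_norml => /andP[? ?] /andP[? ?].
by apply/andP; split; lra.
Qed.

Lemma limfun0 : limfun 0 = 0.
Proof.
by rewrite /limfun; under eq_fun do rewrite (test_eq0 _ (lexx 0)); rewrite lim_cst.
Qed.

Lemma energy_bound : exists2 M0, 0 <= M0 & forall k, E (s k) (s k) <= M0.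
Proof.
have [M M1 HM] := sip_cauchy_bound (eform_semi_inner al0 be0) cs.
exists (M ^+ 2) => [|k]; first exact: sqr_ge0.
rewrite -(sqr_sipn (eform_semi_inner al0 be0)) lerXn2r// ?nnegrE ?sipn_ge0//.
exact: ltW.
Qed.

Lemma limfun_bound L : exists M, forall t, 0 <= t -> t <= L -> `|limfun t| <= M.
Proof.
have [M0 M00 HM] := energy_bound.
have [L0|L0] := ltP L 0; first by exists 0 => t t0 tL; lra.
have [N HN] := limfun_uniform L0 ltr01.
exists (Num.sqrt (L * (M0 / al)) + 1) => t t0 tL.
have := HN N t (leqnn N) t0 tL.
have : `|val (s N) t| <= Num.sqrt (L * (M0 / al)).
  rewrite -sqrtr_sqr ler_sqrt; last first.
    by apply: mulr_ge0 => //; apply: divr_ge0 => //; exact: ltW.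
  apply: (le_trans (test_sqr al0 be0 _ t0)); apply: ler_pM => //.
    by apply: divr_ge0; [exact: E_ge0|exact: ltW].
  by rewrite ler_pM2r ?invr_gt0.
rewrite !ler_norml => /andP[? ?] /andP[? ?]; apply/andP; split; lra.
Qed.

Lemma le_slack (x y C : R) : 0 <= C -> (forall k, 0 < k -> x <= y + k * C) -> x <= y.
Proof.
move=> C0 H; apply/ler_addgt0Pr => e e0.
have C1 : 0 < C + 1 by rewrite ltr_wpDl.
apply: (le_trans (H _ (divr_gt0 e0 C1))); rewrite lerD2l mulrAC ler_pdivrMr//.
by rewrite ler_pM2l// lerDl.
Qed.

(** The weak equation is tested with a hat. The order of choices matters: the slack [k], then the
    smoothing [e], which fixes the test function, and only then an index at which both the residual
    of the equation and the distance to the limit are at most [k]. *)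
Lemma limfun_hat L a b c M : 0 <= a -> a < b -> b < c -> c <= L ->
  (forall t, a <= t -> t <= c -> `|limfun t| <= M) ->
  al * `|(b - a)^-1 * (limfun b - limfun a) - (c - b)^-1 * (limfun c - limfun b)| <=
  8 * potential_bound L * ((b - a)^-1 + (c - b)^-1) * (c - a) ^+ 2 * M.
Proof.
move=> a0 ab bc cL HM; have QP := @potential_boundP L; have Q0 := potential_bound_gt0 L.
move: (potential_bound L) QP Q0 => Q QP Q0.
have ac := lt_trans ab bc; have ca0 : 0 < c - a by rewrite subr_gt0.
have M_ge0 : 0 <= M by apply: le_trans (HM a (lexx _) (ltW ac)).
have L0 : 0 <= L by lra.
have p1 : 0 < (b - a)^-1 by rewrite invr_gt0 subr_gt0.
have p3 : 0 < (c - b)^-1 by rewrite invr_gt0 subr_gt0.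
have [P PE] : exists P, P = (b - a)^-1 + (c - b)^-1 by eexists.
have P0 : 0 < P by rewrite PE addr_gt0.
rewrite -PE.
have [M0 M00 HE] := energy_bound.
(* The constant collects the coefficients of [k]: two errors of size [2 * P * k], multiplied by
   [al], between the divided difference of the limit and the pairing; the residual of the equation;
   and the excess [2 * k] in the bound of [v]. *)
apply: (@le_slack _ _ (4 * al * P + 1 + 16 * Q * P * (c - a) ^+ 2)).
  have h1 : 0 <= al * P by apply: mulr_ge0; exact: ltW.
  have h2 : 0 <= Q * P * (c - a) ^+ 2.
    by apply: mulr_ge0; [apply: mulr_ge0; exact: ltW|exact: sqr_ge0].
  by move: h1 h2; rewrite -!mulrA; lra.
move=> k k0; have [e0 e00 He] := hat_pairing M00 k0.
have I0 : 0 <= M0 / al by apply: divr_ge0 => //; exact: ltW.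
have I1 : 0 < 2 * (M0 / al + 1) by apply: mulr_gt0 => //; rewrite ltr_wpDl.
have [e [ep ee0 ec ek]] : exists e, [/\ 0 < e, e <= e0, 2 * e <= c - a &
    2 * e * (M0 / al) <= k ^+ 2].
  exists (Num.min e0 (Num.min ((c - a) / 2) (k ^+ 2 / (2 * (M0 / al + 1))))).
  set e := Num.min _ _.
  have ep : 0 < e.
    by rewrite !lt_min e00 divr_gt0//=; apply: divr_gt0 => //; exact: exprn_gt0.
  split => //; first by rewrite ge_min lexx.
    have : e <= (c - a) / 2 by rewrite !ge_min lexx orbT.
    by move: (e) => e'; lra.
  have : e <= k ^+ 2 / (2 * (M0 / al + 1)) by rewrite !ge_min lexx !orbT.
  rewrite ler_pdivlMr// => h; apply: le_trans h.
  have : 0 <= e * 2 by apply: mulr_ge0 => //; exact: ltW.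
  by move: (M0 / al) (e) => x e' h; lra.
have [phi phiE] := hat_ex ep a0 ab bc.
have {}He := He e a b c phi ep ee0 a0 ab bc phiE.
have hb t := @hatf_bound R e a b c t ep ab bc.
have hz t := @hatf_eq0 R e a b c t ep ab bc.
rewrite -phiE in hb hz; rewrite -PE in He hb.
have [N1 HN1] : exists N1 : nat, forall j, (N1 <= j)%N -> `|E (s j) phi - l * K (s j) phi| <= k.
  have /cvgrPdist_lt/(_ _ k0)[N1 _ h] := eig phi.
  by exists N1 => j /h /=; rewrite sub0r normrN => /ltW.
have [N2 HN2] := limfun_uniform L0 k0.
pose v := s (maxn N1 N2).
have h1 := HN1 _ (leq_maxl N1 N2); rewrite -/v in h1.
have h2 t := HN2 _ t (leq_maxr N1 N2); rewrite -/v in h2.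
have h3 := He v (HE _).
have [cac cL2 cae cea] := hat_support_arith a0 ac cL ep ec.
have hv : forall t, a <= t -> t <= c + 2 * e -> `|val v t| <= M + 2 * k.
  apply: (bound_extend _ (ltW ac) HM); first by apply: mulr_ge0 => //; exact: ltW.
    by move=> t ta tc; apply: h2; [exact: le_trans ta|exact: le_trans cL].
  move=> x y xy; apply: (test_dist al0 be0 (ltW k0) (HE _)); apply: le_trans ek.
  exact: ler_wpM2r.
pose f t := (l * powR t p - be * t ^+ 2) * (val v t * val phi t).
have fE t : f t = l * (powR t p * (val v t * val phi t)) +
    - 1 * (be * t ^+ 2 * (val v t * val phi t)) by rewrite /f; ring.
have ct : cc (fun t => tder v t * tder phi t) by exact: cc_tder_tder.
have cp : cc (fun t => be * t ^+ 2 * (val v t * val phi t)) by exact: cc_pot.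
have cw : cc (fun t => powR t p * (val v t * val phi t)) by exact: cc_wform.
have ff : f = (fun t => l * (powR t p * (val v t * val phi t))) \+
    (fun t => - 1 * (be * t ^+ 2 * (val v t * val phi t))) by apply/funext => t; rewrite fE.
have cf : cc f by rewrite ff; apply: ccD; exact: ccZ.
have eq1 : al * halfint (fun t => tder v t * tder phi t) =
    (E v phi - l * K v phi) + halfint f.
  rewrite ff halfintD; [|exact: ccZ|exact: ccZ].
  rewrite !halfintZ// /eform halfintD//; last exact: ccZ.
  by rewrite halfintZ// /wform; ring.
(* The factor 8 of the conclusion arises here: the hat is at most [2 * P * (2 * (c - a))], and its
   support has length at most [2 * (c - a)]. *)
have fb : `|halfint f| <= Q * ((M + 2 * k) * (2 * P * (2 * (c - a)))) * (2 * (c - a)).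
  have fz t : t <= a \/ c + 2 * e <= t -> f t = 0.
    case=> h; rewrite /f hz ?mulr0//; last by right.
    by left; apply: (le_trans h); rewrite lerDl ltW.
  have C0 : 0 <= Q * ((M + 2 * k) * (2 * P * (2 * (c - a)))).
    apply: mulr_ge0; first exact: ltW.
    apply: mulr_ge0; first by rewrite addr_ge0// mulr_ge0// ltW.
    by apply: mulr_ge0; apply: mulr_ge0 => //; exact: ltW.
  apply: (@le_trans _ _ (Q * ((M + 2 * k) * (2 * P * (2 * (c - a)))) * (c + 2 * e - a))).
    apply: halfint_bound => // t ta tc; rewrite /f !normrM.
    apply: ler_pM => //.
      by apply: QP; [exact: le_trans ta|exact: le_trans cL2].
    apply: ler_pM => //; first exact: hv.
    apply: (le_trans (hb t ta tc)); apply: ler_wpM2l => //.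
    by apply: mulr_ge0 => //; exact: ltW.
  exact: ler_wpM2l.
have h4 := second_difference_dist p1 p3 (h2 a a0 (le_trans (ltW ac) cL))
  (h2 b (le_trans a0 (ltW ab)) (le_trans (ltW bc) cL)) (h2 c (le_trans a0 (ltW ac)) cL).
rewrite -PE in h4.
set Du := _^-1 * _ - _ in h4 *; set Dv := _^-1 * (val v b - _) - _ in h3 h4.
set I := halfint (fun t => tder v t * tder phi t) in eq1 h3.
have h5 : `|Du| <= 2 * P * k + 2 * P * k + `|I|.
  have -> : Du = (Du - Dv) - (I - Dv) + I by ring.
  apply: (le_trans (ler_normD _ _)); rewrite lerD2r.
  by apply: (le_trans (ler_normB _ _)); apply: lerD.
rewrite -(ler_pM2l al0) mulrDr in h5; apply: (le_trans h5).
have h6 : al * `|I| <= k + Q * ((M + 2 * k) * (2 * P * (2 * (c - a)))) * (2 * (c - a)).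
  rewrite -{1}(gtr0_norm al0) -normrM eq1; apply: (le_trans (ler_normD _ _)).
  exact: lerD.
apply: (le_trans (lerD (lexx _) h6)).
by rewrite le_eqVlt; apply/orP; left; apply/eqP; ring.
Qed.

End LimitFunction.

(** * The spectrum for real test functions *)

Section TestSpectrum.
Variables (R : realType) (al be p : R).
Hypotheses (al0 : 0 < al) (be0 : 0 < be) (p0 : 0 <= p) (p2 : p < 2).
Local Notation E := (eform al be).
Local Notation K := (wform p).
Implicit Types s t : nat -> test_space R.

Let sE := eform_semi_inner al0 be0.
Let sK := wform_semi_inner (R := R) p.

(** The finite-rank estimate once more: the energies stay bounded and the finitely many point values
    tend to 0. *)
Lemma limfun_eq0_wform s : sip_cauchy E s -> (forall x, 0 <= x -> limfun s x = 0) ->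
  (fun k => K (s k) (s k)) @ \oo --> (0 : R).
Proof.
move=> cs s0; apply/cvgrPdist_lt => e e0.
have [M M0 HM] := energy_bound al0 be0 cs.
have M1 : 0 < 2 * (M + 1) by rewrite mulr_gt0// ltr_wpDl.
have [N [h [C [h0 C0 HC]]]] :=
  wform_finite_rank al0 be0 p0 (ltW p2) p2 (divr_gt0 e0 M1).
have L0 : 0 <= N%:R * h by rewrite mulr_ge0// ltW.
have NC : 0 <= N%:R * C by rewrite mulr_ge0.
have D0 : 0 < 2 * (N%:R * C + 1) by rewrite mulr_gt0// ltr_wpDl.
pose k0 := Num.min 1 (e / (2 * (N%:R * C + 1))).
have k00 : 0 < k0 by rewrite lt_min ltr01 divr_gt0.
have k02 : k0 ^+ 2 <= e / (2 * (N%:R * C + 1)).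
  apply: (@le_trans _ _ k0); last by rewrite ge_min lexx orbT.
  by rewrite expr2 ler_piMl ?(ltW k00)// ge_min lexx.
have [N1 HN1] := limfun_uniform al0 be0 cs L0 k00.
exists N1 => // k /= Nk; rewrite sub0r normrN ger0_norm ?(sip_ge0 sK)//.
apply: (le_lt_trans (HC _)).
have h1 : e / (2 * (M + 1)) * E (s k) (s k) < e / 2.
  apply: (@le_lt_trans _ _ (e / (2 * (M + 1)) * M)).
    by rewrite ler_wpM2l ?HM// ltW// divr_gt0.
  by rewrite -mulrA ltr_pM2l// mulrC ltr_pdivrMr//; lra.
have h2 : \sum_(j < N) val (s k) (j%:R * h) ^+ 2 <= N%:R * k0 ^+ 2.
  rewrite mulr_natl -[X in _ <= _ *+ X](card_ord N) -sumr_const.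
  apply: ler_sum => j _.
  have jh : 0 <= j%:R * h by rewrite mulr_ge0// ltW.
  have := HN1 k (j%:R * h) Nk jh _; rewrite s0// subr0.
  have jN : j%:R * h <= N%:R * h by rewrite ler_pM2r// ler_nat ltnW.
  move=> /(_ jN) H; rewrite -(real_normK (num_real (val (s k) (j%:R * h)))).
  by rewrite lerXn2r// nnegrE// ltW.
have h3 : C * \sum_(j < N) val (s k) (j%:R * h) ^+ 2 <= e / 2.
  apply: (@le_trans _ _ (C * (N%:R * k0 ^+ 2))); first by rewrite ler_wpM2l.
  rewrite mulrCA mulrA.
  apply: (@le_trans _ _ ((N%:R * C) * (e / (2 * (N%:R * C + 1))))).
    by rewrite ler_wpM2l.
  move: (N%:R * C) NC D0 => x x0 D0.
  by rewrite mulrA ler_pdivrMr//; nra.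
by move: h1 h3; move: (_ * E _ _) (C * _) => y z; lra.
Qed.

Lemma test_simple s t l : sip_cauchy E s -> sip_cauchy E t ->
  (forall phi, (fun k => E (s k) phi - l * K (s k) phi) @ \oo --> (0 : R)) ->
  (forall phi, (fun k => E (t k) phi - l * K (t k) phi) @ \oo --> (0 : R)) ->
  exists a b, (a != 0) || (b != 0) /\
    (fun k => K (a *: s k + b *: t k) (a *: s k + b *: t k)) @ \oo --> (0 : R).
Proof.
move=> cs ct es et.
have Q0 L := potential_bound_gt0 p l be0 L.
pose T := Num.min 1 (al / (16 * potential_bound be p l 1)).
have T0 : 0 < T by rewrite lt_min ltr01 divr_gt0// mulr_gt0.
have T1 : T <= 1 by rewrite ge_min lexx.
have TQ : 16 * potential_bound be p l 1 * T <= al.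
  by rewrite mulrC -ler_pdivlMr ?mulr_gt0// ge_min lexx orbT.
have [a [b [ab zT]]] : exists a b, (a != 0) || (b != 0) /\
    a * limfun s T + b * limfun t T = 0.
  have [s0|s0] := eqVneq (limfun s T) 0.
    by exists 1, 0; rewrite oner_neq0 s0 mulr0 mul0r addr0.
  exists (limfun t T), (- limfun s T); rewrite oppr_eq0 s0 orbT; split => //.
  by rewrite mulNr mulrC subrr.
exists a, b; split => //.
pose z : nat -> test_space R := fun k => a *: s k + b *: t k.
have c0 : sip_cauchy E (fun=> 0).
  by move=> e e0; exists 0%N => k m _ _; rewrite subrr (sip0l sE).
have cz : sip_cauchy E z.
  have := sip_cauchyP sE a cs (sip_cauchyP sE b ct c0).
  suff -> : a *: s + (b *: t + (fun=> 0)) = z by [].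
  by apply/funext => k; rewrite /z -[RHS]addr0 -addrA.
have ez phi : (fun k => E (z k) phi - l * K (z k) phi) @ \oo --> (0 : R).
  have -> : (fun k => E (z k) phi - l * K (z k) phi) = (fun k =>
      a * (E (s k) phi - l * K (s k) phi) + b * (E (t k) phi - l * K (t k) phi)).
    by apply/funext => k; rewrite /z !(sipDl sE, sipDl sK, sipZl sE, sipZl sK); ring.
  have H : (fun k => a * (E (s k) phi - l * K (s k) phi) +
      b * (E (t k) phi - l * K (t k) phi)) @ \oo --> a * 0 + b * 0.
    by apply: cvgD; apply: cvgMl_tmp; [exact: es|exact: et].
  by move: H; rewrite !mulr0 addr0.
have zT0 : limfun z T = 0.
  rewrite -zT; apply/cvg_lim => //.
  suff H : (fun k => a * val (s k) T + b * val (t k) T) @ \oo -->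
    a * limfun s T + b * limfun t T by exact: H.
  have hs := limfun_cvg al0 be0 cs (ltW T0); have ht := limfun_cvg al0 be0 ct (ltW T0).
  by apply: cvgD; apply: cvgMl_tmp.
have hat := limfun_hat al0 be0 p0 cz ez.
have ini := initial_eq0 al0 (fun L _ => Q0 L) (limfun0 z) (limfun_bound al0 be0 cz) hat
  T0 T1 TQ zT0.
apply: (limfun_eq0_wform cz) => x x0.
(* The extension needs an interval of positive length, also for [x = 0]. *)
have x1 : 0 < x + 1 by rewrite ltr_wpDl.
apply: (extension_eq0 al0 (fun L _ => Q0 L) (limfun_bound al0 be0 cz) hat T0 ini x1 x0).
by rewrite lerDl.
Qed.

Theorem test_spectrum : exists (w : nat -> nat -> test_space R) (lam : nat -> R),
  [/\ forall i, sip_cauchy E (w i),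
      forall i phi, sip_cauchy E phi ->
        lim ((fun k => E (w i k) (phi k)) @ \oo) =
        lam i * lim ((fun k => K (w i k) (phi k)) @ \oo),
      [/\ 0 < lam 0%N, forall i, lam i < lam i.+1 & lam @ \oo --> +oo],
      forall i j, lim ((fun k => K (w i k) (w j k)) @ \oo) = (i == j)%:R &
      forall phi e, sip_cauchy E phi -> 0 < e -> exists N (c : nat -> R),
        lim ((fun k => E (phi k - \sum_(i < N) c i *: w i k)
                         (phi k - \sum_(i < N) c i *: w i k)) @ \oo) < e].
Proof.
have C0 : 0 < 2 / al + 1 / be by rewrite addr_gt0// divr_gt0.
apply: (spectral_completion sE sK C0).
- exact: (wform_le al0 be0 p0 (ltW p2)).
- exact: (eform_compact al0 be0 p0 p2).
- exact: eform_le_wform.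
- exact (@wform_infdim R al be p al0 be0).
- exact: test_simple.
Qed.

End TestSpectrum.

(** * Density of test functions in L2 *)

Section SquareIntegrable.
Variable R : realType.
Notation mu := (@lebesgue_measure R).
Local Notation T := (measurableTypeR R).

(** Square integrability on the whole line: functions on the half-line enter extended by 0, so that
    a single inner product without domain serves throughout. *)
Definition sqint (f : R -> R) : Prop := measurable_fun [set: T] (f : T -> R) /\
  mu.-integrable [set: T] (EFin \o (fun t => f t ^+ 2)).

Lemma sqint_le (f g : R -> R) : measurable_fun [set: T] (f : T -> R) ->
  mu.-integrable [set: T] (EFin \o g) -> (forall t, f t ^+ 2 <= g t) -> sqint f.
Proof.
move=> mf ig fg; split => //; apply: le_integrable ig => //.
  apply/measurable_EFinP; exact: measurable_funX.
move=> t _ /=; rewrite lee_fin ger0_norm ?sqr_ge0//.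
exact: le_trans (fg t) (ler_norm _).
Qed.

Lemma sqint_linear (a : R) (f g : R -> R) : sqint f -> sqint g -> sqint (a *: f + g).
Proof.
move=> [mf jf] [mg jg].
apply: (@sqint_le _ (fun t => 2 * a ^+ 2 * f t ^+ 2 + 2 * g t ^+ 2)).
- apply: measurable_funD => //; apply: measurable_funM => //; exact: measurable_cst.
- have h1 := integrableZl measurableT (2 * a ^+ 2) jf.
  have h2 := integrableZl measurableT 2 jg.
  by have := integrableD measurableT h1 h2.
- move=> t; have -> : (a *: f + g) t = a * f t + g t by [].
  by have := sqr_ge0 (a * f t - g t); nra.
Qed.

Definition sqints : {pred R -> R} := fun f => `[< sqint f >].

Lemma sqints_submod_closed : submod_closed sqints.
Proof.
split; last by move=> a f g /asboolP jf /asboolP jg; apply/asboolP; exact: sqint_linear.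
apply/asboolP; apply: (@sqint_le _ (fun=> 0)); first exact: measurable_cst.
  exact: integrable0.
by move=> t; rewrite expr0n.
Qed.

HB.instance Definition _ := GRing.isSubmodClosed.Build R (R -> R)
  sqints sqints_submod_closed.

Record sqint_space := SqintSpace { sqint_val : R -> R; sqint_valP : sqint_val \in sqints }.

HB.instance Definition _ := [isSub for sqint_val].
HB.instance Definition _ := [Choice of sqint_space by <:].
HB.instance Definition _ := [SubChoice_isSubLmodule of sqint_space by <:].

Lemma sqint_ex (f : R -> R) : sqint f -> exists F : sqint_space, val F = f.
Proof. by move=> /asboolP h; exists (SqintSpace h). Qed.

Lemma sqint_spaceP (F : sqint_space) : sqint (val F).
Proof. exact/asboolP/sqint_valP. Qed.

Definition L2ip (F G : sqint_space) : R := \int[mu]_t (val F t * val G t).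

Lemma integrable_L2ip (F G : sqint_space) :
  mu.-integrable [set: T] (EFin \o (fun t => val F t * val G t)).
Proof.
have [mF jF] := sqint_spaceP F; have [mG jG] := sqint_spaceP G.
have h : mu.-integrable [set: T] (EFin \o (fun t => val F t ^+ 2 + val G t ^+ 2)).
  by have := integrableD measurableT jF jG.
apply: le_integrable h => //.
  apply/measurable_EFinP; exact: measurable_funM.
move=> t _ /=; rewrite lee_fin [leRHS]ger0_norm ?addr_ge0 ?sqr_ge0//.
rewrite ler_norml; have := sqr_ge0 (val F t - val G t); have := sqr_ge0 (val F t + val G t).
by move=> h1 h2; apply/andP; split; nra.
Qed.

Lemma L2ip_semi_inner : semi_inner L2ip.
Proof.
split.
- by move=> F G; apply: eq_Rintegral => t _; rewrite mulrC.
- move=> a F G H; rewrite /L2ip -RintegralZl//; last exact: integrable_L2ip.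
  rewrite -RintegralD//; last exact: integrable_L2ip.
    apply: eq_Rintegral => t _.
    have L (x y z : R) : (a * x + y) * z = a * (x * z) + y * z by rewrite mulrDl mulrA.
    exact: L.
  exact: (integrableZl measurableT a (integrable_L2ip F H)).
- by move=> F; apply: Rintegral_ge0 => t _; rewrite -expr2 sqr_ge0.
Qed.

Lemma dominated_cvg0 (f : nat -> R -> R) (g : R -> R) :
  (forall n, measurable_fun [set: T] (f n : T -> R)) ->
  mu.-integrable [set: T] (EFin \o g) ->
  (forall n t, `|f n t| <= g t) -> (forall t, (fun n => f n t) @ \oo --> (0 : R)) ->
  (fun n => \int[mu]_t f n t) @ \oo --> (0 : R).
Proof.
move=> mf ig fg f0.
have mE n : measurable_fun [set: T] (EFin \o f n : T -> \bar R) by exact/measurable_EFinP.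
have hc : {ae mu, forall t : T, [set: T] t -> (fun n => (EFin \o f n) t) @ \oo --> 0%E}.
  by apply: aeW => t _; apply/fine_cvgP; split; [exact: nearW|exact: f0].
have hd : {ae mu, forall (t : T) n, [set: T] t -> (`|(EFin \o f n) t| <= (EFin \o g) t)%E}.
  by apply: aeW => t n _; rewrite /= lee_fin.
have [_ _ H] := dominated_convergence measurableT mE (measurable_cst 0%E) hc ig hd.
move: H; rewrite integral0 => /fine_cvgP[_].
exact.
Qed.

End SquareIntegrable.

(** * Approximation of indicators by test functions *)

Section TestDensity.
Variable R : realType.
Notation mu := (@lebesgue_measure R).
Local Notation T := (measurableTypeR R).
Implicit Types (F G : sqint_space R) (u v : test_space R).

Lemma sqint_test u : sqint (val u).
Proof.
split.
  apply: continuous_measurable_fun; exact: continuous_test.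
by apply: cc_integrableT; exact: cc_val_val.
Qed.

Definition iota_L2 u : sqint_space R := SqintSpace (asboolT (sqint_test u)).

Lemma iota_L2_linear a u v : iota_L2 (a *: u + v) = a *: iota_L2 u + iota_L2 v.
Proof. exact/val_inj. Qed.

Let sL := L2ip_semi_inner R.

Definition approximable F := forall e : R, 0 < e ->
  exists u, L2ip (F - iota_L2 u) (F - iota_L2 u) < e.

Lemma approximable_test u : approximable (iota_L2 u).
Proof. by move=> e e0; exists u; rewrite subrr (sip0l sL). Qed.

Lemma approximable_linear a F G : approximable F -> approximable G ->
  approximable (a *: F + G).
Proof.
move=> aF aG e e0.
have a1 : 0 < 4 * (a ^+ 2 + 1) by rewrite mulr_gt0// ltr_wpDl ?sqr_ge0.
have [u Hu] := aF _ (divr_gt0 e0 a1).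
have [v Hv] := aG _ (divr_gt0 e0 (ltr0Sn R 3)).
exists (a *: u + v); rewrite iota_L2_linear opprD addrACA -scalerBr.
apply: (le_lt_trans (sip_sqrD_le sL _ _)); rewrite (sip_sqrZ sL).
move: Hu Hv; rewrite !ltr_pdivlMr//.
have := sip_ge0 sL (F - iota_L2 u); set x := L2ip _ _; set y := L2ip _ _ => x0 h1 h2.
by rewrite mulrA; nra.
Qed.

Lemma approximable0 : approximable 0.
Proof.
have -> : 0 = iota_L2 0 by exact/val_inj.
exact: approximable_test.
Qed.

Lemma approximable_sum (H : nat -> sqint_space R) n :
  (forall k, approximable (H k)) -> approximable (\sum_(k < n) H k).
Proof.
move=> aH; elim: n => [|n IH]; first by rewrite big_ord0; exact: approximable0.
rewrite big_ord_recr/=; have := approximable_linear 1 (aH n) IH.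
by rewrite scale1r addrC.
Qed.

(** Dominated convergence of the squared differences. All passages to the limit below, from
    intervals to sets and from sets to functions, go through it. *)
Lemma approximable_limit F (G : nat -> sqint_space R) (h : R -> R) :
  (forall n, approximable (G n)) -> mu.-integrable [set: T] (EFin \o h) ->
  (forall n t, (val F t - val (G n) t) ^+ 2 <= h t) ->
  (forall t, (fun n => val (G n) t) @ \oo --> val F t) -> approximable F.
Proof.
move=> aG ih hh GF e e0; have e4 : 0 < e / 4 by rewrite divr_gt0.
have c : (fun n => \int[mu]_t ((val F t - val (G n) t) ^+ 2)) @ \oo --> (0 : R).
  apply: (@dominated_cvg0 _ _ h) => //.
  - move=> n; apply: measurable_funX; apply: measurable_funB.
      by have [] := sqint_spaceP F.
    by have [] := sqint_spaceP (G n).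
  - by move=> n t; rewrite ger0_norm ?sqr_ge0.
  - move=> t; have -> : (0 : R) = (val F t - val F t) * (val F t - val F t).
      by rewrite subrr mul0r.
    by apply: cvgM; apply: cvgB => //; exact: cvg_cst.
move/cvgrPdist_lt/(_ _ e4) : c => [N _ /(_ N (leqnn N))/=].
rewrite sub0r normrN => h1.
have [u Hu] := aG N _ e4; exists u.
rewrite -(subrK (G N) F) -addrA; apply: (le_lt_trans (sip_sqrD_le sL _ _)).
have : L2ip (F - G N) (F - G N) < e / 4 by apply: le_lt_trans h1; exact: ler_norm.
lra.
Qed.

Lemma integrable_indic_itvT (x y : R) :
  mu.-integrable [set: T] (EFin \o (\1_(`]x, y]%classic) : R -> R)).
Proof. exact: (integrable_indic_itv x y false false). Qed.

Lemma indic_sqr (A : set R) (t : R) : (\1_A t : R) ^+ 2 = \1_A t.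
Proof. by rewrite indicE; case: (_ \in _); rewrite ?expr1n ?expr0n. Qed.

Lemma step_interval (x y : R) : 0 < x -> forall F, val F = \1_(`]x, y]%classic) ->
  approximable F.
Proof.
move=> x0 F FE.
(* A smooth plateau that climbs right after [x] and descends right after [y], each within a length
   [1 / n.+1]. The limit is the indicator of the half-open interval, end values included, and the
   indicator of []x, y + 1]] dominates the squared error. *)
pose f (n : nat) (t : R) := step_fun (n.+1%:R * t + - n.+1%:R * x) *
  step_fun (- n.+1%:R * t + (n.+1%:R * y + 1)).
have sf n : smoothR (f n).
  apply: smooth_exprP.
  apply: (@smooth_mul _ (fun t => step_fun (n.+1%:R * t + - n.+1%:R * x))
     (fun t => step_fun (- n.+1%:R * t + (n.+1%:R * y + 1)))).
    apply: (@smooth_comp _ (@step_fun R) (fun t => n.+1%:R * t + - n.+1%:R * x)).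
      exact: smooth_step.
    exact: smooth_affine.
  apply: (@smooth_comp _ (@step_fun R) (fun t => - n.+1%:R * t + (n.+1%:R * y + 1))).
    exact: smooth_step.
  exact: smooth_affine.
have n1 n : 1 <= n.+1%:R :> R by rewrite ler1n.
have fl n t : t <= x -> f n t = 0.
  move=> tx; rewrite /f step_le0 ?mul0r// mulNr -mulrBr.
  by apply: mulr_ge0_le0 => //; rewrite subr_le0.
have fr n t : y + 1 <= t -> f n t = 0.
  move=> ty; rewrite /f [X in _ * X]step_le0 ?mulr0//.
  by have := n1 n; nra.
have tf n : rtest (f n).
  split; first exact: sf.
  exists x, (Num.max x (y + 1)); split => //; first by rewrite le_max lexx.
  move=> t [/ltW|]; first exact: fl.
  by rewrite gt_max => /andP[_ /ltW]; exact: fr.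
have [u Hu] : exists u : nat -> test_space R, forall n, val (u n) = f n.
  by have [u Hu] := choice (fun n => test_ex (tf n)); exists u.
have f01 n t : 0 <= f n t <= 1.
  by rewrite mulr_ge0 ?step_ge0//= mulr_ile1 ?step_ge0 ?step_le1.
apply: (@approximable_limit F (fun n => iota_L2 (u n)) \1_(`]x, y + 1]%classic)).
- by move=> n; exact: approximable_test.
- exact: integrable_indic_itvT.
- move=> n t; rewrite FE [val (iota_L2 _)]Hu !indicE !mem_setE !in_itv/=.
  have /andP[g0 g1] := f01 n t.
  have [xt|tx] := ltP x t; last by rewrite fl//= subrr expr0n.
  have [ty|yt] := leP t y; have [ty1|yt1] := leP t (y + 1) => /=.
  + by nra.
  + have : y + 1 < y + 1 by lra.
    by rewrite ltxx.
  + by nra.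
  + by rewrite fr ?subrr ?expr0n// ltW.
- move=> t; rewrite FE indicE mem_setE in_itv/=.
  have -> : (fun n => val (iota_L2 (u n)) t) = (fun n => f n t).
    by apply/funext => n; rewrite [val (iota_L2 _)]Hu.
  have [xt|tx] := ltP x t; last first.
    by under eq_fun do rewrite fl//; exact: cvg_cst.
  have [ty|yt] := leP t y.
    have tx0 : 0 < t - x by rewrite subr_gt0.
    have [N HN] := invS_lt tx0.
    apply: cvg_near_cst; exists N => // n /= Nn.
    rewrite /f !step_ge1 ?mulr1//; first by have := n1 n; nra.
    rewrite mulNr -mulrBr -ler_pdivrMl ?ltr0n// mulr1.
    exact/ltW/HN.
  have ty0 : 0 < t - y by rewrite subr_gt0.
  have [N HN] := invS_lt ty0.
  apply: cvg_near_cst; exists N => // n /= Nn.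
  rewrite /f [X in _ * X]step_le0 ?mulr0//.
  have := HN n Nn; rewrite -[X in X < _]mulr1 -ltr_pdivlMl ?invr_gt0 ?ltr0n// invrK => h.
  by rewrite mulrBr in h; lra.
Qed.

Section Window.
Variables (a b : R) (a0 : 0 < a).
Local Notation I := (`]a, b]%classic : set R).

Lemma window_sqint (S : set T) : measurable S -> sqint (\1_(S `&` I) : R -> R).
Proof.
move=> mS; apply: (@sqint_le _ _ (\1_I)).
- by apply: measurable_indic; apply: measurableI.
- exact: integrable_indic_itvT.
- move=> t; rewrite indic_sqr !indicE ler_nat in_setI.
  by case: (t \in S); case: (t \in I).
Qed.

(** Dynkin's argument: half-open intervals generate the Borel sets and are stable under
    intersection, and the property passes to complements and countable disjoint unions. The window
    keeps the indicators square integrable and provides the function from which complements are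
    taken. *)
Lemma window_approximable (S : set T) : measurable S ->
  forall F, val F = \1_(S `&` I) -> approximable F.
Proof.
move=> mS; pose P (S : set T) := forall F, val F = \1_(S `&` I) -> approximable F.
rewrite -/(P S).
apply: (@dynkin_induction _ T (R.-ocitv.-measurable) P erefl) => //.
- by move=> A B mA mB; exact: ocitvI.
- move=> F; rewrite setTI => FE; exact: (step_interval a0 FE).
- move=> _ [[x y] _ <-] F /= FE.
  have E : `]x, y]%classic `&` I = `]Num.max x a, Num.min y b]%classic.
    apply/seteqP; split => t /=; rewrite !in_itv/= gt_max le_min.
      by move=> [/andP[-> ->] /andP[-> ->]].
    by move=> /andP[/andP[-> ->] /andP[-> ->]].
  apply: (@step_interval (Num.max x a) (Num.min y b)); last by rewrite -E; exact: FE.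
  by rewrite lt_max a0 orbT.
- move=> A mA PA F FE.
  have [FI FIE] := sqint_ex (window_sqint measurableT).
  have [FA FAE] := sqint_ex (window_sqint mA).
  have -> : F = -1 *: FA + FI.
    apply/val_inj; have -> : val (-1 *: FA + FI) = -1 *: val FA + val FI by [].
    rewrite FE FAE FIE; apply/funext => t.
    have -> : (-1 *: (\1_(A `&` I) : R -> R) + \1_([set: T] `&` I)) t =
      -1 * \1_(A `&` I) t + \1_([set: T] `&` I) t by [].
    rewrite !indicE !in_setI in_setT in_setC.
    by case: (t \in A); case: (t \in I) => /=; lra.
  apply: approximable_linear; first exact: PA.
  by apply: (step_interval a0); rewrite FIE setTI.
- move=> A mA tA PA F FE.
  have [H HE] : exists H : nat -> sqint_space R, forall k, val (H k) = \1_(A k `&` I).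
    by have [H HE] := choice (fun k => sqint_ex (window_sqint (mA k))); exists H.
  have valS n t : val (\sum_(k < n) H k) t = \sum_(k < n) \1_(A k `&` I) t.
    elim: n => [|n IH]; first by rewrite !big_ord0.
    by rewrite !big_ord_recr/= -IH -(HE n).
  have sum0 n t : (forall k, (k < n)%N -> ~ (A k `&` I) t) ->
      \sum_(k < n) \1_(A k `&` I) t = 0 :> R.
    move=> h; apply: big1 => k _; rewrite indicE memNset//.
    by move=> Akt; exact: (h k (ltn_ord k)).
  have sum1 n t k : (k < n)%N -> (A k `&` I) t ->
      \sum_(k < n) \1_(A k `&` I) t = 1 :> R.
    move=> kn Akt; rewrite (bigD1 (Ordinal kn))//= big1 ?addr0.
      by rewrite indicE mem_set.
    move=> j jk; rewrite indicE memNset// => -[Ajt _].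
    move/eqP: jk; apply; apply/val_inj; apply: (tA j k) => //.
    by case: Akt => Akt _; exists t.
  apply: (@approximable_limit F (fun n => \sum_(k < n) H k) \1_I).
  - move=> n; apply: approximable_sum => k; exact: PA.
  - exact: integrable_indic_itvT.
  - move=> n t; rewrite FE valS.
    have [[_ It]|nIt] := pselect ((\bigcup_k A k `&` I) t).
      have S01 : \sum_(k < n) \1_(A k `&` I) t = 0 :> R \/
          \sum_(k < n) \1_(A k `&` I) t = 1 :> R.
        have [[k [kn Akt]]|h] := pselect (exists k, (k < n)%N /\ (A k `&` I) t).
          by right; exact: (sum1 _ _ k).
        by left; apply: sum0 => k kn Akt; apply: h; exists k.
      have -> : \1_I t = 1 :> R by rewrite indicE mem_set.
      rewrite indicE.
      by case: S01 => ->; case: (_ \in _) => /=; nra.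
    rewrite sum0 => [|k _ [Ak It]]; last by apply: nIt; split => //; exists k.
    by rewrite indicE memNset// subrr expr0n indicE.
  - move=> t; rewrite FE; under eq_fun do rewrite valS.
    have [[[k _ Akt] It]|nIt] := pselect ((\bigcup_k A k `&` I) t).
      apply: cvg_near_cst; exists k.+1 => // n /= kn.
      rewrite (sum1 n t k)// indicE mem_set//; split => //; by exists k.
    have -> : (fun n => \sum_(k < n) \1_(A k `&` I) t : R) = (fun=> 0).
      apply/funext => n; apply: sum0 => k _ [Ak It].
      by apply: nIt; split => //; exists k.
    by rewrite indicE memNset//; exact: cvg_cst.
Qed.

End Window.

End TestDensity.

Lemma clamp_norm_le (R : realDomainType) (m x : R) : 0 <= m ->
  `|Num.max (- m) (Num.min m x)| <= `|x|.
Proof.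
move=> m0; have x0 := normr_ge0 x; have := ler_norm x; have := ler_norm (- x).
rewrite normrN => h1 h2; rewrite ler_norml; apply/andP; split.
  by rewrite le_max le_min; apply/orP; right; apply/andP; split; lra.
by rewrite ge_max ge_min; apply/andP; split; [lra|apply/orP; right].
Qed.

(** * From indicators to all square-integrable functions on the half-line *)

Section Truncation.
Variable R : realType.
Notation mu := (@lebesgue_measure R).
Local Notation T := (measurableTypeR R).
Implicit Types (F G : sqint_space R).

(* Bisecting the range: subtracting [M / 2] where [F >= M / 2] halves the
   bound on what remains. *)
Lemma bounded_bisection (a b : R) (a0 : 0 < a) n : forall M F,
  (forall t, 0 <= val F t <= M * \1_(`]a, b]%classic) t) ->
  exists2 G, approximable G &
    forall t, 0 <= val F t - val G t <= M / 2 ^+ n * \1_(`]a, b]%classic) t.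
Proof.
elim: n => [|n IH] M F HF.
  exists 0; first exact: approximable0.
  by move=> t; rewrite subr0 expr0 divr1.
pose A := [set t : T | M / 2 <= val F t].
have mA : measurable A.
  have [mF _] := sqint_spaceP F.
  have -> : A = [set: T] `&` (val F : T -> R) @^-1` `[M / 2, +oo[%classic.
    by rewrite setTI; apply/seteqP; split => t /=; rewrite in_itv/= andbT.
  exact: mF.
have [H HE] := sqint_ex (window_sqint a b mA).
have aH : approximable H := window_approximable a0 mA HE.
have valF' t : val (- (M / 2) *: H + F) t = - (M / 2) * \1_(A `&` `]a, b]%classic) t + val F t.
  by rewrite -HE.
have HF' t : 0 <= val (- (M / 2) *: H + F) t <= M / 2 * \1_(`]a, b]%classic) t.
  rewrite valF'; have := HF t; rewrite !indicE in_setI.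
  have hA : (t \in A) = (M / 2 <= val F t).
    by apply/idP/idP => [/set_mem//|h]; rewrite mem_set.
  rewrite hA; move: (val F t) => x; case: (leP (M / 2) x) => h; case: (t \in _);
    rewrite /= ?mulr1 ?mulr0 ?add0r => /andP[h1 h2]; apply/andP; split; lra.
have [G aG HG] := IH _ _ HF'.
exists ((M / 2) *: H + G); first exact: approximable_linear.
move=> t; have -> : val F t - val ((M / 2) *: H + G) t =
    val (- (M / 2) *: H + F) t - val G t.
  rewrite valF' -HE.
  have -> : val ((M / 2) *: H + G) t = M / 2 * val H t + val G t by [].
  ring.
have := HG t; rewrite exprS invfM mulrA.
by [].
Qed.

Lemma bounded_approximable (a b M : R) F : 0 < a -> 0 <= M ->
  (forall t, 0 <= val F t <= M * \1_(`]a, b]%classic) t) -> approximable F.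
Proof.
move=> a0 M0 HF.
have [G HG] : exists G : nat -> sqint_space R, forall n, approximable (G n) /\
    forall t, 0 <= val F t - val (G n) t <= M / 2 ^+ n * \1_(`]a, b]%classic) t.
  have ex (n : nat) : exists G, approximable G /\
      forall t, 0 <= val F t - val G t <= M / 2 ^+ n * \1_(`]a, b]%classic) t.
    by have [G aG h] := bounded_bisection a0 n HF; exists G.
  by have [G HG] := choice ex; exists G.
have p2 n : M / 2 ^+ n <= M.
  rewrite ler_pdivrMr ?exprn_gt0//; apply: ler_peMr => //.
  by apply: exprn_ege1; rewrite ler1n.
apply: (@approximable_limit _ F G (fun t => M ^+ 2 * \1_(`]a, b]%classic) t)).
- by move=> n; case: (HG n).
- exact: (integrableZl measurableT (M ^+ 2) (integrable_indic_itvT a b)).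
- move=> n t; have [_ /(_ t)] := HG n; rewrite indicE.
  case: (_ \in _); rewrite ?mulr0 ?mulr1 => /andP[h1 h2].
    by apply: lerXn2r; rewrite ?nnegrE//; exact: le_trans h2 (p2 n).
  have -> : val F t - val (G n) t = 0 by apply/eqP; rewrite eq_le h1 h2.
  by rewrite expr0n.
- move=> t; apply/cvgrPdist_lt => e e0.
  have [N _ HN] : \forall n \near \oo, `|(0 : R) - (2^-1) ^+ n| < e / (M + 1).
    have : (fun n => (2^-1 : R) ^+ n) @ \oo --> (0 : R).
      by apply: cvg_expr; rewrite ger0_norm ?invr_ge0// invf_lt1// ltr1n.
    by move/cvgrPdist_lt; apply; rewrite divr_gt0// ltr_wpDl.
  exists N => // n /= Nn; have := HN n Nn.
  rewrite sub0r normrN ger0_norm ?exprn_ge0 ?invr_ge0// ltr_pdivlMr ?ltr_wpDl// => h.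
  have [_ /(_ t)/andP[h1 h2]] := HG n; rewrite ger0_norm//.
  apply: (le_lt_trans h2); apply: le_lt_trans h; rewrite -exprVn.
  have q0 : 0 <= (2^-1 : R) ^+ n by rewrite exprn_ge0 ?invr_ge0.
  rewrite indicE; case: (_ \in _); rewrite ?mulr1 ?mulr0; nra.
Qed.

(** Values are clamped to [[-m, m]] and the domain is cut to []1 / m.+1, m.+1]]. At each positive
    point this eventually changes nothing, and the squared error is at most four times the square of
    [F]. *)
Lemma halfline_approximable F : (forall t, t <= 0 -> val F t = 0) -> approximable F.
Proof.
move=> F0; have [mF jF] := sqint_spaceP F.
pose I (m : nat) : set R := `]m.+1%:R^-1, m.+1%:R]%classic.
pose g (m : nat) (t : R) : R :=
  Num.max (- m%:R) (Num.min m%:R (val F t)) * \1_(I m) t.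
have g_le m t : `|g m t| <= `|val F t|.
  rewrite /g normrM indicE; case: (_ \in _); rewrite ?normr1 ?normr0 ?mulr1 ?mulr0//.
  exact: clamp_norm_le.
have mg m : measurable_fun [set: T] (g m : T -> R).
  apply: measurable_funM; last by apply: measurable_indic; exact: measurable_itv.
  by apply: measurable_maxr => //; apply: measurable_minr.
have sg m : sqint (g m).
  apply: (sqint_le (mg m) jF) => t.
  rewrite -(real_normK (num_real (g m t))) -(real_normK (num_real (val F t))).
  by rewrite lerXn2r// nnegrE.
have [G GE] : exists G : nat -> sqint_space R, forall m, val (G m) = g m.
  by have [G GE] := choice (fun m => sqint_ex (sg m)); exists G.
have aG m : approximable (G m).
  have m0 : 0 <= m%:R :> R by [].
  have i0 : 0 < m.+1%:R^-1 :> R by rewrite invr_gt0.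
  have [J JE] := sqint_ex (window_sqint m.+1%:R^-1 m.+1%:R (@measurableT _ T)).
  rewrite setTI -/(I m) in JE.
  have aJ : approximable J by exact: (step_interval i0 JE).
  (* Adding [m] times the indicator of the window moves the values into [[0, 2 m]], since the
     bisection treats nonnegative functions. *)
  have -> : G m = - m%:R *: J + (m%:R *: J + G m) by rewrite addrA -scalerDl addNr scale0r add0r.
  apply: (approximable_linear (- m%:R) aJ).
  apply: (@bounded_approximable m.+1%:R^-1 m.+1%:R (2 * m%:R) _ i0 (mulr_ge0 (ler0n R 2) m0)).
  move=> t; have -> : val (m%:R *: J + G m) t = m%:R * \1_(I m) t + g m t.
    by rewrite -JE -GE.
  rewrite -/(I m) /g !indicE; case: (t \in I m) => /=; rewrite ?mulr1 ?mulr0 ?addr0 ?lexx//.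
  set x := val F t; have : - m%:R <= Num.max (- m%:R) (Num.min m%:R x) by rewrite le_max lexx.
  have : Num.max (- m%:R) (Num.min m%:R x) <= m%:R.
    by rewrite ge_max ge_min lexx andbT; apply: le_trans m0; rewrite oppr_le0.
  by move=> h1 h2; apply/andP; split; lra.
apply: (@approximable_limit _ F G (fun t => 4 * val F t ^+ 2)) => //.
- exact: (integrableZl measurableT 4 jF).
- move=> n t; rewrite GE.
  have h : `|val F t - g n t| <= 2 * `|val F t|.
    by apply: (le_trans (ler_normB _ _)); have := g_le n t; lra.
  have -> : 4 * val F t ^+ 2 = (2 * `|val F t|) ^+ 2.
    by rewrite exprMn real_normK ?num_real//; ring.
  rewrite -(real_normK (num_real (val F t - g n t))).
  by rewrite lerXn2r// nnegrE// mulr_ge0.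
- move=> t; under eq_fun do rewrite GE.
  have [t0|t0] := leP t 0.
    have -> : (fun n => g n t) = (fun=> val F t).
      apply/funext => n; rewrite F0//; apply/eqP; rewrite -normr_eq0 eq_le normr_ge0 andbT.
      by apply: (le_trans (g_le n t)); rewrite F0// normr0.
    exact: cvg_cst.
  have [N1 HN1] := invS_lt t0.
  pose N2 := Num.bound t; pose N3 := Num.bound (`|val F t|).
  apply: cvg_near_cst; exists (maxn N1 (maxn N2 N3)) => // n /=.
  rewrite !geq_max => /and3P[n1 n2 n3].
  have h2 : t <= n.+1%:R.
    have : t < N2%:R by apply: archi_boundP; exact: ltW.
    have : N2%:R <= n.+1%:R :> R by rewrite ler_nat ltnW.
    lra.
  have h3 : `|val F t| <= n%:R.
    have : `|val F t| < N3%:R by exact: archi_boundP.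
    have : N3%:R <= n%:R :> R by rewrite ler_nat.
    lra.
  have tI : t \in I n by rewrite /I mem_setE in_itv/= h2 andbT; exact: HN1.
  rewrite /g indicE tI mulr1; move: h3; rewrite ler_norml => /andP[h3 h4].
  by rewrite (min_idPr h4); apply/max_idPr.
Qed.

End Truncation.

(** * Complex-valued functions *)

Section ComplexForms.
Variable R : realType.
Local Notation C := (R[i]).
Implicit Types (f g : R -> C) (u v : test_space R).

Definition cparts f u v := forall t, f t = Complex (val u t) (val v t).

Lemma test_fun_parts f : test_fun f -> exists u v, cparts f u v.
Proof.
move=> [sr si [a [b [a0 [ab fz]]]]].
have [u uE] : exists u : test_space R, val u = (fun t => complex.Re (f t)).
  by apply: test_ex; split => //; exists a, b; split => // t /fz ->.
have [v vE] : exists v : test_space R, val v = (fun t => complex.Im (f t)).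
  by apply: test_ex; split => //; exists a, b; split => // t /fz ->.
by exists u, v => t; rewrite uE vE; case: (f t).
Qed.

Lemma cparts_test_fun f u v : cparts f u v -> test_fun f.
Proof.
move=> fE; have Re : (fun t => complex.Re (f t)) = val u by apply/funext => t; rewrite fE.
have Im : (fun t => complex.Im (f t)) = val v by apply/funext => t; rewrite fE.
split; [rewrite Re; exact: test_smooth|rewrite Im; exact: test_smooth|].
have [a [b [a0 ab uz]]] := test_supp u; have [a' [b' [a'0 ab' vz]]] := test_supp v.
exists (Num.min a a'), (Num.max b b'); split; first by rewrite lt_min a0.
split; first by rewrite le_max ge_min (ltW ab).
move=> t H; have [h1 h2] : (t <= a \/ b <= t) /\ (t <= a' \/ b' <= t).
  by case: H; rewrite ?lt_min ?gt_max => /andP[/ltW ? /ltW ?]; split; by [left|right].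
by rewrite fE (proj1 (uz t h1)) (proj1 (vz t h2)).
Qed.

Lemma cpartsB f u v f' u' v' : cparts f u v -> cparts f' u' v' ->
  cparts (fun t => f t - f' t) (u - u') (v - v').
Proof. by move=> fE fE' t; rewrite fE fE'. Qed.

Lemma cder_parts f u v t : cparts f u v -> cder f t = Complex (tder u t) (tder v t).
Proof.
move=> fE; rewrite /cder /tder; congr Complex; congr (derive1 _ t).
  by apply/funext => s; rewrite fE.
by apply/funext => s; rewrite fE.
Qed.

Variables (n : nat) (Lam : R).
Hypotheses (hn : (3 <= n)%N) (hLam : Lam < 0).

Definition kin_coef : R := 1 / 32 * (n%:R ^+ 2 / (n%:R - 1)).
Definition pot_coef : R := n%:R * `|Lam|.
Definition wexp : R := 2 - 4 / n%:R.

Let n0 : 0 < n%:R :> R. Proof. by rewrite ltr0n; apply: leq_trans hn. Qed.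
Let n3 : 3 <= n%:R :> R. Proof. by rewrite (ler_nat R 3 n). Qed.

Lemma kin_coef_gt0 : 0 < kin_coef.
Proof.
apply: mulr_gt0; first by rewrite divr_gt0.
apply: divr_gt0; first by rewrite exprn_gt0.
by rewrite subr_gt0; apply: lt_le_trans n3; rewrite ltr1n.
Qed.

Lemma pot_coef_gt0 : 0 < pot_coef.
Proof. by rewrite mulr_gt0// normr_gt0 lt_eqF. Qed.

Lemma wexp_ge0 : 0 <= wexp.
Proof. by rewrite subr_ge0 ler_pdivrMr//; move: (n%:R) n3 => x x3; lra. Qed.

Lemma wexp_lt2 : wexp < 2.
Proof. by rewrite gtrBl divr_gt0. Qed.

Local Notation E := (eform kin_coef pot_coef).
Local Notation K := (wform wexp).

Lemma Bform_parts f u v f' u' v' : cparts f u v -> cparts f' u' v' ->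
  Bform n Lam f f' = Complex (E u u' + E v v') (E u v' - E v u').
Proof.
move=> fE fE'; rewrite /Bform /cint -/kin_coef -/pot_coef; congr Complex.
  rewrite /eform -halfintD; [|exact: cc_eform|exact: cc_eform].
  apply: eq_halfint => t _; rewrite (cder_parts t fE) (cder_parts t fE') fE fE' /=.
  ring.
have -> : E u v' - E v u' = E u v' + - 1 * E v u' by rewrite mulN1r.
rewrite /eform -[- 1 * _]halfintZ; last exact: cc_eform.
rewrite -halfintD; [|exact: cc_eform|exact/ccZ/cc_eform].
apply: eq_halfint => t _; rewrite (cder_parts t fE) (cder_parts t fE') fE fE' /=.
ring.
Qed.

Lemma Kform_parts f u v f' u' v' : cparts f u v -> cparts f' u' v' ->
  Kform n f f' = Complex (K u u' + K v v') (K u v' - K v u').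
Proof.
move=> fE fE'; rewrite /Kform /cint -/wexp; congr Complex.
  rewrite /wform -halfintD; [|exact: cc_wform|exact: cc_wform].
  by apply: eq_halfint => t _; rewrite fE fE' /=; ring.
have -> : K u v' - K v u' = K u v' + - 1 * K v u' by rewrite mulN1r.
rewrite /wform -[- 1 * _]halfintZ; last exact: cc_wform.
rewrite -halfintD; [|exact: cc_wform|exact/ccZ/cc_wform].
by apply: eq_halfint => t _; rewrite fE fE' /=; ring.
Qed.

Let sE := eform_semi_inner kin_coef_gt0 pot_coef_gt0.
Let sK := wform_semi_inner (R := R) wexp.

Lemma Bnorm_parts f u v : cparts f u v -> Bnorm n Lam f = Num.sqrt (E u u + E v v).
Proof. by move=> fE; rewrite /Bnorm (Bform_parts fE fE). Qed.

Lemma inH_parts s : inH n Lam s -> exists u v : nat -> test_space R,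
  [/\ forall k, cparts (s k) (u k) (v k), sip_cauchy E u & sip_cauchy E v].
Proof.
move=> [ts cs].
have [u Hu] := choice (fun k => test_fun_parts (ts k)).
have [v Hv] := choice Hu; exists u, v; split => // e e0.
- have se : 0 < Num.sqrt e by rewrite sqrtr_gt0.
  have [N HN] := cs _ se; exists N => k l Nk Nl; have := HN k l Nk Nl.
  rewrite (Bnorm_parts (cpartsB (Hv k) (Hv l))) ltr_sqrt//; apply: le_lt_trans.
  by rewrite lerDl (sip_ge0 sE).
- have se : 0 < Num.sqrt e by rewrite sqrtr_gt0.
  have [N HN] := cs _ se; exists N => k l Nk Nl; have := HN k l Nk Nl.
  rewrite (Bnorm_parts (cpartsB (Hv k) (Hv l))) ltr_sqrt//; apply: le_lt_trans.
  by rewrite lerDr (sip_ge0 sE).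
Qed.

(** Real eigenvectors suffice over the complex numbers: the real and imaginary parts of the
    coefficients expand the two parts of a function separately. *)
Definition embed (s : nat -> test_space R) (k : nat) (t : R) : C := Complex (val (s k) t) 0.

Lemma embed_parts s k : cparts (embed s k) (s k) 0.
Proof. by []. Qed.

Lemma embed_inH s : sip_cauchy E s -> inH n Lam (embed s).
Proof.
move=> cs; split => [k|e e0]; first exact: (cparts_test_fun (embed_parts s k)).
have [N HN] := cs _ (exprn_gt0 2 e0); exists N => k l Nk Nl.
rewrite (Bnorm_parts (cpartsB (embed_parts s k) (embed_parts s l))).
rewrite subrr (sip0l sE) addr0.
rewrite -[ltRHS](gtr0_norm e0) -sqrtr_sqr ltr_sqrt ?exprn_gt0//.
exact: HN.
Qed.

Lemma limC_Complex (a b : nat -> R) :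
  limC (fun k => Complex (a k) (b k)) = Complex (lim (a @ \oo)) (lim (b @ \oo)).
Proof. by []. Qed.

Lemma BH_embed w phi (u v : nat -> test_space R) : (forall k, cparts (phi k) (u k) (v k)) ->
  BH n Lam (embed w) phi =
  Complex (lim ((fun k => E (w k) (u k)) @ \oo)) (lim ((fun k => E (w k) (v k)) @ \oo)).
Proof.
move=> H; rewrite /BH -limC_Complex; congr limC; apply/funext => k.
by rewrite (Bform_parts (embed_parts w k) (H k)) !(sip0l sE) addr0 subr0.
Qed.

Lemma KH_embed w phi (u v : nat -> test_space R) : (forall k, cparts (phi k) (u k) (v k)) ->
  KH n (embed w) phi =
  Complex (lim ((fun k => K (w k) (u k)) @ \oo)) (lim ((fun k => K (w k) (v k)) @ \oo)).
Proof.
move=> H; rewrite /KH -limC_Complex; congr limC; apply/funext => k.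
by rewrite (Kform_parts (embed_parts w k) (H k)) !(sip0l sK) addr0 subr0.
Qed.

Definition rsum N (c : nat -> R) (w : nat -> nat -> test_space R) k : test_space R :=
  \sum_(i < N) c i *: w i k.

Lemma lincomb_parts N (c : nat -> C) w k :
  cparts (lincomb N c (fun i => embed (w i)) k)
    (rsum N (fun i => complex.Re (c i)) w k) (rsum N (fun i => complex.Im (c i)) w k).
Proof.
move=> t; rewrite /lincomb /rsum; elim: N => [|N IH]; first by rewrite !big_ord0.
have vD (p q : test_space R) z : val (p + z *: q) t = val p t + z * val q t by [].
have L : \sum_(i < N.+1) c i * embed (w i) k t =
    \sum_(i < N) c i * embed (w i) k t + c N * embed (w N) k t by rewrite big_ord_recr.
have S (d : nat -> R) : \sum_(i < N.+1) d i *: w i k =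
    \sum_(i < N) d i *: w i k + d N *: w N k by rewrite big_ord_recr.
rewrite L IH (S (fun i => complex.Re (c i))) (S (fun i => complex.Im (c i))) !vD /embed.
case: (c N) => x y /=.
apply/eqP; rewrite eq_complex /=; apply/andP; split; apply/eqP; ring.
Qed.

Lemma rsum_cauchy N c w : (forall i, sip_cauchy E (w i)) -> sip_cauchy E (rsum N c w).
Proof.
move=> cw; elim: N => [|N IH].
  move=> e e0; exists 0%N => k l _ _; rewrite /rsum !big_ord0 subrr (sip0l sE) //.
have := sip_cauchyP sE (c N) (cw N) IH.
suff -> : c N *: w N + rsum N c w = rsum N.+1 c w by [].
by apply/funext => k; rewrite /rsum big_ord_recr/= addrC.
Qed.

Lemma rsum_pad N N' (c : nat -> R) w k : (N <= N')%N ->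
  rsum N' (fun i => if (i < N)%N then c i else 0) w k = rsum N c w k.
Proof.
move=> NN'; rewrite /rsum (big_ord_widen _ (fun i => c i *: w i k) NN') [RHS]big_mkcond /=.
by apply: eq_bigr => i _; case: ifP => // _; rewrite scale0r.
Qed.

End ComplexForms.

(** * Completeness in the energy space and in L2 *)

Section Completeness.
Variables (R : realType) (n : nat) (Lam : R) (hn : (3 <= n)%N) (hLam : Lam < 0).
Notation mu := (@lebesgue_measure R).
Local Notation T := (measurableTypeR R).
Local Notation D := (`](0:R), +oo[)%classic.
Local Notation E := (eform (kin_coef R n) (pot_coef n Lam)).
Local Notation K := (wform (wexp R n)).

Let al0 := @kin_coef_gt0 R n hn.
Let be0 := @pot_coef_gt0 R n Lam hn hLam.
Let sE := eform_semi_inner al0 be0.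
Let sL := L2ip_semi_inner R.

Variable w : nat -> nat -> test_space R.
Hypothesis cw : forall i, sip_cauchy E (w i).
Hypothesis complete_w : forall phi e, sip_cauchy E phi -> 0 < e ->
  exists N (c : nat -> R), lim ((fun k => E (phi k - rsum N c w k)
    (phi k - rsum N c w k)) @ \oo) < e.

(** The two parts of a complex function are approximated by sums of different lengths; padding with
    zeros merges them into one complex combination. *)
Lemma combine_coefs N1 (c1 : nat -> R) N2 (c2 : nat -> R) :
  exists N (c : nat -> R[i]),
    (forall k, rsum N (fun i => complex.Re (c i)) w k = rsum N1 c1 w k) /\
    (forall k, rsum N (fun i => complex.Im (c i)) w k = rsum N2 c2 w k).
Proof.
exists (maxn N1 N2), (fun i => Complex (if (i < N1)%N then c1 i else 0)
  (if (i < N2)%N then c2 i else 0)); split => k /=.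
  by rewrite rsum_pad// leq_maxl.
by rewrite rsum_pad// leq_maxr.
Qed.

Lemma rsum_sub_cauchy phi N c : sip_cauchy E phi ->
  sip_cauchy E (fun k => phi k - rsum N c w k).
Proof.
move=> cphi; have := sip_cauchyP sE (-1) (rsum_cauchy hn hLam N c cw) cphi.
suff -> : -1 *: rsum N c w + phi = (fun k => phi k - rsum N c w k) by [].
apply/funext => k.
have -> : (-1 *: rsum N c w + phi) k = -1 *: rsum N c w k + phi k by [].
by rewrite scaleN1r addrC.
Qed.

Lemma complete_in_H phi : inH n Lam phi -> forall e : R, 0 < e ->
  exists (N : nat) (c : nat -> R[i]),
    BHnorm n Lam (fun k t => phi k t - lincomb N c (fun i => embed (w i)) k t) < e.
Proof.
move=> /(inH_parts hn hLam)[u [v [phiE cu cv]]] e e0.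
have e2 : 0 < e ^+ 2 / 2 by rewrite divr_gt0// exprn_gt0.
have [N1 [c1 h1]] := complete_w cu e2; have [N2 [c2 h2]] := complete_w cv e2.
have [N [c [cE1 cE2]]] := combine_coefs N1 c1 N2 c2.
exists N, c; rewrite /BHnorm -(gtr0_norm e0) -sqrtr_sqr ltr_sqrt ?exprn_gt0//.
pose U k := u k - rsum N1 c1 w k; pose V k := v k - rsum N2 c2 w k.
have P k : cparts (fun t => phi k t - lincomb N c (fun i => embed (w i)) k t) (U k) (V k).
  by rewrite /U /V -cE1 -cE2; apply: cpartsB => //; exact: lincomb_parts.
(* [lim] returns a default value on divergent sequences, so both parts must be known to converge
   before the limit of the sum is split. *)
have cU : cvg ((fun k => E (U k) (U k)) @ \oo).
  by apply: (sip_cauchy_cvg sE); exact: rsum_sub_cauchy.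
have cV : cvg ((fun k => E (V k) (V k)) @ \oo).
  by apply: (sip_cauchy_cvg sE); exact: rsum_sub_cauchy.
have -> : complex.Re (BH n Lam
    (fun k t => phi k t - lincomb N c (fun i => embed (w i)) k t)
    (fun k t => phi k t - lincomb N c (fun i => embed (w i)) k t)) =
    lim ((fun k => E (U k) (U k) + E (V k) (V k)) @ \oo).
  rewrite [LHS]/complex.Re [LHS]/limR; congr (lim (_ @ \oo)); apply/funext => k.
  by rewrite (Bform_parts n Lam (P k) (P k)).
have /cvg_lim -> // : (fun k => E (U k) (U k) + E (V k) (V k)) @ \oo -->
    lim ((fun k => E (U k) (U k)) @ \oo) + lim ((fun k => E (V k) (V k)) @ \oo).
  exact: (cvgD cU cV).
by apply: lt_le_trans (ltrD h1 h2) _; rewrite -splitr.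
Qed.

Lemma sqint_restrict (f : R -> R) (g : R -> R) : measurable_fun D f ->
  mu.-integrable D (fun t => (g t)%:E) -> (forall t, f t ^+ 2 <= g t) ->
  sqint (f \_ D).
Proof.
move=> mf ig fg.
apply: (@sqint_le _ _ (g \_ D)).
- by apply/(measurable_restrictT _ (measurable_itv _)).
- move: ig; rewrite integrable_mkcond//; congr integrable.
  by rewrite -restrict_EFin.
- by move=> t; rewrite !patchE; case: ifP => // _; rewrite expr0n.
Qed.

Lemma restrict_halfline (f : R -> R) t : t <= 0 -> (f \_ D) t = 0.
Proof.
move=> t0; rewrite patchE; case: ifPn => // /set_mem /=.
by rewrite in_itv/= andbT ltNge t0.
Qed.

Lemma L2ip_iota (u v : test_space R) : L2ip (iota_L2 u) (iota_L2 v) = wform 0 u v.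
Proof.
rewrite /L2ip -halfintT; last exact: cc_val_val.
by apply: eq_halfint => t _; rewrite powRr0 mul1r.
Qed.

Lemma iota_L2B (u v : test_space R) : iota_L2 (u - v) = iota_L2 u - iota_L2 v.
Proof. exact/val_inj. Qed.

(** The comparison of the weighted form with the energy at exponent 0 is the embedding of the energy
    space into L2. *)
Lemma iota_L2_cauchy s : sip_cauchy E s -> sip_cauchy (@L2ip R) (fun k => iota_L2 (s k)).
Proof.
move=> cs e e0; pose C := 2 / kin_coef R n + 1 / pot_coef n Lam.
have C0 : 0 < C by rewrite addr_gt0// divr_gt0.
have [N HN] := cs _ (divr_gt0 e0 C0); exists N => k l Nk Nl.
rewrite -iota_L2B L2ip_iota.
apply: (le_lt_trans (wform_le al0 be0 (lexx 0) (ler0n _ 2) _)).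
by have := HN k l Nk Nl; rewrite ltr_pdivlMr// mulrC.
Qed.

Lemma sip_cauchy_shift (F : sqint_space R) s : sip_cauchy (@L2ip R) s ->
  sip_cauchy (@L2ip R) (fun k => F - s k).
Proof.
move=> cs e e0; have [N HN] := cs e e0; exists N => k l Nk Nl.
have -> : F - s k - (F - s l) = - (s k - s l).
  by rewrite !opprB addrC subrKA.
by rewrite (sipNl sL) (sipNr sL) opprK; exact: HN.
Qed.

(** [F] is approximated in L2 by a test function, which is then expanded in energy. Convergence is
    part of the conclusion because the limits for real and imaginary parts are later added under a
    square root. *)
Lemma L2_combination (F : sqint_space R) e : (forall t, t <= 0 -> val F t = 0) -> 0 < e ->
  exists N (c : nat -> R), let G k := F - iota_L2 (rsum N c w k) in
    cvg ((fun k => L2ip (G k) (G k)) @ \oo) /\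
    lim ((fun k => L2ip (G k) (G k)) @ \oo) < e.
Proof.
move=> F0 e0.
(* The two errors, [e / 8] in L2 and [e / (8 * C)] in energy, are doubled when added, the second
   being multiplied by [C] as well; together they give [e / 2]. *)
have e4 : 0 < e / 8 by rewrite divr_gt0.
have [u Hu] := halfline_approximable F0 e4.
pose C := 2 / kin_coef R n + 1 / pot_coef n Lam.
have C0 : 0 < C by rewrite addr_gt0// divr_gt0.
have eC : 0 < e / (8 * C) by rewrite divr_gt0// mulr_gt0.
have cu : sip_cauchy E (fun=> u).
  by move=> d d0; exists 0%N => k l _ _; rewrite subrr (sip0l sE).
have [N [c h]] := complete_w cu eC.
exists N, c => G.
have cG : sip_cauchy (@L2ip R) G.
  by apply: sip_cauchy_shift; apply: iota_L2_cauchy; exact: rsum_cauchy.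
have cGG := sip_cauchy_cvg sL cG cG; split => //.
pose X k := E (u - rsum N c w k) (u - rsum N c w k).
have cX : cvg (X @ \oo) by apply: (sip_cauchy_cvg sE); exact: rsum_sub_cauchy.
have cY : (fun k => e / 4 + 2 * C * X k) @ \oo --> e / 4 + 2 * C * lim (X @ \oo).
  by apply: cvgD; [exact: cvg_cst|apply: cvgMl_tmp].
have le_GX : lim ((fun k => L2ip (G k) (G k)) @ \oo) <=
    lim ((fun k => e / 4 + 2 * C * X k) @ \oo).
  apply: (ler_lim cGG (cvgP _ cY)); apply: nearW => k.
  rewrite /G -(subrK (iota_L2 u) F) -addrA -iota_L2B.
  apply: (le_trans (sip_sqrD_le sL _ _)); rewrite L2ip_iota.
  have := wform_le al0 be0 (lexx 0) (ler0n _ 2) (u - rsum N c w k).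
  by rewrite -/C -/(X k) -mulrA; move: (C * X k) => y; lra.
apply: (le_lt_trans le_GX); have /cvg_lim -> // := cY.
move: h; rewrite -/X ltr_pdivlMr ?mulr_gt0//.
by rewrite -mulrA [C * _]mulrC => h; lra.
Qed.

Lemma complete_in_L2 f : inL2 f -> forall e : R, 0 < e ->
  exists (N : nat) (c : nat -> R[i]),
    limR (fun k => L2norm (fun t => f t - lincomb N c (fun i => embed (w i)) k t)) < e.
Proof.
move=> [mr mi jf] e e0.
have [F1 F1E] : exists F : sqint_space R, val F = (fun t => complex.Re (f t)) \_ D.
  by apply: sqint_ex; apply: (sqint_restrict mr jf) => t; rewrite lerDl sqr_ge0.
have [F2 F2E] : exists F : sqint_space R, val F = (fun t => complex.Im (f t)) \_ D.
  by apply: sqint_ex; apply: (sqint_restrict mi jf) => t; rewrite lerDr sqr_ge0.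
have e2 : 0 < e ^+ 2 / 2 by rewrite divr_gt0// exprn_gt0.
have z1 t : t <= 0 -> val F1 t = 0 by move=> t0; rewrite F1E restrict_halfline.
have z2 t : t <= 0 -> val F2 t = 0 by move=> t0; rewrite F2E restrict_halfline.
have [N1 [c1 [g1 h1]]] := L2_combination z1 e2.
have [N2 [c2 [g2 h2]]] := L2_combination z2 e2.
have [N [c [cE1 cE2]]] := combine_coefs N1 c1 N2 c2.
exists N, c.
set G1 := fun k => L2ip _ _ in g1 h1; set G2 := fun k => L2ip _ _ in g2 h2.
have nE k : L2norm (fun t => f t - lincomb N c (fun i => embed (w i)) k t) =
    Num.sqrt (G1 k + G2 k).
  rewrite /L2norm; congr Num.sqrt.
  rewrite /G1 /G2 /L2ip -RintegralD//; try exact: integrable_L2ip.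
  rewrite Rintegral_mkcond; apply: eq_Rintegral => t _.
  have valB (A : sqint_space R) u : val (A - iota_L2 u) t = val A t - val u t by [].
  rewrite !valB F1E F2E !patchE; case: ifPn => tD.
    by rewrite (lincomb_parts N c w k t) cE1 cE2; case: (f t) => x y /=; rewrite -!expr2.
  have t0 : t <= 0.
    by rewrite leNgt; apply: contra tD => t0; rewrite mem_set//= in_itv/= andbT.
  by rewrite !(test_eq0 _ t0) subrr mulr0 addr0.
have -> : limR (fun k => L2norm (fun t => f t - lincomb N c (fun i => embed (w i)) k t)) =
    Num.sqrt (lim (G1 @ \oo) + lim (G2 @ \oo)).
  rewrite /limR; under eq_fun do rewrite nE.
  apply/cvg_lim => //.
  have cD : (fun k => G1 k + G2 k) @ \oo --> lim (G1 @ \oo) + lim (G2 @ \oo).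
    exact: (cvgD g1 g2).
  have := @sqrt_continuous R (lim (G1 @ \oo) + lim (G2 @ \oo)) => cs.
  have H := @continuous_cvg _ _ _ \oo _ (fun k => G1 k + G2 k) _ _ cs cD.
  exact: H.
rewrite -[ltRHS](gtr0_norm e0) -sqrtr_sqr ltr_sqrt ?exprn_gt0//.
by apply: lt_le_trans (ltrD h1 h2) _; rewrite -splitr.
Qed.

End Completeness.

Unset Implicit Arguments.

Theorem theorem3p2 (R : realType) (n : nat) (Lam : R)
  (hn : (3 <= n)%N) (hLam : Lam < 0) :
  exists (w : nat -> nat -> R -> R[i]) (lam : nat -> R),
    [/\ (forall i, inH n Lam (w i)),
        (forall i (phi : nat -> R -> R[i]), inH n Lam phi ->
           BH n Lam (w i) phi = Complex (lam i) 0 * KH n (w i) phi),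
        [/\ 0 < lam 0%N, (forall i, lam i < lam i.+1) & lam @ \oo --> +oo],
        (forall i j, KH n (w i) (w j) = Complex (if i == j then 1 else 0) 0) &
        ((forall phi : nat -> R -> R[i], inH n Lam phi ->
           forall e : R, 0 < e -> exists (N : nat) (c : nat -> R[i]),
             BHnorm n Lam (fun k t => phi k t - lincomb N c w k t) < e) /\
        (forall f : R -> R[i], inL2 f ->
           forall e : R, 0 < e -> exists (N : nat) (c : nat -> R[i]),
             limR (fun k => L2norm (fun t => f t - lincomb N c w k t)) < e))].
Proof.
have al0 := @kin_coef_gt0 R n hn; have be0 := @pot_coef_gt0 R n Lam hn hLam.
have sK := wform_semi_inner (R := R) (wexp R n).
have [w [lam [cw eig lams orth compl]]] :=
  test_spectrum al0 be0 (wexp_ge0 R hn) (wexp_lt2 R hn).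
exists (fun i => embed (w i)), lam; split => //.
- by move=> i; exact: embed_inH.
- move=> i phi /(inH_parts hn hLam)[u [v [phiE cu cv]]].
  rewrite (BH_embed hn hLam (w i) phiE) (KH_embed n (w i) phiE).
  rewrite (eig i u cu) (eig i v cv).
  by apply/eqP; rewrite eq_complex /=; apply/andP; split; apply/eqP; ring.
- move=> i j; rewrite (KH_embed n (w i) (embed_parts (w j))) orth.
  congr Complex; first by case: (i == j).
  by under eq_fun do rewrite (sip0r sK); rewrite lim_cst.
- split; first exact: (complete_in_H hn hLam cw compl).
  exact: (complete_in_L2 hn hLam cw compl).
Qed.
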